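(* Let $L$ be an integral Euclidean lattice of rank $l$, let $\alpha\in\mathbb{C}^l$, and let $g=e^{-2\pi i\alpha(0)}$, an automorphism of the lattice vertex operator superalgebra $V_L=\bigoplus_{\mu\in L}M_\mu$. Put $V_{L+\alpha}=\bigoplus_{\mu\in L}M_{\mu+\alpha}$. Then $(V_{L+\alpha},\mathcal{Y})\cong(V_L,Y_g)$ as $g$-twisted $V_L$-modules, where $$Y_g(u\otimes e^\mu,z)=\mathcal{Y}\big(\Delta(\alpha,z)(u\otimes e^\mu),z\big),\qquad \Delta(\alpha,z)=z^{\alpha(0)}Y_+(\alpha,-z),$$ for $u\otimes e^\mu\in V_L$.
   Context: For $\alpha,\beta\in\mathbb{C}^l$ write $\alpha\cdot\beta=\sum_{i=1}^l\alpha^i\beta^i$ (complex bilinear), $\alpha^2=\alpha\cdot\alpha$; $L\subset\mathbb{R}^l\subset\mathbb{C}^l$ with $\mu\cdot\nu\in\mathbb{Z}$ for $\mu,\nu\in L$. $M^l$ is the rank $l$ Heisenberg vertex operator algebra, generated by weight one vectors $a^1,\dots,a^l$ whose modes satisfy $[a^i(n),a^j(m)]=n\,\delta_{n,-m}\delta_{i,j}$; it is spanned by the vectors $a^{i_1}(-k_1)\cdots a^{i_r}(-k_r)\mathbf{1}$, $k_j>0$, with Virasoro vector $\omega=\frac12\sum_i a^i(-1)^2\mathbf{1}$. For $\alpha\in\mathbb{C}^l$, $M_\alpha=M^l\otimes e^\alpha$ is the irreducible $M^l$-module with $a^i(0)(u\otimes e^\alpha)=\alpha^i(u\otimes e^\alpha)$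 and $a^i(n)(u\otimes e^\alpha)=(a^i(n)u)\otimes e^\alpha$ for $n\ne0$. For $u\in M^l$, $Y(u,z)$ denotes the (module) vertex operator on every $M_\alpha$. Put $\alpha(n)=\sum_i\alpha^ia^i(n)$, $Y_\pm(\alpha,z)=\exp\big(\mp\sum_{n>0}\frac{\alpha(\pm n)}{n}z^{\mp n}\big)$, $\mathcal{M}=\bigoplus_{\beta\in\mathbb{C}^l}M_\beta$. The operator $e^{\alpha\cdot q}$ on $\mathcal{M}$ is $u\otimes e^\beta\mapsto u\otimes e^{\alpha+\beta}$. Cocycle structure: $\epsilon:\mathbb{C}^l\times\mathbb{C}^l\to\mathbb{C}^\times$ with $\epsilon(\alpha,0)=\epsilon(0,\alpha)=1$; $c_\alpha(u\otimes e^\beta)=\epsilon(\alpha,\beta)u\otimes e^\beta$ and $e^\alpha=e^{\alpha\cdot q}c_\alpha$ as an operator on $\mathcal{M}$; it is assumed that $e^\alpha e^\beta=\epsilon(\alpha,\beta)e^{\alpha+\beta}$, $e^0=1$, and that the commutator function $C(\alpha,\beta)=\epsilon(\alpha,\beta)/\epsilon(\beta,\alpha)$ satisfies $C(\mu_1,\mu_2)=(-1)^{\mu_1\cdot\mu_2+\mu_1^2\mu_2^2}$ for $\mu_1,\mu_2\in L$. The vertex operators on $\mathcal{M}$ are $$\mathcal{Y}(u\otimes e^\alpha,z)=e^\alpha Y_-(\alpha,z)Y(u,z)Y_+(\alpha,z)z^{\alpha(0)},$$ with $z^{\alpha(0)}$ acting on $M_\gamma$ as $z^{\alpha\cdot\gamma}$,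 extended linearly in the first argument. With parity $p(u\otimes e^\mu)=\mu^2\bmod 2$, $(V_L,\mathcal{Y},\mathbf{1},\omega)$ is a vertex operator superalgebra (VOSA). On $V_{L+\alpha}$ the twisted vertex operators for $v\in V_L$ are the restrictions of $\mathcal{Y}(v,z)$. Twisted modules: let $g$ be an automorphism of a VOSA $V$ (a linear map preserving $\mathbf{1},\omega$ with $gY(v,z)g^{-1}=Y(gv,z)$) such that $V$ decomposes into $g$-eigenspaces, $V^\rho$ being the eigenspace with eigenvalue $e^{2\pi i\rho}$, $\rho\in\mathbb{C}$. A $g$-twisted $V$-module is a pair $(W^g,Y_g)$ where $W^g=\bigoplus_{r\in\mathbb{C}}W^g_r$ with $\dim W^g_r<\infty$ and, for each $r$, $W^g_{r+n}=0$ for $n\ll0$; $Y_g$ is a linear map from $V$ to $\mathrm{End}(W^g)$-valued formal series in $z$ with arbitrary complex powers, such that: for $v\in V^\rho$, $Y_g(v,z)=\sum_{n\in\rho+\mathbb{Z}}v_g(n)z^{-n-1}$ with $v_g(\rho+k)w=0$ for $w\in W^g$ and $k\in\mathbb{Z}$ sufficiently large; $Y_g(\mathbf{1},z)=\mathrm{Id}_{W^g}$; $Y_g(\omega,z)=\sum_nL_g(n)z^{-n-2}$ with $L_g(0)w=rw$ for $w\in W^g_r$; and for $u\in V^\rho$, $v\in V$, with $p(u,v)=p(u)p(v)$, $$z_0^{-1}\delta\left(\tfrac{z_1-z_2}{z_0}\right)Y_g(u,z_1)Y_g(v,z_2)-(-1)^{p(u,v)}z_0^{-1}\delta\left(\tfrac{z_2-z_1}{-z_0}\right)Y_g(v,z_2)Y_g(u,z_1)=z_2^{-1}\left(\tfrac{z_1-z_0}{z_2}\right)^{-\rho}\delta\left(\tfrac{z_1-z_0}{z_2}\right)Y_g(Y(u,z_0)v,z_2).$$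 Here $\delta(x/y)=\sum_{n\in\mathbb{Z}}x^ny^{-n}$ and $(x+y)^\kappa=\sum_{m\ge0}\binom{\kappa}{m}x^{\kappa-m}y^m$. An isomorphism of $g$-twisted modules is a linear isomorphism intertwining the twisted vertex operators of all $v\in V$. *)

(* Defs.v *)
(* mathcomp-analysis (R : realType, cos, sin, finitely supported
   sums), real-closed (R[i]) and multinomials' monalg ({malg G[K]}: finitely
   supported functions K -> G, here used as the free module on K). *)
From HB Require Import structures.
From mathcomp Require Import all_boot all_order all_algebra.
From mathcomp Require Import finmap monalg complex.
From mathcomp Require Import all_classical all_reals.
From mathcomp Require Import topology normedtype sequences exp trigo.

Set Implicit Arguments.
Unset Strict Implicit.
Unset Printing Implicit Defensive.

Import Order.TTheory GRing.Theory Num.Theory.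

Local Open Scope classical_set_scope.
Local Open Scope ring_scope.

(** * Scalars *)

Definition cexp (R : realType) (z : R[i]) : R[i] :=
  (expR (complex.Re z))%:C%C *
  Complex (cos (complex.Im z)) (sin (complex.Im z)).

Definition two_pi_i (R : realType) : R[i] := Complex 0 (2 * pi).

(* the generalized binomial coefficient kappa (kappa-1) ... (kappa-m+1) / m! *)
Definition cbinom (F : fieldType) (kappa : F) (m : nat) : F :=
  (\prod_(i < m) (kappa - i%:R)) / m`!%:R.

Definition dot (F : pzRingType) (l : nat) (a b : 'rV[F]_l) : F :=
  \sum_(i < l) a 0 i * b 0 i.

(** * Formal series with complex exponents

   A series \sum_s x_s z^s with coefficients in X is its coefficient function
   C -> X, and an operator-valued one is a function C -> W -> W.  All sums over
   infinite sets are \sum_(i \in D) of mathcomp-analysis: the sum of the nonzero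
   terms when there are finitely many of them, 0 otherwise. *)

(* coefficients of \sum_(i \in D) c_i z^(e_i), in possibly several variables *)
Definition formal_sum (E : Type) (I : choiceType) (X : zmodType)
    (D : set I) (e : I -> E) (c : I -> X) (s : E) : X :=
  \sum_(i \in D `&` [set i | e i = s]) c i.

Section Series.
Variables (F : fieldType) (W : lmodType F).

Definition opseries := F -> W -> W.

Definition op_sum (I : choiceType) (D : set I) (e : I -> F)
    (A : I -> W -> W) : opseries :=
  fun s w => formal_sum D e (fun i => A i w) s.

Definition op_one : opseries := fun s w => if s == 0 then w else 0.

Definition op_add (A B : opseries) : opseries := fun s w => A s w + B s w.

Definition op_mul (A B : opseries) : opseries :=
  fun s w => \sum_(t \in [set: F]) A t (B (s - t) w).

Definition op_exp (A : opseries) : opseries :=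
  fun s w => \sum_(k \in [set: nat]) (k`!%:R)^-1 *: iter k (op_mul A) op_one s w.

(* the product of a scalar series and a W-valued one in (z_0, z_1, z_2) *)
Definition mul3 (K : F * F * F -> F) (X : F * F * F -> W) : F * F * F -> W :=
  fun s => \sum_(t \in [set: F * F * F]) K t *: X (s - t).

End Series.

(** * The delta functions of the Jacobi identity

   The exponents are those of (z_0, z_1, z_2); the index (n, m) is the m-th term
   of the binomial expansion of the n-th term of the delta function. *)
Section Delta.
Variable F : fieldType.

(* z_0^-1 delta((z_1 - z_2) / z_0) = \sum_n z_0^(-n-1) (z_1 - z_2)^n *)
Definition delta12 : F * F * F -> F :=
  formal_sum [set: int * nat]
    (fun p => ((- p.1 - 1)%:~R, p.1%:~R - p.2%:R, p.2%:R))
    (fun p => cbinom p.1%:~R p.2 * (-1) ^+ p.2).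

(* z_0^-1 delta((z_2 - z_1) / (- z_0)) =
   \sum_n (-1)^n z_0^(-n-1) (z_2 - z_1)^n *)
Definition delta21 : F * F * F -> F :=
  formal_sum [set: int * nat]
    (fun p => ((- p.1 - 1)%:~R, p.2%:R, p.1%:~R - p.2%:R))
    (fun p => (-1) ^ p.1 * (cbinom p.1%:~R p.2 * (-1) ^+ p.2)).

(* z_2^-1 ((z_1 - z_0) / z_2)^(- rho) delta((z_1 - z_0) / z_2) =
   \sum_n z_2^(-1-(n-rho)) (z_1 - z_0)^(n-rho) *)
Definition delta10 (rho : F) : F * F * F -> F :=
  formal_sum [set: int * nat]
    (fun p => (p.2%:R, p.1%:~R - rho - p.2%:R, - 1 - (p.1%:~R - rho)))
    (fun p => cbinom (p.1%:~R - rho) p.2 * (-1) ^+ p.2).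

End Delta.

(** * Subspaces, as sets of vectors of an ambient space *)
Section Subspace.
Variables (F : fieldType) (W : lmodType F).

Definition is_subspace (S : set W) : Prop :=
  S 0 /\ forall (a : F) (u v : W), S u -> S v -> S (a *: u + v).

Definition fin_dim (S : set W) : Prop :=
  exists (n : nat) (b : 'I_n -> W),
    forall w, S w -> exists c : 'I_n -> F, w = \sum_(i < n) c i *: b i.

Definition is_family (I : choiceType) (Si : I -> set W) (f : I -> W) : Prop :=
  finite_set [set i | f i != 0] /\ forall i, Si i (f i).

(* S is the (internal) direct sum of the Si *)
Definition direct_sum (I : choiceType) (S : set W) (Si : I -> set W) : Prop :=
  [/\ forall i, is_subspace (Si i),
      forall w, S w <->
        exists2 f, is_family Si f & w = \sum_(i \in [set: I]) f i
    & forall f, is_family Si f -> \sum_(i \in [set: I]) f i = 0 ->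
        forall i, f i = 0].

Definition linear_on (X : lmodType F) (S : set W) (f : W -> X) : Prop :=
  forall (a : F) (u v : W), S u -> S v -> f (a *: u + v) = a *: f u + f v.

End Subspace.

(** * Twisted modules *)

(* the data of a vertex operator superalgebra: underlying space, even (false)
   and odd (true) parts, vertex operators, vacuum and Virasoro vector; everything
   lives inside an ambient space U, and only the values of vosa_Y on vosa_space
   matter *)
Record vosa_data (F : fieldType) (U : lmodType F) := VosaData {
  vosa_space : set U;
  vosa_parity : bool -> set U;
  vosa_Y : U -> F -> U -> U;
  vosa_one : U;
  vosa_omega : U
}.

Section Twisted.
Variables (R : realType) (U W : lmodType R[i]).
Variables (V : vosa_data U) (g : U -> U).

Local Notation C := R[i].

Record diagonalizable_automorphism : Prop := {
  aut_bij : set_bij (vosa_space V) (vosa_space V) g;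
  aut_linear : linear_on (vosa_space V) g;
  aut_one : g (vosa_one V) = vosa_one V;
  aut_omega : g (vosa_omega V) = vosa_omega V;
  aut_Y : forall v w s, vosa_space V v -> vosa_space V w ->
    g (vosa_Y V v s w) = vosa_Y V (g v) s (g w);
  aut_diag : direct_sum (vosa_space V)
    (fun lambda : C => [set v | vosa_space V v /\ g v = lambda *: v])
}.

Definition eigen (rho : C) : set U :=
  [set v | vosa_space V v /\ g v = cexp (two_pi_i R * rho) *: v].

(* Y v s w is the coefficient of z^s in Y_g(v, z) w *)
Variables (S : set W) (Y : U -> C -> W -> W).

Definition mode (v : U) (n : C) (w : W) : W := Y v (- n - 1) w.

Definition twisted_jacobi : Prop :=
  forall (rho : C) (p q : bool) (u v : U) (w : W),
    eigen rho u -> vosa_parity V p u -> vosa_parity V q v -> S w ->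
  forall s : C * C * C,
    mul3 (@delta12 C)
      (fun t => if t.1.1 == 0 then Y u t.1.2 (Y v t.2 w) else 0) s
    - (-1) ^+ (p && q) *: mul3 (@delta21 C)
      (fun t => if t.1.1 == 0 then Y v t.2 (Y u t.1.2 w) else 0) s
    = mul3 (delta10 rho)
      (fun t => if t.1.2 == 0 then Y (vosa_Y V u t.1.1 v) t.2 w else 0) s.

Record twisted_module : Prop := {
  tw_space : is_subspace S;
  tw_closed : forall v s w, vosa_space V v -> S w -> S (Y v s w);
  tw_linear_l : forall s w, S w -> linear_on (vosa_space V) (fun v => Y v s w);
  tw_linear_r : forall v s, vosa_space V v -> linear_on S (Y v s);
  tw_grading : exists Sr : C -> set W,
    [/\ direct_sum S Sr,
        forall r, fin_dim (Sr r),
        forall r, exists N : int, forall n : int, n <= N ->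
          Sr (r + n%:~R) `<=` [set 0]
      & forall r w, Sr r w -> mode (vosa_omega V) 1 w = r *: w];
  tw_exponents : forall rho v, eigen rho v -> forall n w, S w ->
    (forall k : int, n <> rho + k%:~R) -> mode v n w = 0;
  tw_truncation : forall rho v, eigen rho v -> forall w, S w ->
    exists K : int, forall k : int, K <= k -> mode v (rho + k%:~R) w = 0;
  tw_one : forall s w, S w -> Y (vosa_one V) s w = op_one s w;
  (* Y_g(omega, z) = \sum_(n in Z) L_g(n) z^(-n-2); L_g(0) is in tw_grading *)
  tw_omega : forall s w, S w -> (forall n : int, s <> (- n - 2)%:~R) ->
    Y (vosa_omega V) s w = 0;
  tw_jacobi : twisted_jacobi
}.

End Twisted.

Definition twisted_isomorphic (R : realType) (U W1 W2 : lmodType R[i])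
    (V : vosa_data U) (g : U -> U)
    (S1 : set W1) (Y1 : U -> R[i] -> W1 -> W1)
    (S2 : set W2) (Y2 : U -> R[i] -> W2 -> W2) : Prop :=
  [/\ twisted_module V g S1 Y1, twisted_module V g S2 Y2
    & exists f : W1 -> W2,
        [/\ linear_on S1 f, set_bij S1 S2 f
          & forall v s w, vosa_space V v -> S1 w ->
              f (Y1 v s w) = Y2 v s (f w)]].

(** * Lattices *)

(* the Z-span of a basis of R^l, with integral inner products *)
Definition integral_lattice (R : realType) (l : nat) (L : set 'rV[R]_l) : Prop :=
  (exists2 B : 'M[R]_l, B \in unitmx &
     L = [set map_mx intr x *m B | x in [set: 'rV[int]_l]]) /\
  (forall mu nu, L mu -> L nu -> exists n : int, dot mu nu = n%:~R).

(** * The Heisenberg algebra and the space \bigoplus_beta M_beta *)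
Section Heisenberg.
Variables (R : realType) (l : nat).
Local Notation C := R[i].

(* M^l is the polynomial algebra on the creation operators; the variable (i, k)
   stands for a^i(-(k+1)) *)
Definition var : choiceType := ('I_l * nat)%type.
Definition fmon : choiceType := {cmonom var}.

(* the basis element (m, beta) is m 1 (x) e^beta *)
Definition key : choiceType := (fmon * 'rV[C]_l)%type.
Definition calM : lmodType C := {malg C[key]}.

Definition bvec (k : key) : calM := mkmalgU k 1.

Definition linext (X : lmodType C) (f : key -> X) (x : calM) : X :=
  \sum_(k <- msupp x) mcoeff k x *: f k.

(* V_T = \bigoplus_(beta \in T) M_beta *)
Definition sector (T : set 'rV[C]_l) : set calM :=
  [set x | forall k : key, k \in msupp x -> T k.2].

(* a^i(n): a^i(-(k+1)) is multiplication by the variable (i, k), and a^i(k+1) is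
   (k+1) times the derivation with respect to it *)
Definition heis (i : 'I_l) (n : int) : calM -> calM :=
  match n with
  | Posz 0 => linext (fun b : key => b.2 0 i *: bvec b)
  | Posz k.+1 => linext (fun b : key =>
      (k.+1 * b.1 (i, k))%:R *: bvec (divcm b.1 (ucm (i, k)), b.2))
  | Negz k => linext (fun b : key => bvec (mulcm b.1 (ucm (i, k)), b.2))
  end.

Definition vac : calM := bvec (onecm var, 0).

Definition omega : calM :=
  2^-1 *: \sum_(i < l) heis i (-1) (heis i (-1) vac).

(* The creation (n < 0) or annihilation (n >= 0) part of
   (1/k!) (d/dz)^k a^i(z) = \sum_n binom(-n-1, k) a^i(n) z^(-n-1-k) *)
Definition current_part (D : set int) (i : 'I_l) (k : nat) : opseries calM :=
  op_sum D (fun n => (- n - 1)%:~R - k%:R)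
    (fun n w => cbinom ((- n - 1)%:~R : C) k *: heis i n w).

(* Y(a^(i_1)(-k_1-1) ... a^(i_r)(-k_r-1) 1, z) on every M_beta, by
   Y(a^i(-k-1) u, z) = :(1/k!) (d/dz)^k a^i(z) Y(u, z): *)
Fixpoint Yseq (vs : seq var) : opseries calM :=
  if vs is (i, k) :: vs' then
    op_add (op_mul (current_part [set n | n < 0] i k) (Yseq vs'))
           (op_mul (Yseq vs') (current_part [set n | 0 <= n] i k))
  else @op_one _ calM.

(* the variables of m with multiplicity; Yseq does not depend on their order *)
Definition fmon_seq (m : fmon) : seq var :=
  flatten [seq nseq (m x) x | x <- (finsupp m : seq var)].

Definition Yheis (m : fmon) : opseries calM := Yseq (fmon_seq m).

Definition heisv (alpha : 'rV[C]_l) (n : int) (w : calM) : calM :=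
  \sum_(i < l) alpha 0 i *: heis i n w.

(* Y_+(alpha, c z), for a constant c *)
Definition Yplus (c : C) (alpha : 'rV[C]_l) : opseries calM :=
  op_exp (op_sum [set n : nat | (0 < n)%N] (fun n => - n%:R)
    (fun n w => - ((c ^- n / n%:R) *: heisv alpha n%:Z w))).

Definition Yminus (alpha : 'rV[C]_l) : opseries calM :=
  op_exp (op_sum [set n : nat | (0 < n)%N] (fun n => n%:R)
    (fun n w => (n%:R)^-1 *: heisv alpha (- n%:Z) w)).

(* z^(alpha(0)) *)
Definition zpow (alpha : 'rV[C]_l) : opseries calM :=
  fun s => linext (fun b : key => if s == dot alpha b.2 then bvec b else 0).

(* e^(c alpha(0)), for a constant c *)
Definition exp_zero_mode (c : C) (alpha : 'rV[C]_l) : calM -> calM :=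
  linext (fun b : key => cexp (c * dot alpha b.2) *: bvec b).

(* e^(alpha.q) *)
Definition shift_op (alpha : 'rV[C]_l) : calM -> calM :=
  linext (fun b : key => bvec (b.1, alpha + b.2)).

Section Cocycle.
Variable eps : 'rV[C]_l -> 'rV[C]_l -> C.

Definition coc (alpha : 'rV[C]_l) : calM -> calM :=
  linext (fun b : key => eps alpha b.2 *: bvec b).

(* e^alpha *)
Definition eop (alpha : 'rV[C]_l) (w : calM) : calM := shift_op alpha (coc alpha w).

Definition calY_basis (b : key) : opseries calM :=
  fun s w => eop b.2
    (op_mul (Yminus b.2)
      (op_mul (Yheis b.1) (op_mul (Yplus 1 b.2) (zpow b.2))) s w).

Definition calY (v : calM) : opseries calM :=
  fun s w => linext (fun b => calY_basis b s w) v.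

(* Delta(alpha, z) = z^(alpha(0)) Y_+(alpha, -z) *)
Definition Delta (alpha : 'rV[C]_l) : opseries calM :=
  op_mul (zpow alpha) (Yplus (-1) alpha).

(* Y(Delta(alpha, z) v, z) *)
Definition Yg (alpha : 'rV[C]_l) (v : calM) : opseries calM :=
  fun s w => \sum_(t \in [set: C]) calY (Delta alpha t v) (s - t) w.

End Cocycle.

Definition embed (mu : 'rV[R]_l) : 'rV[C]_l := map_mx (real_complex R) mu.

Variable L : set 'rV[R]_l.

Record cocycle_structure (eps : 'rV[C]_l -> 'rV[C]_l -> C) : Prop := {
  eps_neq0 : forall a b, eps a b != 0;
  eps_right0 : forall a, eps a 0 = 1;
  eps_left0 : forall a, eps 0 a = 1;
  eop_mul : forall a b w, eop eps a (eop eps b w) = eps a b *: eop eps (a + b) w;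
  eop_zero : forall w, eop eps 0 w = w;
  eps_comm : forall mu nu, L mu -> L nu -> forall m n k : int,
    dot mu mu = m%:~R -> dot nu nu = n%:~R -> dot mu nu = k%:~R ->
    eps (embed mu) (embed nu) / eps (embed nu) (embed mu) = (-1) ^ (k + m * n)
}.

Definition lattice_sector (alpha : 'rV[C]_l) : set calM :=
  sector [set embed mu + alpha | mu in L].

(* V_L, with p(u (x) e^mu) = mu^2 mod 2 *)
Definition lattice_vosa (eps : 'rV[C]_l -> 'rV[C]_l -> C) : vosa_data calM :=
  {| vosa_space := sector (embed @` L);
     vosa_parity := fun p : bool => sector
       [set embed mu | mu in L `&`
          [set mu | exists2 n : int, dot mu mu = n%:~R & odd `|n|%N = p]];
     vosa_Y := calY eps;
     vosa_one := vac;
     vosa_omega := omega |}.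

End Heisenberg.

(* Main.v *)
Require Import Defs.
From HB Require Import structures.
From mathcomp Require Import all_boot all_order all_algebra.
From mathcomp Require Import finmap monalg complex.
From mathcomp Require Import all_classical all_reals.
From mathcomp Require Import topology normedtype sequences exp trigo.
From mathcomp Require Import ring zify.

Set Implicit Arguments.
Unset Strict Implicit.
Unset Printing Implicit Defensive.

Import Order.TTheory GRing.Theory Num.Theory.

Local Open Scope classical_set_scope.
Local Open Scope ring_scope.

(** The Jacobi identity is compared coefficient by coefficient, at z_0^(-n-1) z_1^s1 z_2^s2,
    where each of its three terms is a sum over one natural number; the difference of its
    two sides is the trilinear map jacobi_defect. Two facts about the Heisenberg modes a(n)
    reduce it to the vectors e^mu: the iterate formula, by which Y(a(-k-1) u, z) is the
    normally ordered product of the k-th divided derivative of a(z) with Y(u, z), and the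
    formula for the commutator of a(n) with Y(v, z). They express the defect at a(-k-1) u,
    or at a(-k-1) v if u = e^mu, by defects at u and v (left_step, right_step), and induction
    on monomials leaves u = e^mu and v = e^nu.

    For these the defects at all exponents form a family that is closed under commutators
    with the modes. Such a family vanishes on M_beta as soon as the constant terms of its
    values on e^beta do (coherent_family_eq0), because the positive modes recover a vector
    from constant terms and the negative ones generate M_beta from e^beta. The constant
    terms are those of (1 - z_2 / z_1)^(mu.nu) for the products and of
    (1 + z_0 / z_2)^(mu.beta) for the iterate, times values of the cocycle. The cocycle
    identity and the commutator function reduce their comparison to the identity of three
    delta functions (delta_identity, jacobi_sector).

    On V_(L + alpha) the exponents of z_1 lie in mu.alpha + Z, and mu.alpha is in - rho + Z
    exactly if e^mu belongs to the eigenvalue e^(2 pi i rho) of g (eigen_momenta); hence the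
    identity is the twisted one. The vector m 1 (x) e^beta has L(0)-eigenvalue
    wt(m) + beta^2 / 2, and the eigenspaces are finite-dimensional because a lattice has
    finitely many points in a ball (conformal_weight, energy_finite).

    The isomorphism maps m 1 (x) e^(beta + alpha) to eps(beta, alpha)^-1 m 1 (x) e^beta. It
    commutes with a(n) for nonzero n and shifts a(0) by alpha. In the iterate formula for
    Y(a(-k-1) u, z) the shift adds a multiple of z^(-k-1) Y(u, z), and the same multiple
    arises when a(-k-1) passes through Delta(alpha, z) (reduced_creation). Thus both sides of the
    intertwining relation satisfy the same recursion in the monomial, and on e^mu they are
    compared by constant terms again (flow_vertex, flow_intertwines). The axioms for
    (V_L, Y_g) follow by transport along the isomorphism (twisted_module_transport). *)

(** * Finite sums over the natural numbers and binomial coefficients *)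

Definition nsum (V : zmodType) (f : nat -> V) : V := \sum_(n \in [set: nat]) f n.

(** The sums over natural numbers below have finitely many nonzero terms, but exchanging
    two of them needs a joint bound; fin1, fin2 and fin3 are such bounds for one, two and three
    summation indices. *)
Definition fin1 (V : zmodType) (f : nat -> V) : Prop :=
  exists N, forall n, (N <= n)%N -> f n = 0.

Definition fin2 (V : zmodType) (f : nat -> nat -> V) : Prop :=
  exists N, forall i j, (N <= i + j)%N -> f i j = 0.

Lemma nsumE (V : zmodType) N (f : nat -> V) : (forall n, (N <= n)%N -> f n = 0) -> nsum f = \sum_(n < N) f n.
Proof.
move=> h; rewrite /nsum -(fsbig_widen `I_N) //; first by rewrite -fsbig_ord.
move=> n /= [_ /negP]; rewrite -leqNgt; exact: h.
Qed.

Section Nsum.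
Variable V : zmodType.
Implicit Types (f g : nat -> V) (F : nat -> nat -> V).

Lemma eq_nsum f g : f =1 g -> nsum f = nsum g.
Proof. by move=> /funext ->. Qed.

Lemma nsum0 : nsum (fun=> 0 : V) = 0.
Proof. by rewrite (@nsumE _ 0) // big_ord0. Qed.

Lemma nsum_eq0 f : (forall n, f n = 0) -> nsum f = 0.
Proof. by move=> h; rewrite (eq_nsum h) nsum0. Qed.

Lemma fin1_eq f g : f =1 g -> fin1 f -> fin1 g.
Proof. by move=> /funext ->. Qed.

Lemma fin1D f g : fin1 f -> fin1 g -> fin1 (fun n => f n + g n).
Proof.
move=> [N hN] [M hM]; exists (maxn N M) => n; rewrite geq_max => /andP[? ?].
by rewrite hN // hM // addr0.
Qed.

Lemma fin1N f : fin1 f -> fin1 (fun n => - f n).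
Proof. by move=> [N hN]; exists N => n /hN ->; rewrite oppr0. Qed.

Lemma nsumD f g : fin1 f -> fin1 g ->
  nsum (fun n => f n + g n) = nsum f + nsum g.
Proof.
move=> [N hN] [M hM].
have hf n : (maxn N M <= n)%N -> f n = 0 by rewrite geq_max => /andP[/hN].
have hg n : (maxn N M <= n)%N -> g n = 0 by rewrite geq_max => /andP[_ /hM].
rewrite (nsumE hf) (nsumE hg) (@nsumE _ (maxn N M)) ?big_split //.
by move=> n hn; rewrite hf // hg // addr0.
Qed.

Lemma nsum_lin (U : zmodType) (h : V -> U) f :
  h 0 = 0 -> (forall x y, h (x + y) = h x + h y) -> fin1 f ->
  h (nsum f) = nsum (fun n => h (f n)).
Proof.
move=> h0 hD [N hN]; rewrite (nsumE hN) (@nsumE _ N); last by move=> n /hN ->.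
by apply: (big_morph h).
Qed.

Lemma nsumN f : fin1 f -> nsum (fun n => - f n) = - nsum f.
Proof.
move=> hf; apply/esym/(nsum_lin (h := fun x => - x)) => //; first exact: oppr0.
exact: opprD.
Qed.

Lemma nsum_shift k f : (forall i, (i < k)%N -> f i = 0) ->
  nsum f = nsum (fun n => f (k + n)%N).
Proof.
move=> hk; rewrite /nsum -(fsbig_widen [set n | (k <= n)%N]) //.
  apply: reindex_fsbig; split => //=.
  - by move=> n _ /=; exact: leq_addr.
  - by move=> i j _ _ /addnI.
  - by move=> n /= hn; exists (n - k)%N => //; rewrite subnKC.
by move=> n /= [_ /negP]; rewrite -ltnNge; exact: hk.
Qed.

Lemma nsum1 j f : (forall i, i != j -> f i = 0) -> nsum f = f j.
Proof.
move=> h; rewrite /nsum -(fsbig_widen [set j]) //; first by rewrite fsbig_set1.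
by move=> n /= [_ /eqP hn]; apply: h.
Qed.

Lemma fin2_rows F : (exists N, forall i, (N <= i)%N -> forall j, F i j = 0) ->
  (forall i, fin1 (F i)) -> fin2 F.
Proof.
move=> [N hN] /choice[M hM]; exists (N + \sum_(i < N) M i)%N => i j h.
have [hi|hi] := leqP N i; first exact: hN.
apply: hM; move: h; rewrite (bigD1 (Ordinal hi)) //=; lia.
Qed.

Lemma fin2_swap F : fin2 F -> fin2 (fun i j => F j i).
Proof. by move=> [N hN]; exists N => i j h; apply: hN; rewrite addnC. Qed.

Lemma fin2_cols F : (exists N, forall j, (N <= j)%N -> forall i, F i j = 0) ->
  (forall j, fin1 (fun i => F i j)) -> fin2 F.
Proof. by move=> h1 h2; apply/fin2_swap/fin2_rows. Qed.

Lemma fin2_row F i : fin2 F -> fin1 (F i).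
Proof. by move=> [N hN]; exists N => j h; apply: hN; lia. Qed.

Lemma fin2_nsum F : fin2 F -> fin1 (fun i => nsum (F i)).
Proof.
by move=> [N hN]; exists N => i h; apply: nsum_eq0 => j; apply: hN; lia.
Qed.

Lemma fin2_nsumC F : fin2 F -> fin1 (fun j => nsum (fun i => F i j)).
Proof. by move=> /fin2_swap/fin2_nsum. Qed.

Lemma nsum_exch F : fin2 F ->
  nsum (fun i => nsum (F i)) = nsum (fun j => nsum (fun i => F i j)).
Proof.
move=> [N hN].
have e1 i : nsum (F i) = \sum_(j < N) F i j by apply: nsumE => j h; apply: hN; lia.
have e2 j : nsum (fun i => F i j) = \sum_(i < N) F i j.
  by apply: nsumE => i h; apply: hN; lia.
rewrite (eq_nsum e1) (eq_nsum e2) (@nsumE _ N); last first.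
  by move=> n h; rewrite big1 // => j _; apply: hN; lia.
rewrite (@nsumE _ N); last by move=> n h; rewrite big1 // => j _; apply: hN; lia.
exact: exchange_big.
Qed.

Lemma nsum_diag F : fin2 F ->
  nsum (fun i => nsum (F i)) = nsum (fun n => \sum_(i < n.+1) F i (n - i)%N).
Proof.
move=> [N hN].
have e1 i : nsum (F i) = \sum_(j < N) F i j by apply: nsumE => j h; apply: hN; lia.
rewrite (eq_nsum e1) (@nsumE _ N); last first.
  by move=> n h; rewrite big1 // => j _; apply: hN; lia.
rewrite (@nsumE _ N); last first.
  move=> n h; rewrite big1 // => -[i hi] _ /=; apply: hN; lia.
have inner i : \sum_(j < N) F i j = \sum_(n < N | (i <= n)%N) F i (n - i)%N.
  rewrite -(big_mkord xpredT) -(big_mkord (fun n => (i <= n)%N) (fun n => F i (n - i)%N)).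
  have -> : \sum_(0 <= j < N) F i j = \sum_(i <= n < N + i) F i (n - i)%N.
    rewrite -[X in index_iota X (N + i)]add0n big_addn addnK; apply: eq_bigr => j _.
    by rewrite addnK.
  have [hi|hi] := leqP i N; last first.
    rewrite big_nat_cond big_pred0; last by move=> n; lia.
    by rewrite big_nat_cond big1 // => j /andP[/andP[h1 h2] _]; apply: hN; lia.
  rewrite (@big_cat_nat _ _ _ N) ?leq_addr //=.
  rewrite [X in _ + X]big_nat_cond [X in _ + X]big1 ?addr0; last first.
    by move=> j /andP[/andP[h1 h2] _]; apply: hN; lia.
  rewrite [RHS](@big_cat_nat _ _ _ i) //= [X in _ = X + _]big_nat_cond.
  rewrite [X in _ = X + _]big_pred0 ?add0r; last by move=> n; lia.
  by rewrite big_nat_cond [RHS]big_nat_cond; apply: eq_bigl => n; lia.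
under eq_bigr => i _ do rewrite inner.
rewrite (exchange_big_dep xpredT) //=.
apply: eq_bigr => n _.
rewrite -(big_mkord (fun i => (i <= n)%N) (fun i => F i (n - i)%N)).
rewrite -(big_mkord xpredT (fun i => F i (n - i)%N)).
rewrite (@big_cat_nat _ _ _ n.+1 0 N) ?(ltn_ord n) //=.
rewrite [X in _ + X]big_nat_cond [X in _ + X]big1 ?addr0; last first.
  by move=> j /andP[/andP[h _]]; rewrite leqNgt h.
by rewrite big_nat_cond [RHS]big_nat_cond; apply: eq_bigl => j; lia.
Qed.

End Nsum.

Section NsumScale.
Variables (F : fieldType) (W : lmodType F).

Lemma linear0' (U : lmodType F) (h : W -> U) : linear h -> h 0 = 0.
Proof. by move=> hl; have := hl (-1) 0 0; rewrite !scaleN1r !addNr. Qed.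

Lemma linearD' (U : lmodType F) (h : W -> U) : linear h ->
  forall x y, h (x + y) = h x + h y.
Proof. by move=> hl x y; have := hl 1 x y; rewrite !scale1r. Qed.

Lemma linearZ' (U : lmodType F) (h : W -> U) : linear h ->
  forall c x, h (c *: x) = c *: h x.
Proof. by move=> hl c x; rewrite -[c *: x]addr0 hl linear0' ?addr0. Qed.

Lemma linearN' (U : lmodType F) (h : W -> U) : linear h ->
  forall x, h (- x) = - h x.
Proof. by move=> hl x; rewrite -scaleN1r linearZ' // scaleN1r. Qed.

Lemma linearB' (U : lmodType F) (h : W -> U) : linear h ->
  forall x y, h (x - y) = h x - h y.
Proof. by move=> hl x y; rewrite linearD' // linearN'. Qed.

Lemma linear_sum' (U : lmodType F) (h : W -> U) (J : Type) (r : seq J)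
    (P : pred J) (G : J -> W) : linear h ->
  h (\sum_(j <- r | P j) G j) = \sum_(j <- r | P j) h (G j).
Proof. by move=> hl; apply: big_morph; [exact: linearD' | exact: linear0']. Qed.

Lemma linear_comp' (U V : lmodType F) (f : U -> V) (g : W -> U) :
  linear f -> linear g -> linear (fun w => f (g w)).
Proof. by move=> hf hg c u v; rewrite hg hf. Qed.

Lemma linear_add' (U : lmodType F) (f g : W -> U) :
  linear f -> linear g -> linear (fun w => f w + g w).
Proof. by move=> hf hg c u v; rewrite hf hg scalerDr addrACA. Qed.

Lemma linear_scale' (U : lmodType F) k (f : W -> U) :
  linear f -> linear (fun w => k *: f w).
Proof. by move=> hf c u v; rewrite hf scalerDr !scalerA mulrC. Qed.

Lemma linear_cst0 (U : lmodType F) : linear (fun _ : W => 0 : U).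
Proof. by move=> c u v; rewrite scaler0 addr0. Qed.

Lemma linear_id' : linear (fun w : W => w).
Proof. by []. Qed.

Lemma linear_bigsum (U : lmodType F) (J : Type) (r : seq J) (f : J -> W -> U) :
  (forall j, linear (f j)) -> linear (fun w => \sum_(j <- r) f j w).
Proof.
move=> hf c u v; rewrite scaler_sumr -big_split.
by apply: eq_bigr => j _; exact: hf.
Qed.

Lemma linear_nsum (U : lmodType F) (h : W -> U) (f : nat -> W) :
  linear h -> fin1 f -> h (nsum f) = nsum (fun n => h (f n)).
Proof. by move=> hl; apply: nsum_lin; [exact: linear0' | exact: linearD']. Qed.

Lemma fin1_linear (U : lmodType F) (h : W -> U) (f : nat -> W) :
  linear h -> fin1 f -> fin1 (fun n => h (f n)).
Proof. by move=> hl [N hN]; exists N => n /hN ->; rewrite linear0'. Qed.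

Lemma fin1_linear_fam (U : lmodType F) (h : nat -> W -> U) (f : nat -> W) :
  (forall n, linear (h n)) -> fin1 f -> fin1 (fun n => h n (f n)).
Proof. by move=> hl [N hN]; exists N => n /hN ->; rewrite linear0'. Qed.

Lemma fin1Z (c : nat -> F) (f : nat -> W) : fin1 f -> fin1 (fun n => c n *: f n).
Proof. by move=> [N hN]; exists N => n /hN ->; rewrite scaler0. Qed.

Lemma nsumZ c (f : nat -> W) : fin1 f -> c *: nsum f = nsum (fun n => c *: f n).
Proof.
by move=> hf; apply: (nsum_lin (h := *:%R c)) => //; [exact: scaler0|exact: scalerDr].
Qed.

Lemma nsum_conv (b c : nat -> F) (X : nat -> W) : fin1 X ->
  nsum (fun i => nsum (fun j => (b i * c j) *: X (i + j)%N)) =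
  nsum (fun n => (\sum_(i < n.+1) b i * c (n - i)%N) *: X n).
Proof.
move=> [N hN]; rewrite nsum_diag; last first.
  by exists N => i j /hN ->; rewrite scaler0.
apply: eq_nsum => n; rewrite scaler_suml; apply: eq_bigr => i _.
by rewrite subnKC // -ltnS.
Qed.

End NsumScale.

Lemma linear_nsum_fam (F : fieldType) (W U : lmodType F) (f : nat -> W -> U) :
  (forall j, linear (f j)) -> (forall w, fin1 (f^~ w)) ->
  linear (fun w => nsum (f^~ w)).
Proof.
move=> hf fin c u v; rewrite nsumZ // -nsumD //; last exact: fin1Z.
by apply: eq_nsum => j; exact: hf.
Qed.

Section Binomials.
Variable F : numFieldType.
Implicit Types (x y : F).

Lemma natf_neq0' n : (n.+1%:R : F) != 0. Proof. by rewrite pnatr_eq0. Qed.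

Lemma factf_neq0 n : (n`!%:R : F) != 0.
Proof. by rewrite pnatr_eq0 -lt0n fact_gt0. Qed.

Lemma cbinom0 x : cbinom x 0 = 1.
Proof. by rewrite /cbinom big_ord0 fact0 divr1. Qed.

Lemma cbinom1 x : cbinom x 1 = x.
Proof. by rewrite /cbinom big_ord1 subr0 divr1. Qed.

Lemma cbinomS x m : m.+1%:R * cbinom x m.+1 = (x - m%:R) * cbinom x m.
Proof.
rewrite /cbinom big_ord_recr /= factS natrM.
by field; rewrite nat1r natf_neq0' factf_neq0.
Qed.

Lemma rec_uniq (u v : nat -> F) (c : nat -> F) :
  (forall m, m.+1%:R * u m.+1 = c m * u m) ->
  (forall m, m.+1%:R * v m.+1 = c m * v m) -> u 0%N = v 0%N -> u =1 v.
Proof.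
move=> hu hv h0; elim=> // m IH; apply: (mulfI (natf_neq0' m)).
by rewrite hu hv IH.
Qed.

(** Both sides satisfy (n + 1) t_(n+1) = (x + y - n) t_n; on the left-hand side this follows
    by splitting the factor n + 1 as i + (n + 1 - i) in each term. *)
Lemma vandermonde x y n :
  \sum_(i < n.+1) cbinom x i * cbinom y (n - i)%N = cbinom (x + y) n.
Proof.
pose S n := \sum_(i < n.+1) cbinom x i * cbinom y (n - i)%N.
apply: (@rec_uniq S (cbinom (x + y)) (fun m => x + y - m%:R)); first last.
- by rewrite /S big_ord1 !cbinom0 mulr1.
- by move=> m; rewrite cbinomS.
move=> m; rewrite /S.
have e1 : \sum_(i < m.+2) i%:R * (cbinom x i * cbinom y (m.+1 - i)%N) =
    \sum_(i < m.+1) (x - i%:R) * (cbinom x i * cbinom y (m - i)%N).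
  rewrite big_ord_recl mul0r add0r; apply: eq_bigr => i _ /=.
  by rewrite /bump /= add1n subSS mulrA cbinomS -mulrA.
have e2 : \sum_(i < m.+2) (m.+1 - i)%:R * (cbinom x i * cbinom y (m.+1 - i)%N) =
    \sum_(i < m.+1) (y - (m - i)%:R) * (cbinom x i * cbinom y (m - i)%N).
  rewrite big_ord_recr /= subnn mul0r addr0; apply: eq_bigr => i _ /=.
  have hi : (i <= m)%N by rewrite -ltnS.
  by rewrite subSn // mulrCA [RHS]mulrCA cbinomS.
transitivity (\sum_(i < m.+2) i%:R * (cbinom x i * cbinom y (m.+1 - i)%N) +
   \sum_(i < m.+2) (m.+1 - i)%:R * (cbinom x i * cbinom y (m.+1 - i)%N)).
  rewrite -big_split mulr_sumr; apply: eq_bigr => i _ /=.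
  have hi : (i <= m.+1)%N by rewrite -ltnS.
  by rewrite -mulrDl -natrD subnKC.
rewrite e1 e2 -big_split mulr_sumr; apply: eq_bigr => i _ /=.
have hi : (i <= m)%N by rewrite -ltnS.
by rewrite -mulrDl natrB //; congr (_ * _); ring.
Qed.

Lemma cbinomN x m : (-1) ^+ m * cbinom x m = cbinom (m%:R - x - 1) m.
Proof.
rewrite /cbinom mulrA; congr (_ / _).
rewrite (_ : (-1) ^+ m = \prod_(i < m) (-1 : F)); last first.
  by rewrite prodr_const card_ord.
rewrite -big_split (reindex_inj rev_ord_inj) /=; apply: eq_bigr => i _.
by rewrite natrB // -[i.+1%:R]natr1; ring.
Qed.

Lemma cbinom_nat n m : cbinom (n%:R : F) m = 'C(n, m)%:R.
Proof.
apply: (@rec_uniq (cbinom n%:R) (fun m => 'C(n, m)%:R) (fun m => n%:R - m%:R)).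
- by move=> k; rewrite cbinomS.
- move=> k; rewrite -natrM mul_bin_left natrM.
  by have [h|h] := leqP k n; [rewrite natrB | rewrite bin_small ?mulr0].
- by rewrite cbinom0 bin0.
Qed.

Lemma cbinom_m1 k : cbinom (- 0%:R - 1 : F) k = (-1) ^+ k.
Proof.
rewrite -[LHS](mulKr (unitrX k (unitrN1 F))) cbinomN.
by rewrite oppr0 sub0r opprK addrK cbinom_nat binn mulr1 -exprVn invrN1.
Qed.

Lemma cbinom_small n m : (n < m)%N -> cbinom (n%:R : F) m = 0.
Proof. by move=> h; rewrite cbinom_nat bin_small. Qed.

(** Both sides are x (x - 1) ... (x - i - k + 1) / (i! k!). *)
Lemma cbinom_tri x i k :
  cbinom x i * cbinom (x - i%:R) k = 'C(i + k, k)%:R * cbinom x (i + k).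
Proof.
have -> : 'C(i + k, k)%:R = (i + k)`!%:R / (i`!%:R * k`!%:R) :> F.
  apply: (canRL (mulfK _)); first by rewrite mulf_neq0 ?factf_neq0.
  by rewrite -!natrM; congr (_%:R); rewrite -(bin_fact (leq_addl i k)) addnK; lia.
rewrite /cbinom big_split_ord /=.
under [X in _ = _ * (_ * X / _)]eq_bigr do rewrite natrD opprD addrA.
by field; rewrite !factf_neq0.
Qed.

Lemma cbinom_swap x i k :
  cbinom x i * cbinom (x - i%:R) k = cbinom x k * cbinom (x - k%:R) i.
Proof.
rewrite !cbinom_tri [(k + i)%N]addnC; congr (_%:R * _).
by rewrite -(bin_sub (leq_addl i k)) addnK.
Qed.

Lemma cbinom_absorb1 x k : k.+1%:R * cbinom x k.+1 = x * cbinom (x - 1) k.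
Proof.
have := cbinom_tri x 1 k; rewrite cbinom1 => ->.
by rewrite add1n binSn.
Qed.

Lemma cbinom_absorb x i k :
  cbinom x (k + i) * cbinom ((k + i)%:R) k = cbinom x k * cbinom (x - k%:R) i.
Proof. by rewrite cbinom_swap cbinom_tri cbinom_nat [in RHS]mulrC addnC. Qed.

Lemma cbinom_diag k i : cbinom (k + i)%:R k = (-1) ^+ i * cbinom (- k%:R - 1) i :> F.
Proof.
rewrite cbinom_nat -bin_sub ?leq_addr // addKn -cbinom_nat cbinomN.
by congr cbinom; rewrite natrD; ring.
Qed.

Lemma cbinom_neg_diag j i k :
  cbinom (- (j + i)%:R - 1) k * cbinom (j + i)%:R j =
  cbinom (- j%:R - 1) k * ((-1) ^+ i * cbinom (- j%:R - 1 - k%:R) i) :> F.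
Proof.
rewrite cbinom_diag mulrCA [RHS]mulrCA; congr (_ * _).
by rewrite -cbinom_swap [LHS]mulrC; congr (_ * cbinom _ _); rewrite natrD; ring.
Qed.

End Binomials.

Definition fin3 (V : zmodType) (G : nat -> nat -> nat -> V) : Prop :=
  exists N, forall m r j, (N <= m + r + j)%N -> G m r j = 0.

Section Nsum3.
Variable V : zmodType.
Implicit Types (G : nat -> nat -> nat -> V).

Lemma fin3_first G : (exists N, forall j, (N <= j)%N -> forall m r, G m r j = 0) ->
  (forall j, fin2 (fun m r => G m r j)) -> fin3 G.
Proof.
move=> [N hN] /choice[M hM]; exists (N + \sum_(i < N) M i)%N => m r j h.
have [hi|hi] := leqP N j; first exact: hN.
apply: hM; move: h; rewrite (bigD1 (Ordinal hi)) //=; lia.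
Qed.

Lemma fin3_last G : (exists N, forall m r, (N <= m + r)%N -> forall j, G m r j = 0) ->
  (forall m r, fin1 (G m r)) -> fin3 G.
Proof.
move=> [N hN] hfin; have : forall p : nat * nat, exists M,
    forall j, (M <= j)%N -> G p.1 p.2 j = 0 by move=> p; exact: hfin.
move=> /choice[M hM].
exists (N + N + \sum_(m < N) \sum_(r < N) M (m : nat, r : nat))%N => m r j h.
have [hi|hi] := leqP N (m + r); first exact: hN.
have hm : (m < N)%N by lia.
have hr : (r < N)%N by lia.
apply: (hM (m, r)) => /=; move: h.
rewrite (bigD1 (Ordinal hm)) //= (bigD1 (Ordinal hr)) //=; lia.
Qed.

Lemma nsum_rot G : fin3 G ->
  nsum (fun m => nsum (fun r => nsum (G m r))) =
  nsum (fun j => nsum (fun m => nsum (fun r => G m r j))).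
Proof.
move=> [N hN].
transitivity (nsum (fun m => nsum (fun j => nsum (fun r => G m r j)))).
  apply: eq_nsum => m; apply: nsum_exch; exists N => r j h; apply: hN; lia.
apply: nsum_exch; exists N => m j h; apply: nsum_eq0 => r; apply: hN; lia.
Qed.

Lemma fin3_nsum G : fin3 G -> fin2 (fun m r => nsum (G m r)).
Proof.
by move=> [N hN]; exists N => m r h; apply: nsum_eq0 => j; apply: hN; lia.
Qed.

Lemma fin3_nsum2 G : fin3 G ->
  fin1 (fun j => nsum (fun m => nsum (fun r => G m r j))).
Proof.
move=> [N hN]; exists N => j h; apply: nsum_eq0 => m; apply: nsum_eq0 => r.
by apply: hN; lia.
Qed.

End Nsum3.

Section SignedBinomials.
Variable F : numFieldType.

(** The coefficients of (1 - t)^x. *)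
Definition sbinom (x : F) (m : nat) : F := (-1) ^+ m * cbinom x m.

Lemma sbinom0 x : sbinom x 0 = 1.
Proof. by rewrite /sbinom cbinom0 mulr1. Qed.

Lemma sbinomE x m : sbinom x m = cbinom (m%:R - x - 1) m.
Proof. exact: cbinomN. Qed.

Lemma vandermonde_signed (x y : F) n :
  \sum_(i < n.+1) sbinom x i * sbinom y (n - i)%N = sbinom (x + y) n.
Proof.
rewrite /sbinom -vandermonde mulr_sumr; apply: eq_bigr => i _.
by rewrite mulrACA -exprD subnKC // -ltnS.
Qed.

Variable W : lmodType F.

Lemma nsum_vandermonde (x y : F) (X : nat -> W) : fin1 X ->
  nsum (fun i => nsum (fun j => (cbinom x i * cbinom y j) *: X (i + j)%N)) =
  nsum (fun n => cbinom (x + y) n *: X n).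
Proof.
by move=> hX; rewrite nsum_conv //; apply: eq_nsum => n; rewrite vandermonde.
Qed.

Lemma nsum_vandermonde_signed (x y : F) (X : nat -> W) : fin1 X ->
  nsum (fun i => nsum (fun j => (sbinom x i * sbinom y j) *: X (i + j)%N)) =
  nsum (fun n => sbinom (x + y) n *: X n).
Proof.
by move=> hX; rewrite nsum_conv //; apply: eq_nsum => n; rewrite vandermonde_signed.
Qed.

End SignedBinomials.

(** * The iterate and commutator formulas *)

Section FreeFields.
Variables (F : numFieldType) (W : lmodType F) (I : eqType).
Variables (a : I -> int -> W -> W) (Y : W -> F -> W -> W).

(** The facts about the fields of a lattice from which the Jacobi identity is reduced to
    the vectors e^mu: finiteness of the sums over modes, the Heisenberg commutators and
    the iterate formula for Y(a(-k-1) u, z). *)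
Record normal_ordered : Prop := {
  no_mode_linear : forall i n, linear (a i n);
  no_linear_r : forall u s, linear (Y u s);
  no_linear_l : forall s w, linear (fun u => Y u s w);
  no_comm : forall i j m n w, a i m (a j n w) = a j n (a i m w) +
    (if (i == j) && (m + n == 0) then m%:~R *: w else 0);
  no_mode_trunc : forall i w, fin1 (fun n : nat => a i n w);
  no_trunc : forall u s w, fin1 (fun n => Y u (s - n%:R) w);
  no_normal : forall i k u s w, Y (a i (Negz k) u) s w =
    nsum (fun r => cbinom r%:R k *: a i (Negz r) (Y u (s - r%:R + k%:R) w)) +
    nsum (fun r => cbinom (- r%:R - 1) k *: Y u (s + r%:R + 1 + k%:R) (a i r w))
}.

(** That is, [a(n), Y(v, z)] = \sum_j binom(n, j) z^(n-j) Y(a(j) v, z). *)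
Definition commutator_formula (v : W) : Prop := forall i n s w,
  a i n (Y v s w) = Y v s (a i n w) +
    nsum (fun j => cbinom n%:~R j *: Y (a i j v) (s - n%:~R + j%:R) w).

Hypothesis H : normal_ordered.

Let Al i n := no_mode_linear H i n.
Let Yr u s := no_linear_r H u s.
Let Yl s w := no_linear_l H s w.
Let Ytr u s w := no_trunc H u s w.

Lemma Y_trunc_eq u w (e : nat -> F) s : (forall n, e n = s - n%:R) ->
  fin1 (fun n => Y u (e n) w).
Proof. by move=> he; apply: fin1_eq (Ytr u s w) => n; rewrite he. Qed.

Lemma Y0 s w : Y 0 s w = 0. Proof. exact: linear0' (Yl s w). Qed.

Lemma fin1_normal_neg i k u s w :
  fin1 (fun r => cbinom r%:R k *: a i (Negz r) (Y u (s - r%:R + k%:R) w)).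
Proof.
have [N hN] := Ytr u (s + k%:R) w; exists N => n h.
by rewrite addrAC hN // linear0' // scaler0.
Qed.

Lemma fin1_normal_pos i k u s w :
  fin1 (fun r => cbinom (- r%:R - 1) k *: Y u (s + r%:R + 1 + k%:R) (a i r w)).
Proof.
have [N hN] := no_mode_trunc H i w; exists N => n h.
by rewrite hN // linear0' // scaler0.
Qed.

Lemma fin1_comm i n v s w :
  fin1 (fun j => cbinom n%:~R j *: Y (a i j v) (s - n%:~R + j%:R) w).
Proof.
have [N hN] := no_mode_trunc H i v; exists N => j h.
by rewrite hN // Y0 scaler0.
Qed.

(** In the commutator of a_i(n) with the normally ordered product of a_l and Y(v, z) the
    commutators with Y(v, z) recombine into the vertex operators of a_l(-k-1) a_i(j) v,
    whereas the scalars [a_i(n), a_l(-n)] make up the term with j = k + 1, in which a_i(j)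
    removes a_l(-k-1). *)
Lemma commutator_formula_step l k v :
  commutator_formula v -> commutator_formula (a l (Negz k) v).
Proof.
move=> hv i n s w.
pose del (p : int) (c : F) (x : W) := if (i == l) && (n + p == 0) then c *: x else 0.
have acomm p x : a i n (a l p x) = a l p (a i n x) + del p n%:~R x.
  exact: (no_comm H).
have lindel p c (h : W -> W) x : linear h -> h (del p c x) = del p c (h x).
  by move=> hl; rewrite /del; case: ifP => _; rewrite ?linearZ' ?linear0'.
have [NW hNW] := no_mode_trunc H l w.
have [NV hNV] := no_mode_trunc H i v.
(* A and B refer to the creation and the annihilation part of the iterate formula; 1, 2
   and 3 to a_i(n) having reached w, to its commutator with Y(v, z) and to its commutator
   with a_l *)
pose A1 r := cbinom r%:R k *: a l (Negz r) (Y v (s - r%:R + k%:R) (a i n w)).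
pose A2 r j := (cbinom r%:R k * cbinom n%:~R j) *:
  a l (Negz r) (Y (a i j v) (s - r%:R + k%:R - n%:~R + j%:R) w).
pose A3 r := cbinom r%:R k *: del (Negz r) n%:~R (Y v (s - r%:R + k%:R) w).
pose B1 r := cbinom (- r%:R - 1) k *: Y v (s + r%:R + 1 + k%:R) (a l r (a i n w)).
pose B2 r j := (cbinom (- r%:R - 1) k * cbinom n%:~R j) *:
  Y (a i j v) (s + r%:R + 1 + k%:R - n%:~R + j%:R) (a l r w).
pose B3 r := cbinom (- r%:R - 1) k *: del r n%:~R (Y v (s + r%:R + 1 + k%:R) w).
pose E3 j := cbinom n%:~R j *: (if (i == l) && (j == k.+1) then
   (j%:R) *: Y v (s - n%:~R + j%:R) w else 0).
have finA2 : fin2 A2.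
  apply: fin2_cols.
    by exists NV => j h r; rewrite /A2 hNV // Y0 linear0' // scaler0.
  move=> j; apply: fin1Z; apply: (fin1_linear_fam (h := fun r => a l (Negz r))) => //.
  by apply: (@Y_trunc_eq _ _ _ (s + k%:R - n%:~R + j%:R)) => r; ring.
have finB2 : fin2 B2.
  apply: fin2_cols.
    by exists NV => j h r; rewrite /B2 hNV // Y0 scaler0.
  move=> j; exists NW => r h; rewrite /B2 hNW // linear0' // scaler0 //.
have finA1 : fin1 A1 by exact: fin1_normal_neg.
have finB1 : fin1 B1 by exact: fin1_normal_pos.
have finA3 : fin1 A3.
  apply: fin1Z; have [N hN] := Ytr v (s + k%:R) w; exists N => r h.
  by rewrite addrAC hN // /del scaler0 if_same.
have finB3 : fin1 B3.
  exists `|n|.+1 => r h; rewrite /B3 /del ifF ?scaler0 //.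
  apply/negP => /andP[_ /eqP]; lia.
have [fA2 fB2] := (fin2_nsum finA2, fin2_nsum finB2).
have e1 : a i n (Y (a l (Negz k) v) s w) =
  nsum A1 + nsum (fun r => nsum (A2 r)) + nsum A3 +
  (nsum B1 + nsum (fun r => nsum (B2 r)) + nsum B3).
  rewrite (no_normal H) linearD' //; congr (_ + _).
    rewrite (linear_nsum (Al i n) (fin1_normal_neg _ _ _ _ _)).
    rewrite -!nsumD; try by do ?apply: fin1D.
    apply: eq_nsum => r; rewrite linearZ' // acomm (lindel _ _ (fun x => x)) // scalerDr.
    rewrite hv linearD' // scalerDr; congr (_ + _ + _).
    rewrite (linear_nsum (Al l (Negz r))); last exact: fin1_comm.
    rewrite nsumZ; last by apply: fin1_linear => //; exact: fin1_comm.
    by apply: eq_nsum => j; rewrite linearZ' // scalerA.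
  rewrite (linear_nsum (Al i n) (fin1_normal_pos _ _ _ _ _)).
  rewrite -!nsumD; try by do ?apply: fin1D.
  apply: eq_nsum => r; rewrite linearZ' // hv acomm (linearD' (Yr _ _)) (lindel _ _ (Y v (s + r%:R + 1 + k%:R))) //.
  rewrite !scalerDr addrAC; congr (_ + _ + _).
  rewrite nsumZ; last exact: fin1_comm.
  by apply: eq_nsum => j; rewrite scalerA.
have e2 : Y (a l (Negz k) v) s (a i n w) = nsum A1 + nsum B1.
  by rewrite (no_normal H).
have finE3 : fin1 E3.
  by exists k.+2 => j h; rewrite /E3 ifF ?scaler0 //; apply/negP => /andP[_]; lia.
have e3 : nsum (fun j => cbinom n%:~R j *: Y (a i j (a l (Negz k) v)) (s - n%:~R + j%:R) w)
  = nsum (fun j => nsum (A2^~ j)) + nsum (fun j => nsum (B2^~ j)) + nsum E3.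
  have [fA fB] := (fin2_nsumC finA2, fin2_nsumC finB2).
  rewrite -!nsumD; try by do ?apply: fin1D.
  apply: eq_nsum => j; rewrite (no_comm H) (linearD' (Yl _ _)) scalerDr; congr (_ + _).
    rewrite (no_normal H) scalerDr !nsumZ;
      [|exact: fin1_normal_pos|exact: fin1_normal_neg].
    congr (_ + _); apply: eq_nsum => r; rewrite scalerA mulrC.
      by congr (_ *: a _ _ (Y _ _ _)); ring.
    by congr (_ *: Y _ _ _); ring.
  rewrite /E3; congr (_ *: _); rewrite (_ : (_ + Negz k == 0) = (j == k.+1)); last by lia.
  by case: ifP => _; rewrite ?(linearZ' (Yl _ _)) ?Y0.
have e4 : nsum A3 + nsum B3 = nsum E3.
  rewrite (@nsum1 _ k.+1 E3); last by move=> j /negbTE hj; rewrite /E3 hj andbF scaler0.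
  have [il|il] := eqVneq i l; last first.
    rewrite !nsum_eq0 ?addr0 /E3 ?(negbTE il) ?scaler0 // => r;
      by rewrite /A3 /B3 /del (negbTE il) scaler0.
  rewrite /E3 il !eqxx /= scalerA mulrC cbinom_absorb1.
  rewrite /A3 /B3 /del {}il eqxx /= {hv e1 e2 e3 acomm lindel finA2 finB2 fA2 fB2 finA1 finB1 finA3 finB3 finE3 E3 A1 A2 A3 B1 B2 B3 del}.
  case: n => [[|p]|p].
  - have z (b : bool) x : (if b then 0%:Z%:~R *: x else 0) = 0 :> W.
      by case: b; rewrite ?mulr0z ?scale0r.
    rewrite mul0r scale0r !nsum_eq0 ?addr0 // => r; cbv beta; rewrite ?z; exact: scaler0.
  - rewrite (@nsum1 _ p); last by move=> r hr; cbv beta; rewrite ifF ?scaler0 //; lia.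
    rewrite nsum_eq0 ?addr0; last first.
      move=> r; have -> : (p.+1%:Z + r == 0) = false by lia.
      exact: scaler0.
    rewrite ifT; last lia.
    rewrite scalerA; congr (_ *: Y _ _ _); last by ring.
    by rewrite mulrC; congr (_ * cbinom _ _); ring.
    rewrite nsum_eq0 ?add0r; last first.
      move=> r; have -> : (Negz p + Negz r == 0) = false by lia.
      exact: scaler0.
    rewrite (@nsum1 _ p.+1); last by move=> r hr; cbv beta; rewrite ifF ?scaler0 //; lia.
    rewrite ifT; last lia.
    rewrite scalerA NegzE; congr (_ *: Y _ _ _); last by ring.
    by rewrite mulrC; congr (_ * cbinom _ _); ring.
rewrite e1 e2 e3 -e4 -!(nsum_exch finA2) -(nsum_exch finB2).
by rewrite addrACA [X in X + _]addrACA [RHS]addrA.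
Qed.

End FreeFields.

(** * The Jacobi identity: reduction in the first vector *)

Section Jacobi.
Variables (F : numFieldType) (W : lmodType F) (I : eqType).
Variables (a : I -> int -> W -> W) (Y : W -> F -> W -> W).
Hypothesis H : normal_ordered a Y.
Hypothesis Hcomm : forall v, commutator_formula a Y v.

Let Al i n := no_mode_linear H i n.
Let Yr u s := no_linear_r H u s.
Let Yl s w := no_linear_l H s w.
Let Ytr u s w := no_trunc H u s w.

(** The three terms of the Jacobi identity at z_0^(-n-1) z_1^s1 z_2^s2. In the twisted
    identity s1 lies in - rho + Z, and then the coefficients on the right-hand side,
    which stem from z_2^-1 ((z_1 - z_0) / z_2)^(- rho) delta((z_1 - z_0) / z_2), are
    the binomials binom(- s1 - 1, m) of (z_2 + z_0)^(- s1 - 1). *)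
Definition jacobi12 (u v w : W) (n : int) (s1 s2 : F) : W :=
  nsum (fun m => sbinom n%:~R m *: Y u (s1 - n%:~R + m%:R) (Y v (s2 - m%:R) w)).

Definition jacobi21 (u v w : W) (n : int) (s1 s2 : F) : W :=
  nsum (fun m => ((-1) ^ n * sbinom n%:~R m) *:
    Y v (s2 - n%:~R + m%:R) (Y u (s1 - m%:R) w)).

Definition jacobi20 (u v w : W) (n : int) (s1 s2 : F) : W :=
  nsum (fun m => cbinom (- s1 - 1) m *:
    Y (Y u (- n%:~R - 1 - m%:R) v) (s1 + s2 + 1 + m%:R) w).

Definition kernel := W -> W -> W -> int -> F -> F -> W.

(** The iterate formula for Y(a(-k-1) u, z_1) leaves modes of a on the left of all
    operators, on the right of all operators, or acting on v. *)
Definition left_step (X : kernel) : Prop := forall i k u v w n s1 s2,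
  let f1 r := cbinom r%:R k *: a i (Negz r) (X u v w n (s1 - r%:R + k%:R) s2) in
  let f2 r := cbinom (- r%:R - 1) k *: X u v (a i r w) n (s1 + r%:R + 1 + k%:R) s2 in
  let f3 j := cbinom (- j%:R - 1) k *: X u (a i j v) w (n - j%:Z - 1 - k%:Z) s1 s2 in
  [/\ fin1 f1, fin1 f2, fin1 f3 &
    X (a i (Negz k) u) v w n s1 s2 = nsum f1 + nsum f2 + nsum f3].

Lemma fin1_jacobi12 u v w n s1 s2 : fin1 (fun m =>
  sbinom n%:~R m *: Y u (s1 - n%:~R + m%:R) (Y v (s2 - m%:R) w)).
Proof.
apply: fin1Z.
exact: (fin1_linear_fam (h := fun m => Y u (s1 - n%:~R + m%:R))).
Qed.

Lemma fin1_jacobi21 u v w n s1 s2 : fin1 (fun m =>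
  ((-1) ^ n * sbinom n%:~R m) *: Y v (s2 - n%:~R + m%:R) (Y u (s1 - m%:R) w)).
Proof.
apply: fin1Z.
exact: (fin1_linear_fam (h := fun m => Y v (s2 - n%:~R + m%:R))).
Qed.

Lemma fin1_jacobi20 u v w n s1 s2 : fin1 (fun m => cbinom (- s1 - 1) m *:
    Y (Y u (- n%:~R - 1 - m%:R) v) (s1 + s2 + 1 + m%:R) w).
Proof.
apply: fin1Z.
exact: (fin1_linear_fam (h := fun m x => Y x (s1 + s2 + 1 + m%:R) w)).
Qed.

(** In Y(a(-k-1) u, z_1) Y(v, z_2) the annihilation modes of a stand on the left of
    Y(v, z_2) and have to be moved across it. The commutators add up to values at a(j) v
    by the Vandermonde identity, and the factor (z_1 - z_2)^(-j-1-k) lowers n. *)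
Lemma left_step12 : left_step jacobi12.
Proof.
move=> i k u v w n s1 s2 f1 f2 f3.
have [NW hNW] := no_mode_trunc H i w.
have [NV hNV] := no_mode_trunc H i v.
pose c m := sbinom n%:~R m : F.
pose t m : F := s1 - n%:~R + m%:R.
pose G1 m r := (c m * cbinom r%:R k) *:
  a i (Negz r) (Y u (t m - r%:R + k%:R) (Y v (s2 - m%:R) w)).
pose G2 m r := (c m * cbinom (- r%:R - 1) k) *:
  Y u (t m + r%:R + 1 + k%:R) (Y v (s2 - m%:R) (a i r w)).
pose G3 m r j := (c m * cbinom (- r%:R - 1) k * cbinom r%:R j) *:
  Y u (t m + r%:R + 1 + k%:R) (Y (a i j v) (s2 - m%:R - r%:R + j%:R) w).
have finG1 : fin2 G1.
  apply: fin2_rows.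
    have [N hN] := Ytr v s2 w; exists N => m h r.
    by rewrite /G1 hN // (linear0' (Yr _ _)) (linear0' (Al _ _)) scaler0.
  move=> m; apply: fin1Z; apply: (fin1_linear_fam (h := fun r => a i (Negz r))) => //.
  by apply: (@Y_trunc_eq _ _ _ _ _ H _ _ _ (t m + k%:R)) => r; ring.
have finG2 : fin2 G2.
  apply: fin2_cols.
    exists NW => r h m.
    by rewrite /G2 hNW // (linear0' (Yr _ _)) (linear0' (Yr _ _)) scaler0.
  move=> r; apply: fin1Z.
  by apply: (fin1_linear_fam (h := fun m => Y u (t m + r%:R + 1 + k%:R))).
have finG3 : fin3 G3.
  apply: fin3_first.
    exists NV => j h m r.
    by rewrite /G3 hNV // (Y0 H) (linear0' (Yr _ _)) scaler0.
  move=> j; have [N hN] := Ytr (a i j v) (s2 + j%:R) w; exists N => m r h.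
  rewrite /G3 (_ : s2 - m%:R - r%:R + j%:R = s2 + j%:R - (m + r)%:R).
    by rewrite hN // (linear0' (Yr _ _)) scaler0.
  by rewrite natrD; ring.
have e : jacobi12 (a i (Negz k) u) v w n s1 s2 =
  nsum (fun m => nsum (G1 m)) + nsum (fun m => nsum (G2 m)) +
  nsum (fun m => nsum (fun r => nsum (G3 m r))).
  rewrite -nsumD; [|exact: fin2_nsum|exact: fin2_nsum].
  rewrite -nsumD; [|by apply: fin1D; exact: fin2_nsum|exact: fin2_nsum (fin3_nsum finG3)].
  apply: eq_nsum => m; rewrite (no_normal H) scalerDr.
  rewrite (nsumZ _ (fin1_normal_neg H _ _ _ _ _)) (nsumZ _ (fin1_normal_pos H _ _ _ _ _)).
  rewrite -[RHS]addrA; congr (_ + _); first by apply: eq_nsum => r; rewrite scalerA.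
  rewrite -nsumD; [|exact: fin2_row|exact: fin2_row (fin3_nsum finG3)].
  apply: eq_nsum => r; rewrite scalerA Hcomm (linearD' (Yr _ _)) scalerDr; congr (_ + _).
  rewrite (linear_nsum (Yr _ _) (fin1_comm H _ _ _ _ _)) nsumZ; last first.
    by apply: (fin1_linear (Yr _ _)); exact: (fin1_comm H).
  by apply: eq_nsum => j; rewrite (linearZ' (Yr _ _)) scalerA.
have e1 r : f1 r = nsum (fun m => G1 m r).
  rewrite /f1 /jacobi12 (linear_nsum (Al _ _)); last exact: fin1_jacobi12.
  rewrite nsumZ; last by apply: (fin1_linear (Al _ _)); exact: fin1_jacobi12.
  apply: eq_nsum => m; rewrite (linearZ' (Al _ _)) scalerA mulrC.
  by congr (_ *: a _ _ (Y _ _ _)); rewrite /t; ring.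
have e2 r : f2 r = nsum (fun m => G2 m r).
  rewrite /f2 /jacobi12 nsumZ; last exact: fin1_jacobi12.
  apply: eq_nsum => m; rewrite scalerA mulrC.
  by congr (_ *: Y _ _ _); rewrite /t; ring.
have e3 j : f3 j = nsum (fun m => nsum (fun r => G3 m r j)).
  pose n' : F := n%:~R - j%:R - 1 - k%:R.
  pose X M := Y u (s1 - n' + M%:R) (Y (a i j v) (s2 - M%:R) w).
  have finX : fin1 X by exact: (fin1_linear_fam (h := fun m => Y u (s1 - n' + m%:R))).
  transitivity (cbinom (- j%:R - 1) k *: nsum (fun M => sbinom n' M *: X M)).
    rewrite /f3 /jacobi12; congr (_ *: _); apply: eq_nsum => M.
    by rewrite /X /n'; congr (sbinom _ _ *: Y _ _ _); ring.
  (* (z_1 - z_2)^n' is expanded as the product of (z_1 - z_2)^n, which is present in G3,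
     and (z_1 - z_2)^(-j-1-k), which the sum over r produces *)
  rewrite (_ : n' = n%:~R + (- j%:R - 1 - k%:R)); last by rewrite /n'; ring.
  rewrite -nsum_vandermonde_signed // nsumZ; last first.
    apply: fin2_nsum; case: finX => N hN; exists N => x y h.
    by rewrite hN // scaler0.
  apply: eq_nsum => m; rewrite nsumZ; last first.
    by apply: fin1Z; case: finX => N hN; exists N => y h; rewrite hN //; lia.
  rewrite [RHS](@nsum_shift _ j); last first.
    by move=> r h; rewrite /G3 (cbinom_small _ h) mulr0 scale0r.
  apply: eq_nsum => r; rewrite scalerA /G3.
  rewrite -[c m * _ * _]mulrA cbinom_neg_diag -/(sbinom _ _) mulrCA.
  congr (_ *: Y _ _ (Y _ _ _)); rewrite /t /n'; ring.
split; first by apply: (fin1_eq (fun r => esym (e1 r))); exact: fin2_nsumC.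
- by apply: (fin1_eq (fun r => esym (e2 r))); exact: fin2_nsumC.
- by apply: (fin1_eq (fun r => esym (e3 r))); exact: fin3_nsum2.
- by rewrite e (eq_nsum e1) (eq_nsum e2) (eq_nsum e3) -(nsum_exch finG1) -(nsum_exch finG2)
    -(nsum_rot finG3).
Qed.

(** Here it is the creation modes that have to be moved across Y(v, z_2), to the left. *)
Lemma left_step21 : left_step jacobi21.
Proof.
move=> i k u v w n s1 s2 f1 f2 f3.
have [NW hNW] := no_mode_trunc H i w.
have [NV hNV] := no_mode_trunc H i v.
pose c m := (-1) ^ n * sbinom n%:~R m : F.
pose t m : F := s2 - n%:~R + m%:R.
pose G1 m r := (c m * cbinom r%:R k) *:
  a i (Negz r) (Y v (t m) (Y u (s1 - m%:R - r%:R + k%:R) w)).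
pose G2 m r := (c m * cbinom (- r%:R - 1) k) *:
  Y v (t m) (Y u (s1 - m%:R + r%:R + 1 + k%:R) (a i r w)).
pose G3 m r j := (- (c m * cbinom r%:R k * cbinom (- r%:R - 1) j)) *:
  Y (a i j v) (t m + r%:R + 1 + j%:R) (Y u (s1 - m%:R - r%:R + k%:R) w).
have finG1 : fin2 G1.
  have [N hN] := Ytr u (s1 + k%:R) w; exists N => m r h.
  rewrite /G1 (_ : s1 - m%:R - r%:R + k%:R = s1 + k%:R - (m + r)%:R).
    by rewrite hN // (linear0' (Yr _ _)) (linear0' (Al _ _)) scaler0.
  by rewrite natrD; ring.
have finG2 : fin2 G2.
  apply: fin2_cols.
    exists NW => r h m.
    by rewrite /G2 hNW // (linear0' (Yr _ _)) (linear0' (Yr _ _)) scaler0.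
  move=> r; apply: fin1Z; apply: (fin1_linear_fam (h := fun m => Y v (t m))) => //.
  by apply: (@Y_trunc_eq _ _ _ _ _ H _ _ _ (s1 + r%:R + 1 + k%:R)) => m; ring.
have finG3 : fin3 G3.
  apply: fin3_first.
    by exists NV => j h m r; rewrite /G3 hNV // (Y0 H) scaler0.
  move=> j; have [N hN] := Ytr u (s1 + k%:R) w; exists N => m r h.
  rewrite /G3 (_ : s1 - m%:R - r%:R + k%:R = s1 + k%:R - (m + r)%:R).
    by rewrite hN // (linear0' (Yr _ _)) scaler0.
  by rewrite natrD; ring.
have e : jacobi21 (a i (Negz k) u) v w n s1 s2 =
  nsum (fun m => nsum (G1 m)) + nsum (fun m => nsum (G2 m)) +
  nsum (fun m => nsum (fun r => nsum (G3 m r))).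
  rewrite -addrA [X in _ + X]addrC addrA.
  rewrite -nsumD; [|exact: fin2_nsum|exact: fin2_nsum (fin3_nsum finG3)].
  rewrite -nsumD; [|apply: fin1D; [exact: fin2_nsum|exact: fin2_nsum (fin3_nsum finG3)]|exact: fin2_nsum].
  apply: eq_nsum => m; rewrite (no_normal H) (linearD' (Yr _ _)) scalerDr.
  rewrite (linear_nsum (Yr _ _) (fin1_normal_neg H _ _ _ _ _)).
  rewrite (linear_nsum (Yr _ _) (fin1_normal_pos H _ _ _ _ _)).
  rewrite (nsumZ _ (fin1_linear (Yr _ _) (fin1_normal_neg H _ _ _ _ _))).
  rewrite (nsumZ _ (fin1_linear (Yr _ _) (fin1_normal_pos H _ _ _ _ _))).
  congr (_ + _); last first.
    by apply: eq_nsum => r; rewrite (linearZ' (Yr _ _)) scalerA.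
  rewrite -nsumD; [|exact: fin2_row|exact: fin2_row (fin3_nsum finG3)].
  apply: eq_nsum => r; rewrite (linearZ' (Yr _ _)) scalerA.
  set y := Y u _ w.
  have -> : Y v (t m) (a i (Negz r) y) = a i (Negz r) (Y v (t m) y) -
      nsum (fun j => cbinom (Negz r)%:~R j *: Y (a i j v) (t m - (Negz r)%:~R + j%:R) y).
    by rewrite Hcomm addrK.
  rewrite scalerBr; congr (_ + _).
  rewrite -scalerN -nsumN; last exact: (fin1_comm H).
  rewrite nsumZ; last by apply: fin1N; exact: (fin1_comm H).
  apply: eq_nsum => j; rewrite scalerN scalerA -scaleNr /G3 NegzE.
  congr (- (_ * cbinom _ _) *: Y _ _ _); ring.
have e1 r : f1 r = nsum (fun m => G1 m r).
  rewrite /f1 /jacobi21 (linear_nsum (Al _ _)); last exact: fin1_jacobi21.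
  rewrite nsumZ; last by apply: (fin1_linear (Al _ _)); exact: fin1_jacobi21.
  apply: eq_nsum => m; rewrite (linearZ' (Al _ _)) scalerA mulrC.
  by congr (_ *: a _ _ (Y _ _ (Y _ _ _))); rewrite /t; ring.
have e2 r : f2 r = nsum (fun m => G2 m r).
  rewrite /f2 /jacobi21 nsumZ; last exact: fin1_jacobi21.
  apply: eq_nsum => m; rewrite scalerA mulrC.
  by congr (_ *: Y _ _ (Y _ _ _)); rewrite /t; ring.
have e3 j : f3 j = nsum (fun m => nsum (fun r => G3 m r j)).
  pose n' : F := n%:~R - j%:R - 1 - k%:R.
  pose X M := Y (a i j v) (s2 - n' + M%:R) (Y u (s1 - M%:R) w).
  have finX : fin1 X by exact: (fin1_linear_fam (h := fun m => Y (a i j v) (s2 - n' + m%:R))).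
  transitivity ((- (-1) ^ n * cbinom (- k%:R - 1) j) *: nsum (fun M => sbinom n' M *: X M)).
    rewrite /f3 /jacobi21 nsumZ; last exact: fin1_jacobi21.
    rewrite nsumZ; last exact: fin1Z.
    apply: eq_nsum => M; rewrite !scalerA.
    have -> : sbinom (n - j%:Z - 1 - k%:Z)%:~R M = sbinom n' M by congr sbinom; rewrite /n'; ring.
    congr (_ *: Y _ _ _); last by rewrite /n'; ring.
    rewrite mulrA; congr (_ * _).
    have e0 (x y : nat) : cbinom (- x%:R - 1) y = (-1) ^+ y * 'C(x + y, y)%:R :> F.
      rewrite -cbinom_nat cbinomN; congr cbinom; rewrite natrD; ring.
    rewrite !e0 addnC -[in 'C(k + j, j)]bin_sub ?leq_addl // addnK.
    rewrite (_ : n - j%:Z - 1 - k%:Z = n + (- (j + 1 + k)%:Z)); last by lia.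
    rewrite expfzDr ?oppr_eq0 ?oner_eq0 // -exprnN invr_sign !exprD expr1.
    have hk : (-1) ^+ k * (-1) ^+ k = 1 :> F by rewrite -expr2 sqrr_sign.
    by rewrite -[RHS]mul1r -[X in _ = X * _]hk; ring.
  rewrite (_ : n' = n%:~R + (- k%:R - 1 - j%:R)); last by rewrite /n'; ring.
  rewrite -nsum_vandermonde_signed // nsumZ; last first.
    apply: fin2_nsum; case: finX => N hN; exists N => x y h.
    by rewrite hN // scaler0.
  apply: eq_nsum => m; rewrite nsumZ; last first.
    by apply: fin1Z; case: finX => N hN; exists N => y h; rewrite hN //; lia.
  rewrite [RHS](@nsum_shift _ k); last first.
    by move=> r h; rewrite /G3 (cbinom_small _ h) mulr0 mul0r oppr0 scale0r.
  apply: eq_nsum => r; rewrite scalerA /G3.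
  rewrite -[c m * _ * _]mulrA [cbinom (k + r)%:R k * _]mulrC cbinom_neg_diag -/(sbinom _ _).
  congr (_ *: Y _ _ (Y _ _ _)); rewrite /t /n' /c ?natrD; ring.
split; first by apply: (fin1_eq (fun r => esym (e1 r))); exact: fin2_nsumC.
- by apply: (fin1_eq (fun r => esym (e2 r))); exact: fin2_nsumC.
- by apply: (fin1_eq (fun r => esym (e3 r))); exact: fin3_nsum2.
- by rewrite e (eq_nsum e1) (eq_nsum e2) (eq_nsum e3) -(nsum_exch finG1) -(nsum_exch finG2)
    -(nsum_rot finG3).
Qed.

(** The iterate formula is used twice: inside, for Y(a(-k-1) u, z_0) v, and for the
    vertex operators at z_2 of the vectors a(-r-1) x that arise from it. *)
Lemma left_step20 : left_step jacobi20.
Proof.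
move=> i k u v w n s1 s2 f1 f2 f3.
have [NW hNW] := no_mode_trunc H i w.
have [NV hNV] := no_mode_trunc H i v.
pose c m := cbinom (- s1 - 1) m : F.
pose S m : F := s1 + s2 + 1 + m%:R.
(* the coefficient of Y(u, z_0) v that belongs to the m-th term of the Jacobi identity
   and to the r-th term of the iterate formula *)
pose x (m r : nat) := Y u (- n%:~R - 1 - m%:R - r%:R + k%:R) v.
pose G1 m r q := (c m * cbinom r%:R k * cbinom q%:R r) *:
  a i (Negz q) (Y (x m r) (S m - q%:R + r%:R) w).
pose G2 m r q := (c m * cbinom r%:R k * cbinom (- q%:R - 1) r) *:
  Y (x m r) (S m + q%:R + 1 + r%:R) (a i q w).
pose G3 m r := (c m * cbinom (- r%:R - 1) k) *:
  Y (Y u (- n%:~R - 1 - m%:R + r%:R + 1 + k%:R) (a i r v)) (S m) w.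
have [Nx hNx] : exists N, forall m r, (N <= m + r)%N -> x m r = 0.
  have [N hN] := Ytr u (- n%:~R - 1 + k%:R) v; exists N => m r h.
  by rewrite /x -(hN _ h); congr Y; rewrite natrD; ring.
have finG1 : fin3 G1.
  apply: fin3_last.
    by exists Nx => m r h q; rewrite /G1 hNx // (Y0 H) (linear0' (Al _ _)) scaler0.
  move=> m r; apply: fin1Z; apply: (fin1_linear_fam (h := fun q => a i (Negz q))) => //.
  by apply: (@Y_trunc_eq _ _ _ _ _ H _ _ _ (S m + r%:R)) => q; ring.
have finG2 : fin3 G2.
  apply: fin3_first.
    by exists NW => q h m r; rewrite /G2 hNW // (linear0' (Yr _ _)) scaler0.
  by move=> q; exists Nx => m r h; rewrite /G2 hNx // (Y0 H) scaler0.
have finG3 : fin2 G3.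
  apply: fin2_cols.
    exists NV => r h m.
    by rewrite /G3 hNV // (linear0' (Yr _ _)) (Y0 H) scaler0.
  move=> r; apply: fin1Z; apply: (fin1_linear_fam (h := fun m z => Y z (S m) w)) => //.
  by apply: (@Y_trunc_eq _ _ _ _ _ H _ _ _ (- n%:~R - 1 + r%:R + 1 + k%:R)) => m; ring.
have e : jacobi20 (a i (Negz k) u) v w n s1 s2 =
  nsum (fun m => nsum (fun r => nsum (G1 m r))) +
  nsum (fun m => nsum (fun r => nsum (G2 m r))) +
  nsum (fun m => nsum (G3 m)).
  have [f1G f2G] := (fin3_nsum finG1, fin3_nsum finG2).
  rewrite -nsumD; [|exact: fin2_nsum|exact: fin2_nsum].
  rewrite -nsumD; [|by apply: fin1D; exact: fin2_nsum|exact: fin2_nsum].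
  apply: eq_nsum => m; rewrite (no_normal H) (linearD' (Yl _ _)) scalerDr.
  rewrite (linear_nsum (Yl _ _) (fin1_normal_neg H _ _ _ _ _)).
  rewrite (linear_nsum (Yl _ _) (fin1_normal_pos H _ _ _ _ _)).
  rewrite (nsumZ _ (fin1_linear (Yl _ _) (fin1_normal_neg H _ _ _ _ _))).
  rewrite (nsumZ _ (fin1_linear (Yl _ _) (fin1_normal_pos H _ _ _ _ _))).
  congr (_ + _); last first.
    by apply: eq_nsum => r; rewrite (linearZ' (Yl _ _)) scalerA.
  rewrite -nsumD; [|exact: fin2_row m f1G|exact: fin2_row m f2G].
  apply: eq_nsum => r; rewrite (linearZ' (Yl _ _)) scalerA (no_normal H) scalerDr.
  rewrite (nsumZ _ (fin1_normal_neg H _ _ _ _ _)) (nsumZ _ (fin1_normal_pos H _ _ _ _ _)).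
  by congr (_ + _); apply: eq_nsum => q; rewrite scalerA.
(* the common part of the two sums over r: with a shift of r by k the binomials in k and
   r split off binom(Q, k), and the sum over m and r becomes a convolution *)
have key (Q : F) (X : nat -> nat -> W) (X' : nat -> W) : fin1 X' ->
    (forall m r, X m (k + r)%N = X' (m + r)%N) ->
    nsum (fun m => nsum (fun r => (c m * cbinom r%:R k * cbinom Q r) *: X m r)) =
    cbinom Q k *: nsum (fun m => cbinom (- (s1 - Q + k%:R) - 1) m *: X' m).
  move=> finX' hX.
  have -> : - (s1 - Q + k%:R) - 1 = (- s1 - 1) + (Q - k%:R) by ring.
  rewrite -nsum_vandermonde // nsumZ; last first.
    by apply: fin2_nsum; case: finX' => N hN; exists N => p q h; rewrite hN // scaler0.
  apply: eq_nsum => m; rewrite nsumZ; last first.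
    by apply: fin1Z; case: finX' => N hN; exists N => y h; rewrite hN //; lia.
  rewrite (@nsum_shift _ k); last first.
    by move=> r h; rewrite (cbinom_small _ h) mulr0 mul0r scale0r.
  apply: eq_nsum => r; rewrite scalerA hX; congr (_ *: _).
  by rewrite -mulrA [cbinom (k + r)%:R k * _]mulrC cbinom_absorb mulrCA.
pose x' M := Y u (- n%:~R - 1 - M%:R) v.
have xx' m r : x m (k + r)%N = x' (m + r)%N.
  by rewrite /x /x'; congr Y; rewrite !natrD; ring.
have finx' : fin1 x' by exact: Ytr.
have e1 q : f1 q = nsum (fun m => nsum (fun r => G1 m r q)).
  rewrite /G1 (key _ (fun m r => a i (Negz q) (Y (x m r) (S m - q%:R + r%:R) w))
    (fun M => a i (Negz q) (Y (x' M) (s1 - q%:R + k%:R + s2 + 1 + M%:R) w))).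
  - rewrite /f1 /jacobi20 (linear_nsum (Al _ _)); last exact: fin1_jacobi20.
    by congr (_ *: _); apply: eq_nsum => m; rewrite (linearZ' (Al _ _)).
  - apply: (fin1_linear (h := a i (Negz q))
      (f := fun M => Y (x' M) (s1 - q%:R + k%:R + s2 + 1 + M%:R) w)) => //.
    exact: (fin1_linear_fam (h := fun m z => Y z (s1 - q%:R + k%:R + s2 + 1 + m%:R) w)).
  - by move=> m r; rewrite xx'; congr (a _ _ (Y _ _ _)); rewrite /S !natrD; ring.
have e2 q : f2 q = nsum (fun m => nsum (fun r => G2 m r q)).
  rewrite /G2 (key _ (fun m r => Y (x m r) (S m + q%:R + 1 + r%:R) (a i q w))
    (fun M => Y (x' M) (s1 + q%:R + 1 + k%:R + s2 + 1 + M%:R) (a i q w))).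
  - rewrite /f2 /jacobi20; congr (_ *: _); apply: eq_nsum => m.
    by congr (cbinom _ _ *: _); ring.
  - exact: (fin1_linear_fam (h := fun m z => Y z (s1 + q%:R + 1 + k%:R + s2 + 1 + m%:R) (a i q w))).
  - by move=> m r; rewrite xx'; congr (Y _ _ _); rewrite /S !natrD; ring.
have e3 r : f3 r = nsum (fun m => G3 m r).
  rewrite /f3 /jacobi20 nsumZ; last exact: fin1_jacobi20.
  apply: eq_nsum => m; rewrite scalerA mulrC.
  by congr (_ *: Y (Y _ _ _) _ _); ring.
split; first by apply: (fin1_eq (fun r => esym (e1 r))); exact: fin3_nsum2.
- by apply: (fin1_eq (fun r => esym (e2 r))); exact: fin3_nsum2.
- by apply: (fin1_eq (fun r => esym (e3 r))); exact: fin2_nsumC.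
- by rewrite e (eq_nsum e1) (eq_nsum e2) (eq_nsum e3) -(nsum_exch finG3) -(nsum_rot finG1)
    -(nsum_rot finG2).
Qed.

End Jacobi.

(** * The Jacobi identity: reduction in the second vector and in the module *)

Section JacobiCoherent.
Variables (F : numFieldType) (W : lmodType F) (I : eqType).
Variables (a : I -> int -> W -> W) (Y : W -> F -> W -> W).
Hypothesis H : normal_ordered a Y.
Hypothesis Hcomm : forall v, commutator_formula a Y v.

Let Al i n := no_mode_linear H i n.
Let Yr u s := no_linear_r H u s.
Let Yl s w := no_linear_l H s w.
Let Ytr u s w := no_trunc H u s w.

(** Highest weight vectors of the Heisenberg algebra, such as e^mu. *)
Definition coherent (mu : I -> F) (u : W) : Prop :=
  forall i (j : nat), a i j u = if j == 0%N then mu i *: u else 0.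

Lemma coherent_comm mu u : coherent mu u -> forall i n s w,
  a i n (Y u s w) = Y u s (a i n w) + mu i *: Y u (s - n%:~R) w.
Proof.
move=> hu i n s w; rewrite Hcomm; congr (_ + _).
rewrite (@nsum1 _ 0%N); last first.
  by move=> [|j] //= _; rewrite hu /= (Y0 H) scaler0.
by rewrite cbinom0 scale1r hu /= (linearZ' (Yl _ _)) addr0.
Qed.

(** The analogue of left_step for the second vector. As the first one is a highest
    weight vector, moving a across it only yields multiples of it. *)
Definition right_step (mu : I -> F) (u : W) (X : kernel W) : Prop := forall i k v w n s1 s2,
  let f1 r := cbinom r%:R k *: a i (Negz r) (X u v w n s1 (s2 - r%:R + k%:R)) in
  let f2 r := cbinom (- r%:R - 1) k *: X u v (a i r w) n s1 (s2 + r%:R + 1 + k%:R) in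
  [/\ fin1 f1, fin1 f2 &
    X u (a i (Negz k) v) w n s1 s2 =
    nsum f1 + nsum f2 - mu i *: X u v w (n - 1 - k%:Z) s1 s2].

(** Exchanging u with v and z_1 with z_2 turns (z_1 - z_2)^n into (-1)^n (- z_2 + z_1)^n,
    hence interchanges the first two terms of the Jacobi identity. *)
Definition flip (X : kernel W) : kernel W :=
  fun u v w n s1 s2 => (-1) ^ n *: X v u w n s2 s1.

Lemma jacobi21E : jacobi21 Y = flip (jacobi12 Y).
Proof.
do 6![apply/funext => ?]; rewrite /flip nsumZ; last exact: (fin1_jacobi12 H).
by apply: eq_nsum => m; rewrite scalerA.
Qed.

Lemma jacobi12E : jacobi12 Y = flip (jacobi21 Y).
Proof.
rewrite jacobi21E; do 6![apply/funext => ?].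
by rewrite /flip scalerA -expfzMl mulrNN mulr1 exp1rz scale1r.
Qed.

(** After the exchange this is the step in the first vector. On a highest weight vector
    only its term with j = 0 is nonzero, with coefficient binom(-1, k) = (-1)^k; together
    with the signs of the exchange it gives (-1)^n (-1)^k = - (-1)^(n-1-k). *)
Lemma right_step_flip mu u X : coherent mu u ->
  (forall v w n s1 s2, linear (fun x => X v x w n s1 s2)) ->
  left_step a X -> right_step mu u (flip X).
Proof.
move=> hu lX hX i k v w n s1 s2 f1 f2.
have [g1 g2 _ e] := hX i k v u w n s2 s1.
have e1 : f1 = fun r => (-1) ^ n *: (cbinom r%:R k *: a i (Negz r)
    (X v u w n (s2 - r%:R + k%:R) s1)).
  by apply/funext => r; rewrite /f1 /flip (linearZ' (Al _ _)) !scalerA mulrC.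
have e2 : f2 = fun r => (-1) ^ n *: (cbinom (- r%:R - 1) k *:
    X v u (a i r w) n (s2 + r%:R + 1 + k%:R) s1).
  by apply/funext => r; rewrite /f2 /flip !scalerA mulrC.
rewrite e1 e2; split; [exact: fin1Z|exact: fin1Z|].
rewrite /flip e !scalerDr (nsumZ _ g1) (nsumZ _ g2); congr (_ + _).
rewrite (@nsum1 _ 0%N) => [|[|j] // _]; rewrite hu /=; last first.
  by rewrite (linear0' (lX _ _ _ _ _)) scaler0.
rewrite subr0 (linearZ' (lX _ _ _ _ _)) !scalerA -scaleNr; congr (_ *: _).
rewrite cbinom_m1.
have u1 : (-1 : F) \is a GRing.unit by rewrite unitrN1.
rewrite -addrA exprzDr // -opprD -exprz_inv invrN1 -exprnP exprS.
by ring.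
Qed.

Lemma right_step12 mu u : coherent mu u -> right_step mu u (jacobi12 Y).
Proof.
move=> hu; rewrite jacobi12E; apply: right_step_flip => // [v w n s1 s2|].
  apply: linear_nsum_fam => [m|x]; last exact: (fin1_jacobi21 H).
  by apply: linear_scale'; exact: Yl.
exact: left_step21.
Qed.

Lemma right_step21 mu u : coherent mu u -> right_step mu u (jacobi21 Y).
Proof.
move=> hu; rewrite jacobi21E; apply: right_step_flip => // [v w n s1 s2|].
  apply: linear_nsum_fam => [m|x]; last exact: (fin1_jacobi12 H).
  by apply: linear_scale'; exact: (linear_comp' (Yr _ _) (Yl _ _)).
exact: left_step12.
Qed.

(** Moving a(-k-1) across Y(u, z_0) produces mu z_0^(-k-1) Y(u, z_0), and the power of z_0
    lowers n. *)
Lemma right_step20 mu u : coherent mu u -> right_step mu u (jacobi20 Y).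
Proof.
move=> hu i k v w n s1 s2 f1 f2.
have [NW hNW] := no_mode_trunc H i w.
pose c m := cbinom (- s1 - 1) m : F.
pose S m : F := s1 + s2 + 1 + m%:R.
pose x (m : nat) := Y u (- n%:~R - 1 - m%:R) v.
pose G1 m r := (c m * cbinom r%:R k) *: a i (Negz r) (Y (x m) (S m - r%:R + k%:R) w).
pose G2 m r := (c m * cbinom (- r%:R - 1) k) *:
  Y (x m) (S m + r%:R + 1 + k%:R) (a i r w).
pose G3 m := - (mu i *: (c m *: Y (Y u (- (n - 1 - k%:Z)%:~R - 1 - m%:R) v) (S m) w)).
have [Nx hNx] : fin1 x by exact: Ytr.
have finG1 : fin2 G1.
  apply: fin2_rows.
    by exists Nx => m h r; rewrite /G1 hNx // (Y0 H) (linear0' (Al _ _)) scaler0.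
  move=> m; apply: fin1Z; apply: (fin1_linear_fam (h := fun r => a i (Negz r))) => //.
  by apply: (@Y_trunc_eq _ _ _ _ _ H _ _ _ (S m + k%:R)) => r; ring.
have finG2 : fin2 G2.
  apply: fin2_cols.
    by exists NW => r h m; rewrite /G2 hNW // (linear0' (Yr _ _)) scaler0.
  by move=> r; exists Nx => m h; rewrite /G2 hNx // (Y0 H) scaler0.
have fin3' : fin1 (fun m => c m *: Y (Y u (- (n - 1 - k%:Z)%:~R - 1 - m%:R) v) (S m) w).
  exact: (fin1_jacobi20 H).
have finG3 : fin1 G3 by apply: fin1N; exact: fin1Z.
have e : jacobi20 Y u (a i (Negz k) v) w n s1 s2 =
  nsum (fun m => nsum (G1 m)) + nsum (fun m => nsum (G2 m)) + nsum G3.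
  rewrite -nsumD; [|exact: fin2_nsum|exact: fin2_nsum].
  rewrite -nsumD; [|apply: fin1D; exact: fin2_nsum|by []].
  apply: eq_nsum => m.
  have -> : Y u (- n%:~R - 1 - m%:R) (a i (Negz k) v) = a i (Negz k) (x m) -
      mu i *: Y u (- (n - 1 - k%:Z)%:~R - 1 - m%:R) v.
    rewrite (coherent_comm hu) NegzE.
    have -> : - n%:~R - 1 - m%:R - (- k.+1%:Z)%:~R = - (n - 1 - k%:Z)%:~R - 1 - m%:R :> F.
      by ring.
    by rewrite addrK.
  rewrite (linearB' (Yl _ _)) (linearZ' (Yl _ _)) scalerBr (no_normal H) scalerDr.
  rewrite (nsumZ _ (fin1_normal_neg H _ _ _ _ _)) (nsumZ _ (fin1_normal_pos H _ _ _ _ _)).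
  rewrite /G3; congr (_ + _ - _); try by apply: eq_nsum => r; rewrite scalerA.
  by rewrite !scalerA mulrC.
have e1 r : f1 r = nsum (fun m => G1 m r).
  rewrite /f1 /jacobi20 (linear_nsum (Al _ _)); last exact: (fin1_jacobi20 H).
  rewrite nsumZ; last by apply: (fin1_linear (Al _ _)); exact: (fin1_jacobi20 H).
  apply: eq_nsum => m; rewrite (linearZ' (Al _ _)) scalerA mulrC.
  by congr (_ *: a _ _ (Y _ _ _)); rewrite /S; ring.
have e2 r : f2 r = nsum (fun m => G2 m r).
  rewrite /f2 /jacobi20 nsumZ; last exact: (fin1_jacobi20 H).
  apply: eq_nsum => m; rewrite scalerA mulrC.
  by congr (_ *: Y _ _ _); rewrite /S; ring.
split; first by apply: (fin1_eq (fun r => esym (e1 r))); exact: fin2_nsumC.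
- by apply: (fin1_eq (fun r => esym (e2 r))); exact: fin2_nsumC.
- rewrite e /G3 nsumN; last exact: fin1Z.
  by rewrite -nsumZ // (eq_nsum e1) (eq_nsum e2) -(nsum_exch finG1) -(nsum_exch finG2).
Qed.

(** The values of X at all exponents form a family that is closed under commutators with
    the modes, as coherent_family_eq0 requires. *)
Definition coherent_step (mu nu : I -> F) (u v : W) (X : kernel W) : Prop :=
  forall i p w n s1 s2, a i p (X u v w n s1 s2) =
    X u v (a i p w) n s1 s2 + (mu i *: X u v w n (s1 - p%:~R) s2 +
                               nu i *: X u v w n s1 (s2 - p%:~R)).

Lemma coherent_step12 mu nu u v : coherent mu u -> coherent nu v ->
  coherent_step mu nu u v (jacobi12 Y).
Proof.
move=> hu hv i p w n s1 s2; rewrite /jacobi12.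
rewrite !(nsumZ _ (fin1_jacobi12 H _ _ _ _ _ _)).
rewrite (linear_nsum (Al _ _) (fin1_jacobi12 H _ _ _ _ _ _)).
rewrite -nsumD; try by apply: fin1Z; exact: (fin1_jacobi12 H).
rewrite -nsumD; [|exact: (fin1_jacobi12 H)|by apply: fin1D; apply: fin1Z; exact: (fin1_jacobi12 H)].
apply: eq_nsum => m; rewrite (linearZ' (Al _ _)) (coherent_comm hu) (coherent_comm hv).
rewrite (linearD' (Yr _ _)) (linearZ' (Yr _ _)) !scalerDr !scalerA [mu i * _]mulrC [nu i * _]mulrC.
rewrite addrAC -[LHS]addrA; congr (_ + (_ *: Y _ _ _ + _ *: Y _ _ (Y _ _ _))); ring.
Qed.

Lemma coherent_step21 mu nu u v : coherent mu u -> coherent nu v ->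
  coherent_step mu nu u v (jacobi21 Y).
Proof.
move=> hu hv i p w n s1 s2; rewrite jacobi21E /flip (linearZ' (Al _ _)).
rewrite (coherent_step12 hv hu) [X in _ + X]addrC !scalerDr !scalerA.
by rewrite [mu i * _]mulrC [nu i * _]mulrC.
Qed.

(** On Y(u, z_0) v the mode a(j) acts by mu z_0^j and, for j = 0, additionally by nu. Since
    \sum_j binom(p, j) z_0^j z_2^(p-j) = (z_2 + z_0)^p, the first of these amounts to a
    multiplication by mu z_1^p. *)
Lemma coherent_step20 mu nu u v : coherent mu u -> coherent nu v ->
  coherent_step mu nu u v (jacobi20 Y).
Proof.
move=> hu hv i p w n s1 s2.
pose c m := cbinom (- s1 - 1) m : F.
pose S m : F := s1 + s2 + 1 + m%:R.
pose x m := Y u (- n%:~R - 1 - m%:R) v.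
pose G1 m := c m *: Y (x m) (S m) (a i p w).
pose G2 m j := (mu i * (c m * cbinom p%:~R j)) *:
  Y (x (m + j)%N) (S m - p%:~R + j%:R) w.
pose G3 m := (nu i * c m) *: Y (x m) (S m - p%:~R) w.
have [Nx hNx] : fin1 x by exact: Ytr.
have finG1 : fin1 G1 by exact: (fin1_jacobi20 H).
have finG2 : fin2 G2 by exists Nx => m j h; rewrite /G2 hNx // (Y0 H) scaler0.
have finG3 : fin1 G3 by exists Nx => m h; rewrite /G3 hNx // (Y0 H) scaler0.
have e : a i p (jacobi20 Y u v w n s1 s2) = nsum G1 + (nsum (fun m => nsum (G2 m)) + nsum G3).
  rewrite /jacobi20 (linear_nsum (Al _ _) (fin1_jacobi20 H _ _ _ _ _ _)).
  rewrite -nsumD; [|exact: fin2_nsum|by []].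
  rewrite -nsumD; [|by []|by apply: fin1D => //; exact: fin2_nsum].
  apply: eq_nsum => m; rewrite (linearZ' (Al _ _)) Hcomm scalerDr; congr (_ + _).
  pose d (j : nat) := if j == 0%N then nu i *: Y (x m) (S m - p%:~R) w else 0.
  transitivity (c m *: nsum (fun j => cbinom p%:~R j *:
     (mu i *: Y (x (m + j)%N) (S m - p%:~R + j%:R) w + d j))).
    congr (_ *: _); apply: eq_nsum => j; congr (_ *: _).
    rewrite (coherent_comm hu) hv (linearD' (Yl _ _)) (linearZ' (Yl _ _)) addrC.
    congr (_ *: Y _ _ _ + _); first by rewrite /x; congr Y; rewrite natrD; ring.
    rewrite /d; case: eqP => [->|_]; last by rewrite (linear0' (Yr _ _)) (Y0 H).
    by rewrite (linearZ' (Yr _ _)) (linearZ' (Yl _ _)) addr0.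
  have find : fin1 d by exists 1%N => [[|j]].
  have finA : fin1 (fun j => mu i *: Y (x (m + j)%N) (S m - p%:~R + j%:R) w).
    by exists Nx => j h; rewrite hNx ?(Y0 H) ?scaler0 //; lia.
  rewrite nsumZ; last by apply: fin1Z; apply: fin1D.
  have -> : G3 m = nsum (fun j => (c m * cbinom p%:~R j) *: d j).
    rewrite (@nsum1 _ 0%N); last by move=> [|j] // _; rewrite /d /= scaler0.
    by rewrite /d /= cbinom0 mulr1 scalerA mulrC.
  rewrite -nsumD; [|exact: fin2_row|exact: fin1Z].
  apply: eq_nsum => j; rewrite scalerA scalerDr; congr (_ + _).
  by rewrite scalerA mulrC.
have e1 : nsum G1 = jacobi20 Y u v (a i p w) n s1 s2 by [].
have e2 : nsum (fun m => nsum (G2 m)) = mu i *: jacobi20 Y u v w n (s1 - p%:~R) s2.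
  pose X M := Y (x M) (s1 - p%:~R + s2 + 1 + M%:R) w.
  have finX : fin1 X by exists Nx => M h; rewrite /X hNx // (Y0 H).
  transitivity (mu i *: nsum (fun M => cbinom (- s1 - 1 + p%:~R) M *: X M)); last first.
    by congr (_ *: _); apply: eq_nsum => M; congr (cbinom _ _ *: _); ring.
  rewrite -nsum_vandermonde // nsumZ; last first.
    apply: fin2_nsum; case: finX => N hN; exists N => y z h.
    by rewrite hN // scaler0.
  apply: eq_nsum => m; rewrite nsumZ; last first.
    by apply: fin1Z; case: finX => N hN; exists N => y h; rewrite hN //; lia.
  apply: eq_nsum => j; rewrite scalerA /G2 /X.
  by congr (_ *: Y _ _ _); rewrite /S natrD; ring.
have e3 : nsum G3 = nu i *: jacobi20 Y u v w n s1 (s2 - p%:~R).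
  rewrite /jacobi20 (nsumZ _ (fin1_jacobi20 H _ _ _ _ _ _)); apply: eq_nsum => m.
  by rewrite scalerA /G3; congr (_ *: Y _ _ _); rewrite /S; ring.
by rewrite e e1 e2 e3.
Qed.

End JacobiCoherent.

(** * Fock spaces *)

Section Monomials.
Variable I : choiceType.
Implicit Types (m : {cmonom I}) (x y z : I).

Lemma cm_ext m m' : (forall x, m x = m' x) -> m = m'.
Proof. by move=> h; apply/eqP/cmP. Qed.

Lemma divcmUE m x y : divcm m (ucm x) y = (m y - (x == y))%N.
Proof. by rewrite divcmE ucmE. Qed.

Lemma mulcmUE m x y : mulcm m (ucm x) y = (m y + (x == y))%N.
Proof. by rewrite mulcmE ucmE. Qed.

Lemma divcm_divcmC m x y :
  divcm (divcm m (ucm x)) (ucm y) = divcm (divcm m (ucm y)) (ucm x).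
Proof. by apply: cm_ext => z; rewrite 4!divcmUE subnAC. Qed.

Lemma mulcm_mulcmC m x y :
  mulcm (mulcm m (ucm x)) (ucm y) = mulcm (mulcm m (ucm y)) (ucm x).
Proof. by apply: cm_ext => z; rewrite 4!mulcmUE addnAC. Qed.

Lemma mulcmUK m x : divcm (mulcm m (ucm x)) (ucm x) = m.
Proof. by apply: cm_ext => z; rewrite divcmUE mulcmUE addnK. Qed.

Lemma divcmUK m x : m x != 0%N -> mulcm (divcm m (ucm x)) (ucm x) = m.
Proof.
move=> nz; apply: cm_ext => z; rewrite mulcmUE divcmUE.
by have [<-|_] := eqVneq x z; rewrite ?subn0 ?addn0 // subnK // lt0n.
Qed.

Lemma divcm_mulcmC m x y : x != y ->
  divcm (mulcm m (ucm x)) (ucm y) = mulcm (divcm m (ucm y)) (ucm x).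
Proof.
move=> ne; apply: cm_ext => z; rewrite divcmUE 2!mulcmUE divcmUE.
have [e|_] := eqVneq y z; last by rewrite !subn0.
by rewrite -e (negbTE ne) !addn0.
Qed.

End Monomials.

#[local] Opaque onecm ucm mulcm divcm.

Section Weight.
Variable l : nat.
Local Notation mon := {cmonom ('I_l * nat)%type}.
Implicit Types (m : mon) (x : ('I_l * nat)%type).

(** The conformal weight of a monomial, without the contribution of the momentum. *)
Definition weight m : nat := (\sum_(x <- finsupp m) m x * x.2.+1)%N.

Lemma weightEw m (d : {fset ('I_l * nat)%type}) : (finsupp m `<=` d)%fset ->
  weight m = (\sum_(x <- d) m x * x.2.+1)%N.
Proof.
move=> h; rewrite /weight (big_fset_incl _ h) // => x _ hx.
by rewrite (_ : m x = 0%N) // fsfun_dflt.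
Qed.

Lemma cm_eq0P m : (forall x, m x = 0%N) -> m = onecm _.
Proof. by move=> h; apply: cm_ext => x; rewrite h onecmE. Qed.

Lemma weight1 : weight (onecm _) = 0%N.
Proof. by rewrite /weight big1 // => x _; rewrite onecmE. Qed.

Lemma weightM m x : weight (mulcm m (ucm x)) = (weight m + x.2.+1)%N.
Proof.
pose d := (x |` (finsupp m `|` finsupp (mulcm m (ucm x))))%fset.
have h1 : (finsupp m `<=` d)%fset by rewrite /d fsubsetU // fsubsetUl orbT.
have h2 : (finsupp (mulcm m (ucm x)) `<=` d)%fset.
  by rewrite /d fsubsetU // fsubsetUr orbT.
have hx : x \in d by rewrite /d in_fset1U eqxx.
rewrite (weightEw h1) (weightEw h2).
rewrite [RHS](_ : _ = \sum_(z <- d) (m z * z.2.+1 + (if z == x then z.2.+1 else 0)))%N.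
  apply: eq_bigr => z _; rewrite mulcmUE [x == z]eq_sym mulnDl.
  by case: eqP => _; rewrite ?mul1n ?mul0n.
rewrite big_split /=; congr addn; rewrite -big_mkcond /= -big_filter.
have -> : [seq i0 <- d | i0 == x] = [:: x].
  by apply: filter_pred1_uniq => //; exact: fset_uniq.
by rewrite big_seq1.
Qed.

Lemma weight_div m x : m x != 0%N -> (weight (divcm m (ucm x)) + x.2.+1)%N = weight m.
Proof. by move=> nz; rewrite -weightM divcmUK. Qed.

Lemma weight_ge m x : m x != 0%N -> (x.2 < weight m)%N.
Proof. by move=> /weight_div <-; exact: leq_addl. Qed.

Lemma mon_ind (P : mon -> Prop) : P (onecm _) ->
  (forall m x, P m -> P (mulcm m (ucm x))) -> forall m, P m.
Proof.
move=> h1 hS m; have [d] := ubnP (weight m); elim: d m => // d IH m hd.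
have [[x hx]|h] := pselect (exists x, m x != 0%N); last first.
  by rewrite (cm_eq0P (m := m)) // => x; apply/eqP; apply: contrapT => hx; apply: h; exists x; apply/negP.
rewrite -(divcmUK hx); apply: hS; apply: IH.
by move: hd; rewrite -(weight_div hx); move: (weight _); clear; lia.
Qed.

End Weight.

(** The pair (m, be) is the index of the vector m 1 (x) e^be. *)
Definition fkey (F : numFieldType) (l : nat) : choiceType :=
  ({cmonom 'I_l * nat} * 'rV[F]_l)%type.

Section FockSpace.
Variables (F : numFieldType) (l : nat) (W : lmodType F).
Local Notation key := (fkey F l).
Variables (bvec : key -> W) (coef : key -> W -> F) (supp : W -> seq key).
Variables (heis : 'I_l -> int -> W -> W).

(** A space with a basis of vectors m 1 (x) e^be, on which the Heisenberg modes act as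
    multiplications and derivations of polynomials. The arguments
    below refer to such a basis only, which keeps them free of the details of formal
    linear combinations. *)
Record fock_space : Prop := {
  coef_linear : forall b c u v, coef b (c *: u + v) = c * coef b u + coef b v;
  coef_bvec : forall b b', coef b (bvec b') = (b' == b)%:R;
  fock_span : forall w, w = \sum_(k <- supp w) coef k w *: bvec k;
  heis_linear : forall i n, linear (heis i n);
  heis0 : forall i b, heis i (Posz 0) (bvec b) = b.2 0 i *: bvec b;
  heisP : forall i k b, heis i k.+1 (bvec b) =
    (k.+1 * b.1 (i, k))%:R *: bvec (divcm b.1 (ucm (i, k)), b.2);
  heisN : forall i k b, heis i (Negz k) (bvec b) = bvec (mulcm b.1 (ucm (i, k)), b.2)
}.

Hypothesis H : fock_space.
Implicit Types (b : key) (w : W).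

Lemma vcoef0 b : coef b 0 = 0.
Proof. by have := coef_linear H b (-1) 0 0; rewrite scaler0 addr0 mulN1r addNr. Qed.

Lemma vcoefZ b c w : coef b (c *: w) = c * coef b w.
Proof. by have := coef_linear H b c w 0; rewrite vcoef0 !addr0. Qed.

Lemma vcoefD b u v : coef b (u + v) = coef b u + coef b v.
Proof. by have := coef_linear H b 1 u v; rewrite scale1r mul1r. Qed.

Lemma linear_coef b : linear (coef b : W -> F^o).
Proof. exact: coef_linear. Qed.

Lemma coef_eq0 w : (forall b, coef b w = 0) -> w = 0.
Proof.
by move=> h; rewrite (fock_span H w) big1 // => k _; rewrite h scale0r.
Qed.

Lemma coef_inj u v : (forall b, coef b u = coef b v) -> u = v.
Proof.
move=> h; apply/eqP; rewrite -subr_eq0; apply/eqP/coef_eq0 => b.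
by rewrite vcoefD -scaleN1r vcoefZ h mulN1r addrN.
Qed.

Lemma linear_ext (X : lmodType F) (f g : W -> X) : linear f -> linear g ->
  (forall b, f (bvec b) = g (bvec b)) -> forall w, f w = g w.
Proof.
move=> hf hg h w; rewrite (fock_span H w) !linear_sum' //.
by apply: eq_bigr => k _; rewrite !linearZ' // h.
Qed.

Lemma fock_ind (P : W -> Prop) : P 0 ->
  (forall c u v, P u -> P v -> P (c *: u + v)) -> (forall b, P (bvec b)) ->
  forall w, P w.
Proof.
move=> h0 hl hb w; rewrite (fock_span H w).
elim: (X in \sum_(k <- X) _) => [|k r IH]; first by rewrite big_nil.
by rewrite big_cons; apply: hl.
Qed.

Definition supported (P : key -> Prop) w : Prop := forall b, coef b w != 0 -> P b.

Lemma supported0 P : supported P 0.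
Proof. by move=> b; rewrite vcoef0 eqxx. Qed.

Lemma supportedP (P : key -> Prop) c u v :
  supported P u -> supported P v -> supported P (c *: u + v).
Proof.
move=> hu hv b; rewrite (coef_linear H) => hb; apply: contrapT => hP.
move/eqP: hb; apply; have [e1 e2] : coef b u = 0 /\ coef b v = 0.
  by split; apply: contrapT => /eqP; [move/hu|move/hv].
by rewrite e1 e2 mulr0 addr0.
Qed.

Lemma supportedD (P : key -> Prop) u v :
  supported P u -> supported P v -> supported P (u + v).
Proof. by move=> hu hv; rewrite -[u]scale1r; apply: supportedP. Qed.

Lemma supportedZ (P : key -> Prop) c u : supported P u -> supported P (c *: u).
Proof.
by move=> hu; rewrite -[_ *: _]addr0; apply: supportedP => //; exact: supported0.
Qed.

Lemma supported_sum (P : key -> Prop) (J : Type) (r : seq J) (p : pred J) (f : J -> W) :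
  (forall j, p j -> supported P (f j)) -> supported P (\sum_(j <- r | p j) f j).
Proof. by move=> h; apply: big_ind; [exact: supported0|exact: supportedD|]. Qed.

Lemma supported_fsum (P : key -> Prop) (J : choiceType) (D : set J) (f : J -> W) :
  (forall j, supported P (f j)) -> supported P (\sum_(j \in D) f j).
Proof. by move=> h; apply: supported_sum. Qed.

Lemma supported_nsum (P : key -> Prop) (f : nat -> W) :
  (forall j, supported P (f j)) -> supported P (nsum f).
Proof. by move=> h; apply: supported_fsum. Qed.

Lemma supported_bvec (P : key -> Prop) b : P b -> supported P (bvec b).
Proof. by move=> h k; rewrite (coef_bvec H) pnatr_eq0 eqb0 negbK => /eqP <-. Qed.

Lemma supportedS (P Q : key -> Prop) w : (forall b, P b -> Q b) ->
  supported P w -> supported Q w.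
Proof. by move=> h hw b /hw/h. Qed.

Lemma supported_empty (P : key -> Prop) w : supported P w -> (forall b, ~ P b) -> w = 0.
Proof.
by move=> hw hP; apply: coef_eq0 => b; apply: contrapT => /eqP/hw/hP.
Qed.

Lemma supported_ind (P : key -> Prop) (S : W -> Prop) : S 0 ->
  (forall c u v, S u -> S v -> S (c *: u + v)) -> (forall b, P b -> S (bvec b)) ->
  forall w, supported P w -> S w.
Proof.
move=> h0 hl hb w hw; rewrite (fock_span H w).
elim: (X in \sum_(k <- X) _) => [|k r IH]; first by rewrite big_nil.
rewrite big_cons; have [->|nz] := eqVneq (coef k w) 0; first by rewrite scale0r add0r.
by apply: hl => //; apply: hb; exact: hw.
Qed.

Lemma linear_ext_on (P : key -> Prop) (X : lmodType F) (f g : W -> X) :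
  linear f -> linear g ->
  (forall b, P b -> f (bvec b) = g (bvec b)) -> forall w, supported P w -> f w = g w.
Proof.
move=> hf hg h w hw; apply: (@supported_ind P (fun w => f w = g w) _ _ h w hw).
  by rewrite (linear0' hf) (linear0' hg).
by move=> c u v hu hv; rewrite hf hg hu hv.
Qed.

Lemma supported_linear (P Q : key -> Prop) (f : W -> W) : linear f ->
  (forall b, P b -> supported Q (f (bvec b))) ->
  forall w, supported P w -> supported Q (f w).
Proof.
move=> hf h; apply: (@supported_ind P (fun w => supported Q (f w))) => //.
  by rewrite linear0' //; exact: supported0.
by move=> c u v hu hv; rewrite hf; apply: supportedP.
Qed.

Let heisZ i n := linearZ' (heis_linear H i n).

Lemma natscale_bvec (p q : nat) (x : W) : p = q -> p%:R *: x = q%:R *: x.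
Proof. by move->. Qed.

Lemma heisPN i k j k' b : heis i k.+1 (heis j (Negz k') (bvec b)) =
  heis j (Negz k') (heis i k.+1 (bvec b)) +
  (if (i == j) && (k == k') then (k.+1%:R : F) *: bvec b else 0).
Proof.
rewrite (heisP H) (heisN H) heisZ (heisP H) (heisN H) mulcmUE.
set x := (i, k); set y := (j, k'); case: b => m be /=.
rewrite [X in if X then _ else _](_ : _ = (y == x)); last first.
  by rewrite xpair_eqE [j == i]eq_sym [k' == k]eq_sym.
have [->|ne] := eqVneq y x.
  rewrite mulcmUK addn1 mulnSr natrD scalerDl; congr (_ + _).
  have [z|nz] := eqVneq (m x) 0%N; first by rewrite z muln0 !scale0r.
  by rewrite divcmUK.
by rewrite addn0 addr0 divcm_mulcmC.
Qed.

Lemma heisPP i k j k' b :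
  heis i k.+1 (heis j k'.+1 (bvec b)) = heis j k'.+1 (heis i k.+1 (bvec b)).
Proof.
rewrite 2!(heisP H) 2!heisZ 2!(heisP H) 2!scalerA -2!natrM /=.
have e1 := divcmUE b.1 (j, k') (i, k); have e2 := divcmUE b.1 (i, k) (j, k').
have e3 := divcm_divcmC b.1 (i, k) (j, k').
rewrite e1 e2 e3; apply: natscale_bvec.
by have [[-> ->]|_] := eqVneq (j, k') (i, k); rewrite // 2!subn0 mulnC.
Qed.

Lemma heis_comm i j m n w : heis i m (heis j n w) = heis j n (heis i m w) +
    (if (i == j) && (m + n == 0) then m%:~R *: w else 0).
Proof.
pose Rm := fun w => heis i m (heis j n w).
pose T := fun w : W => if (i == j) && (m + n == 0) then m%:~R *: w else 0.
pose Rm' := fun w => heis j n (heis i m w) + T w.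
have [hi hj] := (heis_linear H i m, heis_linear H j n).
apply: (linear_ext (f := Rm) (g := Rm')).
- exact: linear_comp'.
- apply: (linear_add' (f := fun w => heis j n (heis i m w))).
    exact: linear_comp'.
  rewrite /T; case: ((i == j) && (m + n == 0)); last exact: linear_cst0.
  exact: (linear_scale' m%:~R (@linear_id' _ _)).
case=> b be; rewrite /Rm /Rm' /T {Rm Rm' T}.
case: m hi => [[|k]|k] hi; case: n hj => [[|k']|k'] hj.
- rewrite !(heis0 H) !heisZ !(heis0 H) !scalerA mulrC mulr0z scale0r.
  by rewrite if_same addr0.
- rewrite andbF (heis0 H) (heisP H) !heisZ (heisP H) (heis0 H) /= addr0.
  by rewrite !scalerA mulrC.
- by rewrite andbF (heis0 H) (heisN H) !heisZ (heis0 H) (heisN H) /= addr0.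
- rewrite andbF (heis0 H) (heisP H) !heisZ (heisP H) (heis0 H) /= addr0.
  by rewrite !scalerA mulrC.
- by rewrite andbF addr0 heisPP.
- rewrite heisPN; congr (_ + _); rewrite (_ : (_ == 0) = (k == k')) //; lia.
- by rewrite andbF (heis0 H) (heisN H) !heisZ (heis0 H) (heisN H) /= addr0.
- rewrite heisPN -addrA [X in _ = _ + X](_ : _ = 0) ?addr0 //.
  rewrite (_ : (Negz k + Posz k'.+1 == 0) = (k' == k)); last by lia.
  rewrite [j == i]eq_sym [k' == k]eq_sym.
  have [->|_] := eqVneq k k'; last by rewrite !andbF addr0.
  by case: (i == j); rewrite ?addr0 // NegzE mulrNz -scalerDl subrr scale0r.
- by rewrite !(heisN H) andbF addr0 mulcm_mulcmC.
Qed.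

Lemma heis_weight i k d w : supported (fun b => (weight b.1 <= d)%N) w ->
  supported (fun b => (weight b.1 + k.+1 <= d)%N) (heis i k.+1 w).
Proof.
apply: supported_linear; first exact: heis_linear.
move=> b hb; rewrite (heisP H); have [z|nz] := eqVneq (b.1 (i, k)) 0%N.
  by rewrite z muln0 scale0r; exact: supported0.
apply: supportedZ; apply: supported_bvec; apply: leq_trans hb.
exact: eq_leq (weight_div nz).
Qed.

Lemma weight_bounded w : exists d, supported (fun b => (weight b.1 <= d)%N) w.
Proof.
apply: (fock_ind (P := fun w => exists d, supported (fun b => (weight b.1 <= d)%N) w)).
- by exists 0%N; exact: supported0.
- move=> c u v [d1 h1] [d2 h2]; exists (maxn d1 d2); apply: supportedP.
    by apply: supportedS h1 => b h; rewrite leq_max h.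
  by apply: supportedS h2 => b h; rewrite leq_max h orbT.
- by move=> b; exists (weight b.1); apply: supported_bvec.
Qed.

Lemma heis_trunc i w : fin1 (fun n : nat => heis i n w).
Proof.
have [d hd] := weight_bounded w; exists d.+1 => -[|n] // hn.
apply: (@supported_empty (fun b => (weight b.1 + n.+1 <= d)%N)); first exact: heis_weight.
by move=> b; lia.
Qed.

Lemma vcoef_sum b (J : Type) (r : seq J) (p : pred J) (f : J -> W) :
  coef b (\sum_(j <- r | p j) f j) = \sum_(j <- r | p j) coef b (f j).
Proof. by apply: (big_morph (coef b)); [exact: vcoefD|exact: vcoef0]. Qed.

End FockSpace.

(** * Products and exponentials of operator series *)

Section IndexSums.
Variable V : zmodType.

Lemma fsum_neg (f : int -> V) :
  \sum_(n \in [set n : int | n < 0]) f n = nsum (fun r => f (Negz r)).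
Proof.
apply: (reindex_fsbig Negz); split => //=.
- by move=> i j _ _ [].
- by move=> [n|n] //= _; exists n.
Qed.

Lemma fsum_nneg (f : int -> V) :
  \sum_(n \in [set n : int | 0 <= n]) f n = nsum (fun r => f (Posz r)).
Proof.
apply: (reindex_fsbig Posz); split => //=.
- by move=> i j _ _ [].
- by move=> [n|n] //= _; exists n.
Qed.

Lemma fsum_pos (f : nat -> V) :
  \sum_(n \in [set n : nat | (0 < n)%N]) f n = nsum (fun n => f n.+1).
Proof.
apply: (reindex_fsbig succn); split => //=.
- by move=> i j _ _ [].
- by move=> [|n] //= _; exists n.
Qed.

Lemma nsum_big (J : Type) (r : seq J) (f : J -> nat -> V) : (forall j, fin1 (f j)) ->
  nsum (fun n => \sum_(j <- r) f j n) = \sum_(j <- r) nsum (f j).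
Proof.
move=> hf; elim: r => [|j r IH].
  by rewrite big_nil nsum_eq0 // => n; rewrite big_nil.
rewrite big_cons -IH -nsumD //.
  by apply: eq_nsum => n; rewrite big_cons.
elim: r {IH} => [|i r [N hN]]; first by exists 0%N => n _; rewrite big_nil.
have [M hM] := hf i; exists (maxn N M) => n; rewrite geq_max big_cons => /andP[h1 h2].
by rewrite hM // add0r hN.
Qed.

Lemma fin1_big (J : Type) (r : seq J) (f : J -> nat -> V) : (forall j, fin1 (f j)) ->
  fin1 (fun n => \sum_(j <- r) f j n).
Proof.
move=> hf; elim: r => [|i r [N hN]]; first by exists 0%N => n _; rewrite big_nil.
have [M hM] := hf i; exists (maxn N M) => n; rewrite geq_max big_cons => /andP[h1 h2].
by rewrite hM // add0r hN.
Qed.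

End IndexSums.

Section OperatorSeries.
Variables (F : numFieldType) (W : lmodType F).
Implicit Types (A B X : F -> W -> W).

Lemma op_mul_seq (T : seq F) A B s w : uniq T ->
  (forall t, t \notin T -> A t (B (s - t) w) = 0) ->
  op_mul A B s w = \sum_(t <- T) A t (B (s - t) w).
Proof.
move=> uT hT; rewrite /op_mul -(fsbig_widen [set` T]) //; first by rewrite -fsbig_seq.
by move=> t /= [_ /negP]; exact: hT.
Qed.

Lemma op_sum_at (I : choiceType) (D : set I) (e : I -> F) (A : I -> W -> W) n w :
  set_inj D e -> D n -> op_sum D e A (e n) w = A n w.
Proof.
move=> he Dn; rewrite /op_sum /formal_sum (_ : _ `&` _ = [set n]) ?fsbig_set1 //.
apply/seteqP; split => m /=; last by move->.
by move=> [Dm em]; apply: he; rewrite ?inE.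
Qed.

Lemma op_sum_out (I : choiceType) (D : set I) (e : I -> F) (A : I -> W -> W) t w :
  ~ (e @` D) t -> op_sum D e A t w = 0.
Proof.
move=> ht; rewrite /op_sum /formal_sum (_ : _ `&` _ = set0) ?fsbig_set0 //.
by apply/seteqP; split => // m [Dm em]; apply: ht; exists m.
Qed.

Lemma op_mul_suml (I : choiceType) (D : set I) (e : I -> F) (A : I -> W -> W) B s w :
  set_inj D e ->
  op_mul (op_sum D e A) B s w = \sum_(n \in D) A n (B (s - e n) w).
Proof.
move=> he; rewrite /op_mul -(fsbig_widen (e @` D)) //; last first.
  by move=> t /= [_ ht]; exact: op_sum_out.
by rewrite fsbig_image //; apply: eq_fsbigr => n /set_mem Dn; exact: op_sum_at.
Qed.

Lemma op_mul_sumr (I : choiceType) (D : set I) (e : I -> F) (A : I -> W -> W) B s w :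
  (forall t, B t 0 = 0) -> set_inj D e ->
  op_mul B (op_sum D e A) s w = \sum_(n \in D) B (s - e n) (A n w).
Proof.
move=> B0 he; rewrite /op_mul -(fsbig_widen ((fun n => s - e n) @` D)) //; last first.
  move=> t /= [_ ht]; rewrite op_sum_out // => -[n Dn en]; apply: ht.
  by exists n => //; rewrite en subKr.
rewrite fsbig_image; last by move=> i j Di Dj /addrI/oppr_inj; exact: he.
by apply: eq_fsbigr => n /set_mem Dn; rewrite subKr op_sum_at.
Qed.

Lemma op_mul_nat A B s w : (forall t x, (forall n : nat, t <> n%:R) -> A t x = 0) ->
  op_mul A B s w = nsum (fun n => A n%:R (B (s - n%:R) w)).
Proof.
move=> hA; rewrite /op_mul -(fsbig_widen ((fun n : nat => n%:R) @` [set: nat])) //; last first.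
  by move=> t /= [_ ht]; apply: hA => n hn; apply: ht; exists n.
by rewrite fsbig_image // => i j _ _ /eqP; rewrite eqr_nat => /eqP.
Qed.

Lemma op_mul_shift A B s c w :
  \sum_(t \in [set: F]) A (t + c) (B (s - t) w) = op_mul A B (s + c) w.
Proof.
rewrite /op_mul [RHS](reindex_fsbigT (fun t => t + c)); last first.
  by exists (fun t => t - c) => t; rewrite ?addrK ?subrK.
by apply: eq_fsbigr => t _; rewrite opprD addrACA subrr addr0.
Qed.

(** Products of series are well defined if the right factor has finitely many terms on
    each vector (finite_op), or if the left factor has exponents in the natural numbers
    and those of the right factor are bounded below in each class modulo Z (trunc_op). *)
Definition finite_op B : Prop := forall w, finite_set [set t | B t w != 0].

Definition trunc_op X : Prop := forall w s, fin1 (fun n => X (s - n%:R) w).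

Lemma finite_opP B w : finite_op B ->
  exists2 T : seq F, uniq T & forall t, t \notin T -> B t w = 0.
Proof.
move=> /(_ w)/finite_seqP[T hT]; exists (undup T); first exact: undup_uniq.
move=> t; rewrite mem_undup => /negP ht; apply/eqP; apply: contrapT => h.
by apply: ht; have : [set` T] t by rewrite -hT; apply/negP.
Qed.

Lemma finite_op_shift B s w : finite_op B ->
  exists2 T : seq F, uniq T & forall t, t \notin T -> B (s - t) w = 0.
Proof.
move=> fB; have [T uT hT] := finite_opP w fB; exists [seq s - t | t <- T].
  by rewrite map_inj_uniq // => x y /addrI/oppr_inj.
move=> t ht; rewrite hT //; apply: contra ht => h.
by apply/mapP; exists (s - t) => //; rewrite subKr.
Qed.

Lemma linear_op_mul A B s : (forall t, linear (A t)) -> (forall t, linear (B t)) ->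
  (forall w, finite_set [set t | A t (B (s - t) w) != 0]) ->
  linear (op_mul A B s).
Proof.
move=> lA lB fin c u v.
have [[Tu hu] [Tv hv]] := (proj1 (finite_seqP _) (fin u), proj1 (finite_seqP _) (fin v)).
pose T := undup (Tu ++ Tv).
have notT t : t \notin T -> (A t (B (s - t) u) = 0) * (A t (B (s - t) v) = 0).
  rewrite mem_undup mem_cat negb_or => /andP[/negP h1 /negP h2]; split;
    apply/eqP; apply: contrapT => /negP h.
    by apply: h1; have : [set` Tu] t by rewrite -hu.
  by apply: h2; have : [set` Tv] t by rewrite -hv.
have uT : uniq T by exact: undup_uniq.
rewrite (op_mul_seq (T := T)) // => [|t /notT[h1 h2]]; last first.
  by rewrite lB lA h1 h2 scaler0 addr0.
rewrite (op_mul_seq (T := T)) // => [|t /notT[]//].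
rewrite [X in _ = _ + X](op_mul_seq (T := T)) // => [|t /notT[]//].
by rewrite scaler_sumr -big_split; apply: eq_bigr => t _; rewrite lB lA.
Qed.

Lemma linear_op_mul_finite A B s : (forall t, linear (A t)) -> (forall t, linear (B t)) ->
  finite_op B -> linear (op_mul A B s).
Proof.
move=> lA lB fB; apply: linear_op_mul => // w.
have [T _ hT] := finite_op_shift s w fB.
apply: (@sub_finite_set _ _ [set` T]); last exact: finite_seq.
move=> t /= ht; apply: contrapT => /negP nt; move/eqP: ht; apply.
by rewrite hT ?linear0'.
Qed.

Lemma trunc_op_mul_finite A B : (forall t, linear (A t)) -> trunc_op A -> finite_op B ->
  trunc_op (op_mul A B).
Proof.
move=> lA tA fB w s; have [T uT hT] := finite_opP w fB.
have e s' : op_mul A B s' w = \sum_(t <- T) A (s' - t) (B t w).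
  rewrite (op_mul_seq (T := [seq s' - t | t <- T])).
  - by rewrite big_map; apply: eq_bigr => t _; rewrite subKr.
  - by rewrite map_inj_uniq // => x y /addrI/oppr_inj.
  - move=> t ht; rewrite hT ?linear0' //; apply: contra ht => h.
    by apply/mapP; exists (s' - t) => //; rewrite subKr.
apply: (@fin1_eq _ (fun n => \sum_(t <- T) A (s - t - n%:R) (B t w))).
  by move=> n; rewrite e; apply: eq_bigr => t _; rewrite addrAC.
by apply: fin1_big => t; exact: tA.
Qed.

Section PowerSeries.
Variables (K X : opseries W).
Hypotheses (K_linear : forall t, linear (K t)) (X_linear : forall t, linear (X t)).
Hypothesis K_nat : forall t x, (forall n : nat, t <> n%:R) -> K t x = 0.
Hypothesis X_trunc : trunc_op X.

Lemma fin1_op_mul_nat s w : fin1 (fun n => K n%:R (X (s - n%:R) w)).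
Proof. exact: (fin1_linear_fam (h := fun n => K n%:R)). Qed.

Lemma linear_op_mul_nat s : linear (op_mul K X s).
Proof.
rewrite (_ : op_mul K X s = fun w => nsum (fun n => K n%:R (X (s - n%:R) w))).
  by apply: linear_nsum_fam => [n|w]; [exact: linear_comp'|exact: fin1_op_mul_nat].
by apply/funext => w; exact: op_mul_nat.
Qed.

Lemma trunc_op_mul_nat : trunc_op (op_mul K X).
Proof.
move=> w s; have [N hN] := X_trunc w s; exists N => n hn.
rewrite op_mul_nat // nsum_eq0 // => q; rewrite -addrA -opprD -natrD.
by rewrite hN ?linear0' //; lia.
Qed.

End PowerSeries.

End OperatorSeries.

(** The exponential of a series A = \sum_(n > 0) x_n z^(sg n) with commuting coefficients.
    As A^k has no exponents sg p with p < k, each coefficient of the exponential is a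
    finite sum. *)
Section Exponential.
Variables (F : numFieldType) (W : lmodType F).
Variables (x : nat -> W -> W) (sg : F) (e : nat -> F).
Hypothesis x_linear : forall n, linear (x n).
Hypothesis x_comm : forall m n w, x m (x n w) = x n (x m w).
Hypothesis sg_neq0 : sg != 0.
Hypothesis eE : forall n, e n = sg * n%:R.

Let A : opseries W := op_sum [set n : nat | (0 < n)%N] e x.
Let E k : opseries W := iter k (op_mul A) (@op_one F W).
Let lx n := x_linear n.

Lemma exponent_inj : injective e.
Proof. by move=> m n; rewrite !eE => /(mulfI sg_neq0)/eqP; rewrite eqr_nat => /eqP. Qed.

Lemma sub_exponent s n q : s - e n = e q -> s = e (q + n).
Proof. by move=> es; rewrite -(subrK (e n) s) es !eE natrD mulrDr. Qed.

Lemma exp_power0 s w : E 0 s w = if s == 0 then w else 0.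
Proof. by []. Qed.

Lemma exp_powerS k s w : E k.+1 s w = nsum (fun n => x n.+1 (E k (s - e n.+1) w)).
Proof.
rewrite -(fsum_pos (fun n => x n (E k (s - e n) w))).
by apply: op_mul_suml => m n _ _; exact: exponent_inj.
Qed.

Lemma exp_power_support k s w : (forall p : nat, (k <= p)%N -> s <> e p) -> E k s w = 0.
Proof.
elim: k s => [|k IH] s hs.
  by rewrite exp_power0; case: eqP => // s0; have := hs 0%N isT; rewrite eE mulr0.
rewrite exp_powerS nsum_eq0 // => n; rewrite IH ?linear0' // => p hp es.
by apply: (hs (p + n.+1)%N); [lia | exact: sub_exponent].
Qed.

Lemma exp_power_small k p w : (p < k)%N -> E k (e p) w = 0.
Proof.
move=> h; apply: exp_power_support => q hq /exponent_inj; lia.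
Qed.

Lemma exp_power_fin k s w : fin1 (fun n => E k (s - e n.+1) w).
Proof.
have [[p ->]|h] := pselect (exists p, s = e p); last first.
  exists 0%N => n _; apply: exp_power_support => p _ /sub_exponent es; apply: h.
  by exists (p + n.+1)%N.
exists p => n hn; apply: exp_power_support => q _ /sub_exponent/exponent_inj; lia.
Qed.

Lemma exp_series_fin s w : fin1 (fun k => E k s w).
Proof.
have [[p ->]|h] := pselect (exists p, s = e p); last first.
  by exists 0%N => n _; apply: exp_power_support => p _ es; apply: h; exists p.
by exists p.+1 => k hk; apply: exp_power_small.
Qed.

Lemma exp_power_linear k s : linear (E k s).
Proof.
elim: k s => [|k IH] s.
  by move=> c u v; rewrite !exp_power0; case: ifP => _ //; rewrite scaler0 addr0.
have -> : E k.+1 s = fun w => nsum (fun n => x n.+1 (E k (s - e n.+1) w)).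
  by apply/funext => w; rewrite exp_powerS.
apply: linear_nsum_fam => [n|w]; first exact: linear_comp'.
by apply: (fin1_linear_fam (h := fun n => x n.+1)) => //; exact: exp_power_fin.
Qed.

Lemma op_expE s w : op_exp A s w = nsum (fun k => k`!%:R^-1 *: E k s w).
Proof. by []. Qed.

Lemma op_exp_linear s : linear (op_exp A s).
Proof.
rewrite (_ : op_exp A s = fun w => nsum (fun k => k`!%:R^-1 *: E k s w)); last first.
  by apply/funext => w.
apply: linear_nsum_fam => [k|w]; first by apply: linear_scale'; exact: exp_power_linear.
by apply: fin1Z; exact: exp_series_fin.
Qed.

Lemma op_exp_support s w : (forall p, s <> e p) -> op_exp A s w = 0.
Proof.
move=> h; rewrite op_expE nsum_eq0 // => k.
by rewrite exp_power_support ?scaler0.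
Qed.

Lemma op_exp0 w : op_exp A 0 w = w.
Proof.
rewrite op_expE (@nsum1 _ 0%N) => [|[|k] // _].
  by rewrite exp_power0 eqxx fact0 invr1 scale1r.
by rewrite (_ : 0 = e 0%N) ?exp_power_small ?scaler0 // eE mulr0.
Qed.

Lemma op_exp_closed (S : W -> Prop) : S 0 -> (forall u v, S u -> S v -> S (u + v)) ->
  (forall c u, S u -> S (c *: u)) -> (forall n w, S w -> S (x n.+1 w)) ->
  forall s w, S w -> S (op_exp A s w).
Proof.
move=> S0 SD SZ Sx s w Sw.
have Snsum (f : nat -> W) : (forall n, S (f n)) -> S (nsum f).
  by move=> hf; apply: big_ind.
suff SE k t : S (E k t w) by apply: Snsum => k; apply: SZ; exact: SE.
elim: k t => [|k IH] t; first by rewrite exp_power0; case: ifP.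
by rewrite exp_powerS; apply: Snsum => n; apply: Sx.
Qed.

(** If T commutes with all x_n but one, with which its commutator is a scalar c, then
    [T, exp(A)] = c z^(e n) exp(A) for the exponent e n of this one: T acts on the powers
    of A as a derivation, and the scalar commutes with A. *)
Section Commutator.
Variables (T : W -> W) (n0 : nat) (c : F).
Hypothesis T_linear : linear T.
Hypothesis T_comm : forall n w,
  T (x n.+1 w) = x n.+1 (T w) + (if n == n0 then c *: w else 0).

Lemma exp_power_comm k s w :
  T (E k s w) = E k s (T w) + (k%:R * c) *: E k.-1 (s - e n0.+1) w.
Proof.
elim: k s => [|k IH] s.
  by rewrite !exp_power0 mul0r scale0r addr0; case: ifP => // _; rewrite linear0'.
have fin := exp_power_fin.
have fink w' : fin1 (fun n => x n.+1 (E k (s - e n.+1) w')).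
  exact: (fin1_linear_fam (h := fun n => x n.+1)).
rewrite !exp_powerS (linear_nsum T_linear) //.
transitivity (nsum (fun n => x n.+1 (E k (s - e n.+1) (T w)) +
   ((k%:R * c) *: x n.+1 (E k.-1 (s - e n0.+1 - e n.+1) w) +
   if n == n0 then c *: E k (s - e n0.+1) w else 0))).
  apply: eq_nsum => n; rewrite T_comm IH (linearD' (lx _)) (linearZ' (lx _)).
  rewrite -[LHS]addrA (addrAC s); congr (_ + (_ + _)).
  by case: eqP => // ->.
have fin' : fin1 (fun n => if n == n0 then c *: E k (s - e n0.+1) w else 0).
  by exists n0.+1 => n hn; rewrite ifN //; apply/eqP; lia.
have fin'' : fin1 (fun n => (k%:R * c) *: x n.+1 (E k.-1 (s - e n0.+1 - e n.+1) w)).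
  by apply: fin1Z; exact: (fin1_linear_fam (h := fun n => x n.+1)).
rewrite !nsumD //; last exact: fin1D.
congr (_ + _); rewrite [X in _ + X = _](@nsum1 _ n0) ?eqxx; last by move=> i /negbTE ->.
rewrite -nsumZ; last exact: (fin1_linear_fam (h := fun n => x n.+1)).
rewrite /= -natr1 mulrDl mul1r scalerDl; congr (_ + _).
case: k {IH fink fin' fin''} => [|k]; first by rewrite !mul0r !scale0r.
by rewrite exp_powerS.
Qed.

Lemma op_exp_comm s w :
  T (op_exp A s w) = op_exp A s (T w) + c *: op_exp A (s - e n0.+1) w.
Proof.
have fin w' s' : fin1 (fun k => k`!%:R^-1 *: E k s' w').
  by apply: fin1Z; exact: exp_series_fin.
rewrite !op_expE (linear_nsum T_linear) // nsumZ //.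
transitivity (nsum (fun k => k`!%:R^-1 *: E k s (T w) +
   (k`!%:R^-1 * (k%:R * c)) *: E k.-1 (s - e n0.+1) w)).
  by apply: eq_nsum => k; rewrite (linearZ' T_linear) exp_power_comm scalerDr scalerA.
rewrite nsumD //; last first.
  apply: fin1Z; have [N hN] := exp_series_fin (s - e n0.+1) w.
  by exists N.+1 => -[|n] // hn; exact: hN.
congr (_ + _); rewrite (@nsum_shift _ 1); last first.
  by move=> [|i] //; rewrite mul0r mulr0 scale0r.
apply: eq_nsum => k; rewrite add1n /= scalerA factS natrM; congr (_ *: _).
by field; rewrite factf_neq0 nat1r natf_neq0'.
Qed.

End Commutator.

Lemma op_exp_commute (T : W -> W) s w : linear T ->
  (forall n w, T (x n.+1 w) = x n.+1 (T w)) -> T (op_exp A s w) = op_exp A s (T w).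
Proof.
move=> lT hT; rewrite (@op_exp_comm T 0 0) ?scale0r ?addr0 // => n w'.
by rewrite hT scale0r if_same addr0.
Qed.

(** This is z d/dz exp(A) = (z dA/dz) exp(A); it holds because the x_n commute. *)
Lemma exp_power_der k s w :
  s *: E k.+1 s w = k.+1%:R *: nsum (fun n => e n.+1 *: x n.+1 (E k (s - e n.+1) w)).
Proof.
elim: k s => [|k IH] s.
  rewrite scale1r exp_powerS nsumZ; last first.
    by apply: (fin1_linear_fam (h := fun n => x n.+1)) => //; exact: exp_power_fin.
  apply: eq_nsum => n; rewrite !exp_power0 subr_eq0.
  by case: eqP => [->//|_]; rewrite linear0' // !scaler0.
have fin k' s' : fin1 (fun n => x n.+1 (E k' (s' - e n.+1) w)).
  by apply: (fin1_linear_fam (h := fun n => x n.+1)) => //; exact: exp_power_fin.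
have finX : fin1 (fun n => e n.+1 *: x n.+1 (E k.+1 (s - e n.+1) w)) by exact: fin1Z.
pose G n m := (e m.+1) *: x n.+1 (x m.+1 (E k (s - e n.+1 - e m.+1) w)).
have finG : fin2 G.
  have [[p sp]|h] := pselect (exists p, s = e p); last first.
    exists 0%N => n m _; rewrite /G exp_power_support; first by rewrite !(linear0' (lx _)) scaler0.
    by move=> p _ /sub_exponent/sub_exponent es; apply: h; exists (p + m.+1 + n.+1)%N.
  exists p => n m hn; rewrite /G exp_power_support; first by rewrite !(linear0' (lx _)) scaler0.
  by move=> q _ /sub_exponent/sub_exponent; rewrite sp => /exponent_inj; lia.
have e1 n : (s - e n.+1) *: x n.+1 (E k.+1 (s - e n.+1) w) = k.+1%:R *: nsum (G n).
  rewrite -(linearZ' (lx _)) IH (linearZ' (lx _)) (linear_nsum (lx _)); last exact: fin1Z.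
  by congr (_ *: _); apply: eq_nsum => m; rewrite (linearZ' (lx _)).
rewrite exp_powerS nsumZ //.
transitivity (nsum (fun n => e n.+1 *: x n.+1 (E k.+1 (s - e n.+1) w) +
    k.+1%:R *: nsum (G n))).
  by apply: eq_nsum => n; rewrite -e1 -scalerDl [e n.+1 + _]addrC subrK.
have finG1 : fin1 (fun n => nsum (G n)) by exact: fin2_nsum.
rewrite nsumD //; last exact: fin1Z.
rewrite -nsumZ // nsum_exch // -[k.+2%:R]natr1 scalerDl scale1r addrC; congr (_ *: _ + _).
apply: eq_nsum => m; rewrite exp_powerS (linear_nsum (lx _)) // nsumZ; last first.
  by apply: (fin1_linear (lx _)).
by apply: eq_nsum => n; rewrite /G x_comm addrAC.
Qed.

Lemma op_exp_der s w :
  s *: op_exp A s w = nsum (fun n => e n.+1 *: x n.+1 (op_exp A (s - e n.+1) w)).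
Proof.
have fin s' : fin1 (fun k => k`!%:R^-1 *: E k s' w) by apply: fin1Z; exact: exp_series_fin.
rewrite op_expE nsumZ // (@nsum_shift _ 1); last first.
  move=> [|k] // _; rewrite exp_power0; case: eqP => [->|_]; first by rewrite scale0r.
  by rewrite !scaler0.
pose G n k := (k`!%:R^-1 * e n.+1) *: x n.+1 (E k (s - e n.+1) w).
have finG : fin2 G.
  have [[p sp]|h] := pselect (exists p, s = e p); last first.
    exists 0%N => n m _; rewrite /G exp_power_support; first by rewrite !(linear0' (lx _)) scaler0.
    by move=> p _ /sub_exponent es; apply: h; exists (p + n.+1)%N.
  exists (p + p)%N => n m hn; rewrite /G exp_power_support; first by rewrite !(linear0' (lx _)) scaler0.
  by move=> q hq /sub_exponent; rewrite sp => /exponent_inj; lia.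
transitivity (nsum (fun k => nsum (fun n => G n k))).
  apply: eq_nsum => k; rewrite add1n scalerA mulrC -scalerA exp_power_der scalerA.
  rewrite nsumZ; last first.
    apply: fin1Z; apply: (fin1_linear_fam (h := fun n => x n.+1)) => //.
    exact: exp_power_fin.
  apply: eq_nsum => n; rewrite scalerA /G; congr (_ *: _).
  by rewrite factS natrM; field; rewrite factf_neq0 nat1r natf_neq0'.
rewrite -nsum_exch //; apply: eq_nsum => n.
rewrite op_expE (linear_nsum (lx _)) // nsumZ; last by apply: (fin1_linear (lx _)).
by apply: eq_nsum => k; rewrite (linearZ' (lx _)) scalerA mulrC.
Qed.

End Exponential.

(** * Creation and annihilation series *)

Section Currents.
Variables (F : numFieldType) (l : nat) (W : lmodType F).
Local Notation key := (fkey F l).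
Local Notation vec := 'rV[F]_l.
Variables (bvec : key -> W) (coef : key -> W -> F) (supp : W -> seq key).
Variables (heis : 'I_l -> int -> W -> W).
Hypothesis H : fock_space bvec coef supp heis.
Implicit Types (b : key) (w : W) (al mu be : vec).

Let hl i n := heis_linear H i n.

Lemma heis_commP i j (m n : nat) w : heis i m (heis j n w) = heis j n (heis i m w).
Proof.
rewrite (heis_comm H); case: ifP => [/andP[_ /eqP e]|_]; rewrite ?addr0 //.
by rewrite (_ : m = 0%N) ?scale0r ?addr0 //; move: e; clear; lia.
Qed.

Definition modev al (n : int) w : W := \sum_(i < l) al 0 i *: heis i n w.

Lemma modev_linear al n : linear (modev al n).
Proof. by apply: linear_bigsum => i; exact: linear_scale'. Qed.

Lemma heis_modev i p al n w : heis i p (modev al n w) = modev al n (heis i p w) +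
  (if p + n == 0 then (p%:~R * al 0 i) *: w else 0).
Proof.
rewrite /modev (linear_sum' _ _ _ (hl i p)).
under eq_bigr => j _ do rewrite (linearZ' (hl i p)) (heis_comm H) scalerDr.
rewrite big_split; congr (_ + _); rewrite (bigD1 i) //= eqxx /= big1 ?addr0.
  by case: ifP => _; rewrite ?scaler0 // scalerA mulrC.
by move=> j /negbTE ij; rewrite eq_sym ij scaler0.
Qed.

Lemma modevC al m n w : m + n != 0 -> modev al m (modev al n w) = modev al n (modev al m w).
Proof.
move=> mn; rewrite {1}/modev /= [RHS](linear_sum' _ _ _ (modev_linear al n)).
apply: eq_bigr => i _; rewrite heis_modev (negbTE mn) addr0.
by rewrite (linearZ' (modev_linear al n)).
Qed.

(** The factors Y_+(al, c z) and, below, Y_-(al, z) of a vertex operator. *)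
Definition annihilator (c : F) al : opseries W :=
  op_exp (op_sum [set n : nat | (0 < n)%N] (fun n => - n%:R)
    (fun n w => - ((c ^- n / n%:R) *: modev al n%:Z w))).

Definition creator al : opseries W :=
  op_exp (op_sum [set n : nat | (0 < n)%N] (fun n => n%:R)
    (fun n w => (n%:R)^-1 *: modev al (- n%:Z) w)).

Section Creator.
Variable al : vec.
Let x n w := (n%:R : F)^-1 *: modev al (- n%:Z) w.
Let x_linear n : linear (x n).
Proof. by apply: linear_scale'; exact: modev_linear. Qed.
Let x_comm m n w : x m (x n w) = x n (x m w).
Proof.
rewrite /x !(linearZ' (modev_linear _ _)) !scalerA mulrC.
have [->|n0] := eqVneq n 0%N; first by rewrite !invr0 !(mulr0, mul0r) !scale0r.
by rewrite modevC //; lia.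
Qed.
Let sg_neq0 : (1 : F) != 0. Proof. exact: oner_neq0. Qed.
Let eE (n : nat) : n%:R = 1 * n%:R :> F. Proof. by rewrite mul1r. Qed.

Lemma creator_linear s : linear (creator al s).
Proof. exact: (op_exp_linear x_linear sg_neq0 eE). Qed.

Lemma creator_support s w : (forall p : nat, s <> p%:R) -> creator al s w = 0.
Proof. exact: (op_exp_support x_linear sg_neq0 eE). Qed.

Lemma creator0 w : creator al 0 w = w.
Proof. exact: (op_exp0 x_linear sg_neq0 eE). Qed.

Lemma creator_comm i n s w : heis i n.+1 (creator al s w) =
  creator al s (heis i n.+1 w) + al 0 i *: creator al (s - n.+1%:R) w.
Proof.
apply: (op_exp_comm x_linear sg_neq0 eE (n0 := n)) => // m w'.
rewrite /x (linearZ' (hl _ _)) heis_modev scalerDr; congr (_ + _).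
rewrite (_ : (_ == 0) = (m == n)); last by lia.
case: eqP => [->|_]; last by rewrite scaler0.
by rewrite scalerA mulrA mulVf ?mul1r // natf_neq0'.
Qed.

Lemma creator_commute i p s w : p <= 0 ->
  heis i p (creator al s w) = creator al s (heis i p w).
Proof.
move=> hp; apply: (op_exp_commute x_linear sg_neq0 eE) => // m w'.
rewrite /x (linearZ' (hl _ _)) heis_modev ifF ?addr0 //; lia.
Qed.

(** This is z d/dz Y_-(al, z) = (\sum_n al(-n) z^n) Y_-(al, z), a recursion that computes
    Y_-(al, z) on a vacuum vector. *)
Lemma creator_der s w : s *: creator al s w =
  nsum (fun n => modev al (Negz n) (creator al (s - n.+1%:R) w)).
Proof.
have -> := op_exp_der x_linear x_comm sg_neq0 eE s w.
by apply: eq_nsum => n; rewrite scalerA divff ?scale1r ?NegzE // natf_neq0'.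
Qed.

Lemma creator_closed (S : W -> Prop) : S 0 -> (forall u v, S u -> S v -> S (u + v)) ->
  (forall c u, S u -> S (c *: u)) -> (forall i n w, S w -> S (heis i (Negz n) w)) ->
  forall s w, S w -> S (creator al s w).
Proof.
move=> S0 SD SZ Sx; apply: (op_exp_closed sg_neq0 eE (S := S)) => // n w Sw.
by apply: (SZ); apply: (big_ind S) => [|u v|i _]; [exact: S0|exact: SD|exact/SZ/Sx].
Qed.

End Creator.

Section Annihilator.
Variables (c : F) (al : vec).
Let x n w := - ((c ^- n / n%:R : F) *: modev al n%:Z w).
Let x_linear n : linear (x n).
Proof.
rewrite (_ : x n = fun w => - (c ^- n / n%:R : F) *: modev al n%:Z w); last first.
  by apply/funext => w; rewrite scaleNr.
by apply: linear_scale'; exact: modev_linear.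
Qed.
Let sg_neq0 : (-1 : F) != 0. Proof. by rewrite oppr_eq0 oner_neq0. Qed.
Let eE (n : nat) : - n%:R = (-1) * n%:R :> F. Proof. by rewrite mulN1r. Qed.

Lemma annihilator_linear s : linear (annihilator c al s).
Proof. exact: (op_exp_linear x_linear sg_neq0 eE). Qed.

Lemma annihilator_support s w : (forall p : nat, s <> - p%:R) -> annihilator c al s w = 0.
Proof. exact: (op_exp_support x_linear sg_neq0 eE). Qed.

Lemma annihilator0 w : annihilator c al 0 w = w.
Proof. exact: (op_exp0 x_linear sg_neq0 eE). Qed.

Lemma annihilator_comm i n s w : heis i (Negz n) (annihilator c al s w) =
  annihilator c al s (heis i (Negz n) w) +
  (al 0 i * c ^- n.+1) *: annihilator c al (s + n.+1%:R) w.
Proof.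
rewrite -[in s + _](opprK n.+1%:R).
apply: (op_exp_comm x_linear sg_neq0 eE (n0 := n)) => // m w'.
rewrite /x (linearN' (hl _ _)) (linearZ' (hl _ _)) heis_modev scalerDr opprD.
congr (_ + _); rewrite (_ : (_ == 0) = (m == n)); last by lia.
case: eqP => [->|_]; last by rewrite scaler0 oppr0.
rewrite scalerA -scaleNr; congr (_ *: _); rewrite NegzE.
move: (c ^- n.+1) => k; rewrite mulrNz -[n.+1%:~R]/(n.+1%:R : F).
by field; rewrite nat1r natf_neq0'.
Qed.

Lemma annihilator_commute i (n : nat) s w :
  heis i n (annihilator c al s w) = annihilator c al s (heis i n w).
Proof.
apply: (op_exp_commute x_linear sg_neq0 eE) => // m w'.
rewrite /x (linearN' (hl _ _)) (linearZ' (hl _ _)) heis_modev ifF ?addr0 //; lia.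
Qed.

Lemma annihilator_closed (S : W -> Prop) : S 0 -> (forall u v, S u -> S v -> S (u + v)) ->
  (forall c u, S u -> S (c *: u)) -> (forall i n w, S w -> S (heis i n w)) ->
  forall s w, S w -> S (annihilator c al s w).
Proof.
move=> S0 SD SZ Sx; apply: (op_exp_closed sg_neq0 eE (S := S)) => // n w Sw.
rewrite /x -scaleNr.
by apply: (SZ); apply: (big_ind S) => [|u v|i _]; [exact: S0|exact: SD|exact/SZ/Sx].
Qed.

Lemma annihilator_weight d w : supported coef (fun b => (weight b.1 <= d)%N) w ->
  forall p : nat, supported coef (fun b => (weight b.1 + p <= d)%N) (annihilator c al (- p%:R) w).
Proof.
move=> hw p; rewrite /annihilator op_expE; apply: (supported_nsum H) => k.
apply: (supportedZ H); elim: k p => [|k IH] p.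
  rewrite exp_power0; case: eqP => [|_]; last exact: (supported0 H).
  by move=> /eqP; rewrite oppr_eq0 pnatr_eq0 => /eqP ->; apply: supportedS hw => b; lia.
rewrite (exp_powerS _ sg_neq0 eE); apply: (supported_nsum H) => n.
have [hn|hn] := leqP n.+1 p; last first.
  rewrite [X in supported _ _ X](_ : _ = x n.+1 0); last first.
    congr (x n.+1 _); apply: (exp_power_support x_linear sg_neq0 eE) => q _ /eqP.
    rewrite opprK addrC subr_eq addrC eq_sym subr_eq -natrD eqr_nat; lia.
  by rewrite (linear0' (x_linear _)); exact: (supported0 H).
rewrite /x -scaleNr; apply: (supportedZ H); apply: (supported_sum H) => i _.
apply: (supportedZ H).
have -> : - p%:R - - n.+1%:R = - (p - n.+1)%:R :> F by rewrite natrB //; ring.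
apply: (@supportedS _ _ _ coef (fun b => (weight b.1 + n.+1 <= d - (p - n.+1))%N)).
  by move=> b; lia.
by apply: (heis_weight H); apply: supportedS (IH (p - n.+1)%N) => b; lia.
Qed.

Lemma annihilator_finite w : exists d, forall p : nat, (d < p)%N ->
  annihilator c al (- p%:R) w = 0.
Proof.
have [d hd] := weight_bounded H w; exists d => p hp.
apply: (supported_empty H (P := fun b => (weight b.1 + p <= d)%N)).
  exact: annihilator_weight.
by move=> b; lia.
Qed.

End Annihilator.

(** For X = Y(u, z) this is Y(a^i(-(k+1)) u, z): the normally ordered product of X with
    the k-th divided derivative of a^i(z). *)
Definition normal_product (i : 'I_l) (k : nat) (X : opseries W) : opseries W :=
  fun s w =>
    nsum (fun r => cbinom r%:R k *: heis i (Negz r) (X (s - r%:R + k%:R) w)) +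
    nsum (fun r => cbinom (- r%:R - 1) k *: X (s + r%:R + 1 + k%:R) (heis i r w)).

Section NormalProduct.
Variable X : opseries W.
Hypotheses (X_linear : forall s, linear (X s)) (X_trunc : trunc_op X).

Lemma normal_product_fin_neg i k s w :
  fin1 (fun r => cbinom r%:R k *: heis i (Negz r) (X (s - r%:R + k%:R) w)).
Proof.
apply: fin1Z; apply: (fin1_linear_fam (h := fun r => heis i (Negz r))) => //.
by apply: fin1_eq (X_trunc w (s + k%:R)) => r; congr X; ring.
Qed.

Lemma normal_product_fin_pos i k s w :
  fin1 (fun r => cbinom (- r%:R - 1) k *: X (s + r%:R + 1 + k%:R) (heis i r w)).
Proof.
apply: fin1Z; apply: (fin1_linear_fam (h := fun r => X (s + r%:R + 1 + k%:R))) => //.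
exact: (heis_trunc H).
Qed.

Lemma normal_product_linear i k s : linear (normal_product i k X s).
Proof.
apply: (linear_add' (f := fun w => nsum _)).
  apply: linear_nsum_fam => [r|w]; last exact: normal_product_fin_neg.
  by apply: linear_scale'; exact: linear_comp'.
apply: linear_nsum_fam => [r|w]; last exact: normal_product_fin_pos.
by apply: linear_scale'; exact: linear_comp'.
Qed.

Lemma normal_product_trunc i k : trunc_op (normal_product i k X).
Proof.
move=> w s; apply: fin1D.
  have [N hN] := X_trunc w (s + k%:R); exists N => n hn.
  rewrite nsum_eq0 // => r.
  rewrite (_ : s - n%:R - r%:R + k%:R = s + k%:R - (n + r)%:R); last by rewrite natrD; ring.
  by rewrite hN ?(linear0' (hl _ _)) ?scaler0 //; lia.
pose G n r := cbinom (- r%:R - 1) k *: X (s - n%:R + r%:R + 1 + k%:R) (heis i r w).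
have : fin2 G; last exact: fin2_nsum.
have [N hN] := heis_trunc H i w.
apply: fin2_cols.
  by exists N => r hr n; rewrite /G hN // (linear0' (X_linear _)) scaler0.
move=> r; apply: fin1Z.
by apply: fin1_eq (X_trunc (heis i r w) (s + r%:R + 1 + k%:R)) => n; congr X; ring.
Qed.

End NormalProduct.

(** Creation modes stand on the left and annihilation modes on the right of X in any
    case, and the modes on the same side commute. *)
Lemma normal_productC i k j k' X : (forall s, linear (X s)) -> trunc_op X ->
  forall s w, normal_product i k (normal_product j k' X) s w =
              normal_product j k' (normal_product i k X) s w.
Proof.
move=> lX tX.
have XZ t := linearZ' (lX t).
have half i0 k0 j0 k1 s w :
    fin2 (fun r q => (cbinom r%:R k0 * cbinom q%:R k1) *:
      heis i0 (Negz r) (heis j0 (Negz q) (X (s - r%:R + k0%:R - q%:R + k1%:R) w))) /\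
    fin2 (fun r q => (cbinom r%:R k0 * cbinom (- q%:R - 1) k1) *:
      heis i0 (Negz r) (X (s - r%:R + k0%:R + q%:R + 1 + k1%:R) (heis j0 q w))) /\
    fin2 (fun r q => (cbinom (- r%:R - 1) k0 * cbinom q%:R k1) *:
      heis j0 (Negz q) (X (s + r%:R + 1 + k0%:R - q%:R + k1%:R) (heis i0 r w))) /\
    fin2 (fun r q => (cbinom (- r%:R - 1) k0 * cbinom (- q%:R - 1) k1) *:
      X (s + r%:R + 1 + k0%:R + q%:R + 1 + k1%:R) (heis j0 q (heis i0 r w))).
  have [Ni hNi] := heis_trunc H i0 w; have [Nj hNj] := heis_trunc H j0 w.
  split; [|split; [|split]].
  - have [N hN] := tX w (s + k0%:R + k1%:R); exists N => r q h.
    rewrite (_ : s - _ + _ - _ + _ = s + k0%:R + k1%:R - (r + q)%:R); last first.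
      by rewrite natrD; ring.
    by rewrite hN // !(linear0' (hl _ _)) scaler0.
  - apply: fin2_cols.
      by exists Nj => q hq r; rewrite hNj // (linear0' (lX _)) (linear0' (hl _ _)) scaler0.
    move=> q; apply: fin1Z; apply: (fin1_linear_fam (h := fun r => heis i0 (Negz r))) => //.
    by apply: fin1_eq (tX (heis j0 q w) (s + k0%:R + q%:R + 1 + k1%:R)) => n; congr X; ring.
  - apply: fin2_rows.
      by exists Ni => q hq r; rewrite hNi // (linear0' (lX _)) (linear0' (hl _ _)) scaler0.
    move=> q; apply: fin1Z; apply: (fin1_linear_fam (h := fun r => heis j0 (Negz r))) => //.
    by apply: fin1_eq (tX (heis i0 q w) (s + q%:R + 1 + k0%:R + k1%:R)) => n; congr X; ring.
  - apply: fin2_rows.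
      by exists Ni => r hr q; rewrite hNi // (linear0' (hl _ _)) (linear0' (lX _)) scaler0.
    move=> r; apply: fin1Z.
    apply: (fin1_linear_fam (h := fun q => X (s + r%:R + 1 + k0%:R + q%:R + 1 + k1%:R))) => //.
    exact: (heis_trunc H).
have expand i0 k0 j0 k1 s w : normal_product i0 k0 (normal_product j0 k1 X) s w =
  nsum (fun r => nsum (fun q => (cbinom r%:R k0 * cbinom q%:R k1) *:
      heis i0 (Negz r) (heis j0 (Negz q) (X (s - r%:R + k0%:R - q%:R + k1%:R) w)))) +
  nsum (fun r => nsum (fun q => (cbinom r%:R k0 * cbinom (- q%:R - 1) k1) *:
      heis i0 (Negz r) (X (s - r%:R + k0%:R + q%:R + 1 + k1%:R) (heis j0 q w)))) +
  (nsum (fun r => nsum (fun q => (cbinom (- r%:R - 1) k0 * cbinom q%:R k1) *: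
      heis j0 (Negz q) (X (s + r%:R + 1 + k0%:R - q%:R + k1%:R) (heis i0 r w)))) +
  nsum (fun r => nsum (fun q => (cbinom (- r%:R - 1) k0 * cbinom (- q%:R - 1) k1) *:
      X (s + r%:R + 1 + k0%:R + q%:R + 1 + k1%:R) (heis j0 q (heis i0 r w))))).
  have [f1 [f2 [f3 f4]]] := half i0 k0 j0 k1 s w.
  rewrite {1}/normal_product.
  have nn := normal_product_fin_neg tX; have np := normal_product_fin_pos lX.
  congr (_ + _); (rewrite -nsumD; [|exact: fin2_nsum|exact: fin2_nsum]);
    apply: eq_nsum => r; rewrite /normal_product.
    rewrite (linearD' (hl _ _)) (linear_nsum (hl _ _) (nn _ _ _ _)).
    rewrite (linear_nsum (hl _ _) (np _ _ _ _)) scalerDr.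
    rewrite (nsumZ _ (fin1_linear (hl _ _) (nn _ _ _ _))).
    rewrite (nsumZ _ (fin1_linear (hl _ _) (np _ _ _ _))).
    by congr (_ + _); apply: eq_nsum => q; rewrite (linearZ' (hl _ _)) scalerA.
  rewrite scalerDr (nsumZ _ (nn _ _ _ _)) (nsumZ _ (np _ _ _ _)).
  by congr (_ + _); apply: eq_nsum => q; rewrite scalerA.
move=> s w; have [f1 [f2 [f3 f4]]] := half i k j k' s w.
rewrite (expand i) (expand j) (nsum_exch f1) (nsum_exch f2) (nsum_exch f3) (nsum_exch f4).
rewrite [LHS]addrACA.
congr (_ + _ + (_ + _)); apply: eq_nsum => r; apply: eq_nsum => q; rewrite mulrC.
- rewrite (heis_comm H i) andbF addr0.
  by congr (_ *: heis _ _ (heis _ _ (X _ _))); ring.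
- by congr (_ *: heis _ _ (X _ _)); ring.
- by congr (_ *: heis _ _ (X _ _)); ring.
- by rewrite (heis_commP j i); congr (_ *: X _ _); ring.
Qed.

End Currents.

(** * Vertex operators of monomials *)

Section VertexOperators.
Variables (F : numFieldType) (l : nat) (W : lmodType F).
Local Notation key := (fkey F l).
Local Notation vec := 'rV[F]_l.
Variables (bvec : key -> W) (coef : key -> W -> F) (supp : W -> seq key).
Variables (heis : 'I_l -> int -> W -> W).
Variables (zpow : vec -> opseries W) (eop : vec -> W -> W) (eps : vec -> vec -> F).
Variables (Y : W -> opseries W).
Implicit Types (b : key) (w : W) (al mu be : vec).

(** The vertex operators of basis vectors, built as on the space of all M_be but from
    abstract operators. *)
Definition current_half (D : set int) (i : 'I_l) (k : nat) : opseries W :=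
  op_sum D (fun n => (- n - 1)%:~R - k%:R)
    (fun n w => cbinom ((- n - 1)%:~R : F) k *: heis i n w).

Fixpoint Yword (vs : seq ('I_l * nat)) : opseries W :=
  if vs is (i, k) :: vs' then
    op_add (op_mul (current_half [set n | n < 0] i k) (Yword vs'))
           (op_mul (Yword vs') (current_half [set n | 0 <= n] i k))
  else @op_one _ W.

Definition mon_word (m : {cmonom ('I_l * nat)%type}) : seq ('I_l * nat) :=
  flatten [seq nseq (m x) x | x <- (finsupp m : seq _)].

Definition Ybasis b : opseries W := fun s w => eop b.2
  (op_mul (creator heis b.2)
    (op_mul (Yword (mon_word b.1)) (op_mul (annihilator heis 1 b.2) (zpow b.2))) s w).

(** The operators that enter the vertex operators, characterized by their values on the
    basis. *)
Record lattice_fields : Prop := {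
  lf_fock : fock_space bvec coef supp heis;
  zpow_linear : forall al s, linear (zpow al s);
  zpow_bvec : forall al s b, zpow al s (bvec b) = if s == dot al b.2 then bvec b else 0;
  eop_linear : forall mu, linear (eop mu);
  eop_bvec : forall mu b, eop mu (bvec b) = eps mu b.2 *: bvec (b.1, mu + b.2);
  Y_linear_l : forall s w, linear (fun v => Y v s w);
  Y_bvec : forall b s w, Y (bvec b) s w = Ybasis b s w
}.

Hypothesis HL : lattice_fields.
Let H := lf_fock HL.
Let hl i n := heis_linear H i n.
Let zl al s := zpow_linear HL al s.

Lemma Yword_cons i k vs s w : (forall t, linear (Yword vs t)) ->
  Yword ((i, k) :: vs) s w = normal_product heis i k (Yword vs) s w.
Proof.
move=> lY; rewrite /= /op_add /normal_product; congr (_ + _).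
  rewrite op_mul_suml; last first.
    by move=> m n _ _ /addIr/eqP; rewrite eqr_int => /eqP /addIr/oppr_inj.
  rewrite fsum_neg; apply: eq_nsum => r.
  rewrite (_ : - Negz r - 1 = r); last by lia.
  by congr (_ *: heis _ _ (Yword _ _ _)); ring.
rewrite op_mul_sumr; [|by move=> t; exact: linear0'|]; last first.
  by move=> m n _ _ /addIr/eqP; rewrite eqr_int => /eqP /addIr/oppr_inj.
rewrite fsum_nneg; apply: eq_nsum => r; rewrite (linearZ' (lY _)).
have -> : (- (r : int) - 1)%:~R = - r%:R - 1 :> F by ring.
by congr (_ *: Yword _ _ _); ring.
Qed.

Lemma Yword_linear_trunc vs : (forall s, linear (Yword vs s)) /\ trunc_op (Yword vs).
Proof.
elim: vs => [|[i k] vs [lY tY]].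
  split; first by move=> s c u v; rewrite /= /op_one; case: ifP => _; rewrite ?scaler0 ?addr0.
  move=> w s; have [[p ->]|h] := pselect (exists p : nat, s = p%:R).
    exists p.+1 => n hn; rewrite /= /op_one ifF // subr_eq0 eqr_nat; lia.
  exists 0%N => n _; rewrite /= /op_one ifF //; apply/eqP => e; apply: h; exists n.
  by apply/eqP; rewrite -subr_eq0 e.
have e : Yword ((i, k) :: vs) = normal_product heis i k (Yword vs).
  by apply/funext => s; apply/funext => w; exact: Yword_cons.
rewrite e; split; first by move=> s; exact: (normal_product_linear H).
exact: (normal_product_trunc H).
Qed.

Definition momentum be : W -> Prop := supported coef (fun b => b.2 = be).

Lemma momentum_heis be i n w : momentum be w -> momentum be (heis i n w).
Proof.
apply: (supported_linear H); first exact: hl.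
move=> b hb; case: n => [[|n]|n].
- by rewrite (heis0 H); apply: (supportedZ H); exact: (supported_bvec H).
- by rewrite (heisP H); apply: (supportedZ H); exact: (supported_bvec H).
- by rewrite (heisN H); exact: (supported_bvec H).
Qed.

Lemma momentum0 be : momentum be 0. Proof. exact: (supported0 H). Qed.

Lemma momentumD be u v : momentum be u -> momentum be v -> momentum be (u + v).
Proof. exact: (supportedD H). Qed.

Lemma momentumZ be c u : momentum be u -> momentum be (c *: u).
Proof. exact: (supportedZ H). Qed.

Lemma momentum_bvec b : momentum b.2 (bvec b).
Proof. exact: (supported_bvec H). Qed.

Lemma momentum_creator be al s w : momentum be w -> momentum be (creator heis al s w).
Proof.
exact: (creator_closed al (momentum0 be) (@momentumD be) (@momentumZ be)
  (fun i n x => @momentum_heis be i (Negz n) x)).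
Qed.

Lemma momentum_annihilator be c al s w :
  momentum be w -> momentum be (annihilator heis c al s w).
Proof.
exact: (annihilator_closed c al (momentum0 be) (@momentumD be) (@momentumZ be)
  (fun i n x => @momentum_heis be i n x)).
Qed.

Lemma zpow_momentum be al s w : momentum be w ->
  zpow al s w = if s == dot al be then w else 0.
Proof.
move=> hw; pose g w := if s == dot al be then w else 0 : W.
apply: (linear_ext_on H (f := zpow al s) (g := g) _ _ _ hw).
- exact: zl.
- by rewrite /g => c u v; case: ifP; rewrite ?scaler0 ?addr0.
- by move=> b hb; rewrite (zpow_bvec HL) hb.
Qed.

(** The series Y_+(mu, z) z^(mu(0)). *)
Definition annih_zpow mu : opseries W := op_mul (annihilator heis 1 mu) (zpow mu).

Lemma annih_zpowE be mu s w : momentum be w ->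
  annih_zpow mu s w = annihilator heis 1 mu (s - dot mu be) w.
Proof.
move=> hw; rewrite /annih_zpow (op_mul_seq (T := [:: s - dot mu be])) //.
  by rewrite big_seq1 subKr (zpow_momentum _ _ hw) eqxx.
move=> t; rewrite inE => ht; rewrite (zpow_momentum _ _ hw) ifF.
  exact: linear0' (annihilator_linear H _ _ _).
by apply: contraNF ht => /eqP <-; rewrite subKr.
Qed.

Lemma linear_finite_op (B : opseries W) : (forall s, linear (B s)) ->
  (forall b, finite_set [set t | B t (bvec b) != 0]) -> finite_op B.
Proof.
move=> lB hb w.
apply: (fock_ind H (P := fun w => finite_set [set t | B t w != 0])) => //.
- apply: (sub_finite_set _ (@finite_set0 F)) => t /=.
  by rewrite (linear0' (lB _)) eqxx.
- move=> c u v hu hv.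
  apply: (@sub_finite_set _ _ ([set t | B t u != 0] `|` [set t | B t v != 0])).
    move=> t /= h; apply: contrapT => /not_orP[/negP/negPn/eqP h1 /negP/negPn/eqP h2].
    by move/eqP: h; apply; rewrite lB h1 h2 scaler0 addr0.
  by rewrite finite_setU.
Qed.

Lemma zpow_finite mu : finite_op (zpow mu).
Proof.
apply: linear_finite_op; first exact: zl.
move=> b; apply: (sub_finite_set _ (finite_set1 (dot mu b.2))) => t /=.
by rewrite (zpow_bvec HL); case: (t =P _) => [->|_] //; rewrite eqxx.
Qed.

Lemma annih_zpow_linear mu s : linear (annih_zpow mu s).
Proof.
apply: linear_op_mul_finite; [exact: (annihilator_linear H)|exact: zl|exact: zpow_finite].
Qed.

Lemma annih_zpow_finite mu : finite_op (annih_zpow mu).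
Proof.
apply: linear_finite_op; first exact: annih_zpow_linear.
move=> b; have [d hd] := annihilator_finite H 1 mu (bvec b).
apply: (@sub_finite_set _ _ ((fun p : nat => dot mu b.2 - p%:R) @` `I_d.+1)); last first.
  by apply: finite_image; exact: finite_II.
move=> t /=; rewrite (annih_zpowE _ _ (@momentum_bvec b)) => ht.
have [[p hp]|h] := pselect (exists p : nat, t - dot mu b.2 = - p%:R); last first.
  by move/eqP: ht; case; apply: (annihilator_support H) => p e; apply: h; exists p.
exists p; last by rewrite -hp addrC subrK.
by rewrite ltnNge; apply/negP => lt; move/eqP: ht; apply; rewrite hp hd.
Qed.

Lemma annih_zpow_commute mu s i (n : nat) w :
  heis i n (annih_zpow mu s w) = annih_zpow mu s (heis i n w).
Proof.
apply: (linear_ext H (f := fun w => heis i n (annih_zpow mu s w))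
  (g := fun w => annih_zpow mu s (heis i n w))); try (apply: linear_comp' => //;
  exact: annih_zpow_linear).
move=> b; have hb := @momentum_bvec b.
rewrite !(annih_zpowE _ _ (be := b.2)) //; last exact: momentum_heis.
exact: (annihilator_commute H).
Qed.

Lemma annih_zpow_comm mu s i n w : heis i (Negz n) (annih_zpow mu s w) =
  annih_zpow mu s (heis i (Negz n) w) + mu 0 i *: annih_zpow mu (s + n.+1%:R) w.
Proof.
have lA t := annih_zpow_linear mu t.
apply: (linear_ext H (f := fun w => heis i (Negz n) (annih_zpow mu s w))
  (g := fun w => annih_zpow mu s (heis i (Negz n) w) + mu 0 i *: annih_zpow mu (s + n.+1%:R) w)).
- exact: linear_comp'.
- apply: (linear_add' (f := fun w => annih_zpow mu s (heis i (Negz n) w))).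
    exact: linear_comp'.
  exact: linear_scale'.
move=> b; have hb := @momentum_bvec b.
rewrite !(annih_zpowE _ _ (be := b.2)) //; last exact: momentum_heis.
have -> : s + n.+1%:R - dot mu b.2 = s - dot mu b.2 + n.+1%:R by ring.
by rewrite (annihilator_comm H) expr1n invr1 mulr1.
Qed.

(** A factor on the right that commutes with the annihilation modes can be carried into
    the normally ordered product, as can a factor on the left that commutes with the
    creation modes. This is how a current passes through Y_+ and Y_-. *)
Lemma op_mul_normal_product i k (X Q : opseries W) s w :
  (forall t, linear (X t)) -> trunc_op X -> (forall t, linear (Q t)) -> finite_op Q ->
  (forall t (r : nat) v, heis i r (Q t v) = Q t (heis i r v)) ->
  op_mul (normal_product heis i k X) Q s w = normal_product heis i k (op_mul X Q) s w.
Proof.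
move=> lX tX lQ fQ cQ; have [T uT hT] := finite_op_shift s w fQ.
rewrite (op_mul_seq uT) => [|t /hT ->]; last exact: linear0' (normal_product_linear H lX tX _ _ _).
rewrite /normal_product big_split /= -(nsum_big _ (fun t => normal_product_fin_neg H tX i k t _)).
rewrite -(nsum_big _ (fun t => normal_product_fin_pos H lX i k t _)).
congr (_ + _); apply: eq_nsum => r.
  rewrite -scaler_sumr -(linear_sum' _ _ _ (hl _ _)); congr (_ *: heis _ _ _).
  rewrite -addrA -op_mul_shift.
  rewrite -[RHS](fsbig_widen [set` T]) //; first by rewrite -fsbig_seq //; apply: eq_bigr => t _; rewrite addrA.
  by move=> t /= [_ /negP ht]; rewrite hT // (linear0' (lX _)).
rewrite -scaler_sumr; congr (_ *: _).
rewrite -!addrA -op_mul_shift.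
rewrite -[RHS](fsbig_widen [set` T]) //.
  by rewrite -fsbig_seq //; apply: eq_bigr => t _; rewrite cQ !addrA.
by move=> t /= [_ /negP ht]; rewrite -cQ hT // (linear0' (hl _ _)) (linear0' (lX _)).
Qed.

Lemma op_mul_creating_normal_product i k (K X : opseries W) s w :
  (forall t, linear (K t)) -> (forall t x, (forall n : nat, t <> n%:R) -> K t x = 0) ->
  (forall t r v, heis i (Negz r) (K t v) = K t (heis i (Negz r) v)) ->
  (forall t, linear (X t)) -> trunc_op X ->
  op_mul K (normal_product heis i k X) s w = normal_product heis i k (op_mul K X) s w.
Proof.
move=> lK nK cK lX tX.
pose G1 q r := cbinom r%:R k *: heis i (Negz r) (K q%:R (X (s - q%:R - r%:R + k%:R) w)).
pose G2 q r := cbinom (- r%:R - 1) k *: K q%:R (X (s - q%:R + r%:R + 1 + k%:R) (heis i r w)).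
have finG1 : fin2 G1.
  have [N hN] := tX w (s + k%:R); exists N => q r h; rewrite /G1.
  rewrite (_ : s - _ - _ + _ = s + k%:R - (q + r)%:R); last by rewrite natrD; ring.
  by rewrite hN // (linear0' (lK _)) (linear0' (hl _ _)) scaler0.
have finG2 : fin2 G2.
  have [N hN] := heis_trunc H i w; apply: fin2_cols.
    by exists N => r hr q; rewrite /G2 hN // (linear0' (lX _)) (linear0' (lK _)) scaler0.
  move=> r; apply: fin1Z; apply: (fin1_linear_fam (h := fun q => K q%:R)) => //.
  by apply: fin1_eq (tX (heis i r w) (s + r%:R + 1 + k%:R)) => q; congr X; ring.
have nn := normal_product_fin_neg H tX; have np := normal_product_fin_pos H lX.
rewrite op_mul_nat //.
transitivity (nsum (fun q => nsum (G1 q)) + nsum (fun q => nsum (G2 q))).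
  rewrite -nsumD; [|exact: fin2_nsum|exact: fin2_nsum].
  apply: eq_nsum => q; rewrite /normal_product (linearD' (lK _)).
  rewrite (linear_nsum (lK _) (nn _ _ _ _)) (linear_nsum (lK _) (np _ _ _ _)).
  by congr (_ + _); apply: eq_nsum => r; rewrite (linearZ' (lK _)) -?cK.
rewrite (nsum_exch finG1) (nsum_exch finG2) /normal_product.
congr (_ + _); apply: eq_nsum => r.
  rewrite op_mul_nat // (linear_nsum (hl _ _) (fin1_op_mul_nat lK tX _ _)).
  rewrite nsumZ; last exact: (fin1_linear (hl i (Negz r)) (fin1_op_mul_nat lK tX _ _)).
  by apply: eq_nsum => q; rewrite /G1; congr (_ *: heis _ _ (K _ (X _ _))); ring.
rewrite op_mul_nat // nsumZ; last exact: (fin1_op_mul_nat lK tX).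
by apply: eq_nsum => q; rewrite /G2; congr (_ *: K _ (X _ _)); ring.
Qed.

(** The series Y_-(mu, z) Y(m, z) Y_+(mu, z) z^(mu(0)), for the monomial m spelled by vs. *)
Definition dressed mu vs : opseries W :=
  op_mul (creator heis mu) (op_mul (Yword vs) (annih_zpow mu)).

Let lbody mu vs t : linear (op_mul (Yword vs) (annih_zpow mu) t).
Proof.
apply: linear_op_mul_finite; [exact: (Yword_linear_trunc vs).1|exact: annih_zpow_linear
  |exact: annih_zpow_finite].
Qed.

Let tbody mu vs : trunc_op (op_mul (Yword vs) (annih_zpow mu)).
Proof.
have [lY tY] := Yword_linear_trunc vs.
by apply: trunc_op_mul_finite => //; exact: annih_zpow_finite.
Qed.

Lemma dressed_linear mu vs s : linear (dressed mu vs s).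
Proof.
exact: (linear_op_mul_nat (creator_linear H mu) (@lbody mu vs) (creator_support H mu)
  (@tbody mu vs)).
Qed.

Lemma dressed_trunc mu vs : trunc_op (dressed mu vs).
Proof.
exact: (trunc_op_mul_nat (creator_linear H mu) (creator_support H mu) (@tbody mu vs)).
Qed.

Lemma dressed_cons mu i k vs s w :
  dressed mu ((i, k) :: vs) s w = normal_product heis i k (dressed mu vs) s w.
Proof.
have [lY tY] := Yword_linear_trunc vs.
rewrite /dressed -op_mul_creating_normal_product //.
- apply: eq_fsbigr => t _; congr creator.
  rewrite -op_mul_normal_product //.
  + by apply: eq_fsbigr => t' _; exact: Yword_cons.
  + exact: annih_zpow_linear.
  + exact: annih_zpow_finite.
  + by move=> t' r v; exact: annih_zpow_commute.
- exact: (creator_linear H).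
- exact: (creator_support H).
- by move=> t r v; exact: (creator_commute H).
Qed.

End VertexOperators.

(** * The fields of a lattice *)

Section LatticeFields.
Variables (F : numFieldType) (l : nat) (W : lmodType F).
Local Notation key := (fkey F l).
Local Notation vec := 'rV[F]_l.
Variables (bvec : key -> W) (coef : key -> W -> F) (supp : W -> seq key).
Variables (heis : 'I_l -> int -> W -> W).
Variables (zpow : vec -> opseries W) (eop : vec -> W -> W) (eps : vec -> vec -> F).
Variables (Y : W -> opseries W).
Hypothesis HL : lattice_fields bvec coef supp heis zpow eop eps Y.
Implicit Types (b : key) (w : W) (al mu be : vec).
Let H := lf_fock HL.
Let hl i n := heis_linear H i n.
Let el mu := eop_linear HL mu.
Local Notation dressed := (dressed heis zpow).
Local Notation momentum := (momentum coef).
Let ld mu vs s : linear (dressed mu vs s) := dressed_linear HL mu vs s.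
Let td mu vs : trunc_op (dressed mu vs) := dressed_trunc HL mu vs.

Lemma dressed_consE mu i k vs :
  dressed mu ((i, k) :: vs) = normal_product heis i k (dressed mu vs).
Proof. by apply/funext => s; apply/funext => w; exact: (dressed_cons HL). Qed.

Lemma dressed_move mu x vs1 vs2 :
  dressed mu (vs1 ++ x :: vs2) = dressed mu (x :: vs1 ++ vs2).
Proof.
case: x => i k; elim: vs1 => [//|[j k'] vs1 IH].
rewrite [LHS]dressed_consE IH [RHS]dressed_consE !dressed_consE.
apply/funext => s; apply/funext => w.
exact: (normal_productC H _ _ _ _ (ld _ _) (td _ _)).
Qed.

(** Vertex operators depend on the monomial but not on the order in which its variables
    are listed, as normally ordered products can be permuted. *)
Lemma dressed_perm mu vs vs' : perm_eq vs vs' -> dressed mu vs = dressed mu vs'.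
Proof.
elim: vs vs' => [|x vs IH] vs' h.
  by move: h; rewrite perm_sym => /perm_nilP ->.
have : x \in vs' by rewrite -(perm_mem h) mem_head.
move=> xv; case/splitPr: xv h => v1 v2; rewrite perm_sym.
rewrite (perm_catCA v1 [:: x] v2) perm_sym perm_cons => h.
by rewrite dressed_move; case: x => i k; rewrite !dressed_consE (IH _ h).
Qed.

Lemma count_mon_word (m : {cmonom ('I_l * nat)%type}) x : count_mem x (mon_word m) = m x.
Proof.
rewrite /mon_word count_flatten -map_comp sumnE big_map /=.
under eq_bigr => y _ do rewrite count_nseq /=.
have [hx|hx] := boolP (x \in finsupp m).
  rewrite (bigD1_seq x) ?fset_uniq //= eqxx mul1n big1 ?addn0 // => y /negbTE hy.
  by rewrite hy mul0n.
rewrite big1_seq ?fsfun_dflt // => y /andP[_ hy].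
by case: eqP => [e|_]; rewrite ?mul0n //; move: hx; rewrite -e hy.
Qed.

Lemma mon_word_mul (m : {cmonom ('I_l * nat)%type}) x :
  perm_eq (mon_word (mulcm m (ucm x))) (x :: mon_word m).
Proof.
apply/allP => y _ /=; apply/eqP; rewrite !count_mon_word mulcmUE addnC; congr addn.
Qed.

Lemma mon_word1 : mon_word (onecm ('I_l * nat)%type) = [::].
Proof.
apply/nilP; rewrite /nilp -leqn0 leqNgt; apply/negP.
case e : (mon_word _) => [//|x vs] _.
by have := count_mon_word (onecm _) x; rewrite e onecmE /= eqxx.
Qed.

Lemma eop_heis i n mu w : n != 0 -> eop mu (heis i n w) = heis i n (eop mu w).
Proof.
move=> nz; apply: (linear_ext H (f := fun w => eop mu (heis i n w))
  (g := fun w => heis i n (eop mu w))); try exact: linear_comp'.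
move=> b; rewrite (eop_bvec HL) (linearZ' (hl _ _)).
case: n nz => [[|n]|n] //= _.
  rewrite !(heisP H) (linearZ' (el _)) (eop_bvec HL) /= !scalerA; congr (_ *: _).
  by rewrite mulrC.
by rewrite !(heisN H) (eop_bvec HL).
Qed.

Lemma heis0_eop i mu w :
  heis i (Posz 0) (eop mu w) = eop mu (heis i (Posz 0) w) + mu 0 i *: eop mu w.
Proof.
apply: (linear_ext H (f := fun w => heis i (Posz 0) (eop mu w))
  (g := fun w => eop mu (heis i (Posz 0) w) + mu 0 i *: eop mu w)).
- exact: linear_comp'.
- apply: (linear_add' (f := fun w => eop mu (heis i (Posz 0) w))); first exact: linear_comp'.
  exact: linear_scale'.
move=> b; rewrite (eop_bvec HL) (linearZ' (hl _ _)) !(heis0 H) (linearZ' (el _)) (eop_bvec HL).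
by rewrite /= mxE !scalerA -scalerDl; congr (_ *: _); ring.
Qed.

Lemma YbasisE b s w : Ybasis heis zpow eop b s w = eop b.2 (dressed b.2 (mon_word b.1) s w).
Proof. by []. Qed.

Lemma Ybasis_mul m mu i k s w : Y (bvec (mulcm m (ucm (i, k)), mu)) s w =
  normal_product heis i k (Y (bvec (m, mu))) s w.
Proof.
rewrite (Y_bvec HL) YbasisE /= (dressed_perm _ (mon_word_mul m (i, k))) (dressed_cons HL).
rewrite /normal_product (linearD' (el _)).
rewrite (linear_nsum (el _) (normal_product_fin_neg H (td _ _) _ _ _ _)).
rewrite (linear_nsum (el _) (normal_product_fin_pos H (ld _ _) _ _ _ _)).
congr (_ + _); apply: eq_nsum => r; rewrite (linearZ' (el _)) (Y_bvec HL) YbasisE //.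
by rewrite eop_heis.
Qed.

Lemma Y_linear_trunc u : (forall s, linear (Y u s)) /\ trunc_op (Y u).
Proof.
have lY s w := Y_linear_l HL s w.
apply: (fock_ind H (P := fun u => (forall s, linear (Y u s)) /\ trunc_op (Y u))).
- have e s : Y 0 s = fun _ => 0 by apply/funext => w; exact: linear0' (lY s w).
  split; first by move=> s; rewrite e; exact: linear_cst0.
  by move=> w s; exists 0%N => n _; rewrite e.
- move=> c u1 u2 [l1 t1] [l2 t2].
  have e s : Y (c *: u1 + u2) s = fun w => c *: Y u1 s w + Y u2 s w.
    by apply/funext => w; exact: lY.
  split; first by move=> s; rewrite e; apply: linear_add' => //; exact: linear_scale'.
  by move=> w s; apply: (fin1_eq (fun n => esym (congr1 (@^~ w) (e _)))); apply: fin1D => //; apply: fin1Z.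
- move=> b; have e s : Y (bvec b) s = fun w => eop b.2 (dressed b.2 (mon_word b.1) s w).
    by apply/funext => w; rewrite (Y_bvec HL).
  split; first by move=> s; rewrite e; exact: linear_comp'.
  move=> w s; apply: (fin1_eq (fun n => esym (congr1 (@^~ w) (e _)))).
  by apply: (fin1_linear (el _)); exact: td.
Qed.

Theorem lattice_normal_ordered : normal_ordered heis Y.
Proof.
have lY s w := Y_linear_l HL s w.
have lr u s := (Y_linear_trunc u).1 s.
have tr u := (Y_linear_trunc u).2.
have nn u := normal_product_fin_neg H (tr u).
have np u := normal_product_fin_pos H (lr u).
split=> //.
- exact: (heis_comm H).
- exact: (heis_trunc H).
- by move=> u s w; exact: tr.
- move=> i k u; apply: (fock_ind H (P := fun u => forall s w,
    Y (heis i (Negz k) u) s w = normal_product heis i k (Y u) s w)) u.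
  + move=> s w; rewrite (linear0' (hl _ _)) (linear0' (lY _ _)) /normal_product.
    by rewrite !nsum_eq0 ?addr0 // => r; rewrite (linear0' (lY _ _)) ?(linear0' (hl _ _)) scaler0.
  + move=> c u v hu hv s w; rewrite hl lY hu hv /normal_product.
    rewrite scalerDr addrACA; congr (_ + _); (rewrite nsumZ // -nsumD //; last exact: fin1Z);
      apply: eq_nsum => r; rewrite lY ?hl scalerDr !scalerA; congr (_ *: _ + _);
      exact: mulrC.
  + by move=> b s w; rewrite (heisN H) Ybasis_mul; case: b.
Qed.

(** The vector 1 (x) e^mu. *)
Definition vertex mu : W := bvec (onecm _, mu).

Lemma vertexE mu s w : Y (vertex mu) s w =
  eop mu (op_mul (creator heis mu) (annih_zpow heis zpow mu) s w).
Proof.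
rewrite (Y_bvec HL) YbasisE /= mon_word1 /dressed.
have -> : op_mul (Yword heis [::]) (annih_zpow heis zpow mu) = annih_zpow heis zpow mu.
  apply/funext => t; apply/funext => v; rewrite (op_mul_seq (T := [:: 0])) //.
    by rewrite big_seq1 subr0 /= /op_one eqxx.
  by move=> t'; rewrite inE /= /op_one => /negbTE ->.
by [].
Qed.

Lemma vertex_annihilated mu i k : heis i k.+1 (vertex mu) = 0.
Proof. by rewrite (heisP H) /= onecmE muln0 scale0r. Qed.

Lemma vertex_coherent mu : coherent heis (fun i => mu 0 i) (vertex mu).
Proof.
by move=> i [|j] /=; [rewrite (heis0 H) | exact: vertex_annihilated].
Qed.

(** The mode a(n) commutes with all factors of the vertex operator of e^mu but one: with
    Y_- for n > 0, with Y_+ for n < 0 and with the shift e^mu for n = 0. The commutator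
    with this factor is always mu z^n times it. *)
Lemma vertex_comm mu i n s w : heis i n (Y (vertex mu) s w) =
  Y (vertex mu) s (heis i n w) + mu 0 i *: Y (vertex mu) (s - n%:~R) w.
Proof.
rewrite !vertexE.
set K := creator heis mu; set Q := annih_zpow heis zpow mu.
have lK t : linear (K t) := creator_linear H mu t.
have lQ t : linear (Q t) := annih_zpow_linear HL mu t.
have fQ : finite_op Q := annih_zpow_finite HL mu.
have cQ t j (r : nat) v : heis j r (Q t v) = Q t (heis j r v).
  exact: (annih_zpow_commute HL).
have cQ' t j r v : heis j (Negz r) (Q t v) =
    Q t (heis j (Negz r) v) + mu 0 j *: Q (t + r.+1%:R) v := annih_zpow_comm HL mu t j r v.
have cK t j p v : p <= 0 -> heis j p (K t v) = K t (heis j p v).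
  exact: (creator_commute H).
have cK' t j r v : heis j r.+1 (K t v) = K t (heis j r.+1 v) + mu 0 j *: K (t - r.+1%:R) v.
  exact: (creator_comm H).
have seqE X s' v : uniq X -> (forall t, t \notin X -> Q (s' - t) v = 0) ->
    op_mul K Q s' v = \sum_(t <- X) K t (Q (s' - t) v).
  by move=> uX hX; apply: op_mul_seq => // t /hX ->; exact: linear0' (lK t).
case: n => [[|n]|n].
- rewrite heis0_eop subr0; congr (_ + _); congr eop.
  have [X uX hX] := finite_op_shift s w fQ; rewrite (seqE X) //.
  rewrite (seqE X) // => [|t /hX ht]; last by rewrite -cQ ht (linear0' (hl _ _)).
  rewrite (linear_sum' _ _ _ (hl _ _)); apply: eq_bigr => t _.
  by rewrite cK // cQ.
- rewrite -eop_heis // -(linearZ' (el _)) -(linearD' (el _)); congr eop.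
  have [X uX hX] := finite_op_shift s w fQ; rewrite (seqE X) //.
  rewrite (seqE X) // => [|t /hX ht]; last by rewrite -cQ ht (linear0' (hl _ _)).
  rewrite -op_mul_shift -(fsbig_widen [set` X]) //; last first.
    by move=> t /= [_ /negP /hX ->]; exact: linear0' (lK _).
  rewrite -fsbig_seq // (linear_sum' _ _ _ (hl _ _)) scaler_sumr -big_split.
  apply: eq_bigr => t _ /=; rewrite cK' cQ.
  by [].
- rewrite -eop_heis // -(linearZ' (el _)) -(linearD' (el _)); congr eop.
  have [X1 u1 h1] := finite_op_shift s w fQ.
  have [X2 u2 h2] := finite_op_shift s (heis i (Negz n) w) fQ.
  have [X3 u3 h3] := finite_op_shift (s - (Negz n)%:~R) w fQ.
  pose X := undup (X1 ++ X2 ++ X3); have uX : uniq X := undup_uniq _.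
  have nX t : t \notin X -> [&& t \notin X1, t \notin X2 & t \notin X3].
    by rewrite mem_undup !mem_cat !negb_or.
  rewrite (seqE X) // => [|t /nX/and3P[/h1]//].
  rewrite (seqE X) // => [|t /nX/and3P[_ /h2]//].
  rewrite (seqE X) // => [|t /nX/and3P[_ _ /h3]//].
  rewrite (linear_sum' _ _ _ (hl _ _)) scaler_sumr -big_split.
  apply: eq_bigr => t _ /=; rewrite cK // cQ'.
  rewrite (linearD' (lK _)) (linearZ' (lK _)); congr (_ + _ *: K t (Q _ w)).
  by rewrite NegzE; ring.
Qed.

(** For highest weight vectors the formula is vertex_comm; commutator_formula_step
    extends it to all monomials. *)
Theorem lattice_commutator_formula v : commutator_formula heis Y v.
Proof.
have lY s w := Y_linear_l HL s w.
apply: (fock_ind H (P := commutator_formula heis Y)).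
- move=> i n s w; rewrite !(linear0' (lY _ _)) (linear0' (hl _ _)) add0r nsum_eq0 // => j.
  by rewrite (linear0' (hl _ _)) (linear0' (lY _ _)) scaler0.
- move=> c u1 u2 h1 h2 i n s w; rewrite !lY hl h1 h2.
  have fin u := fin1_comm lattice_normal_ordered i n u s w.
  rewrite scalerDr addrACA; congr (_ + _).
  rewrite nsumZ // -nsumD //; last exact: fin1Z.
  apply: eq_nsum => j; rewrite hl lY scalerDr !scalerA; congr (_ *: _ + _).
  exact: mulrC.
case=> m mu; elim/mon_ind: m => [|m [i k] IH].
  move=> i n s w; rewrite -/(vertex mu) vertex_comm; congr (_ + _).
  rewrite (@nsum1 _ 0%N) => [|[|j] // _].
    by rewrite cbinom0 scale1r (heis0 H) (linearZ' (lY _ _)) addr0.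
  by rewrite vertex_annihilated (linear0' (lY _ _)) scaler0.
have -> : bvec (mulcm m (ucm (i, k)), mu) = heis i (Negz k) (bvec (m, mu)).
  by rewrite (heisN H).
exact: commutator_formula_step lattice_normal_ordered _ _ _ IH.
Qed.

Lemma Y_momentum b s be w : momentum be w ->
  momentum (b.2 + be) (Y (bvec b) s w) /\
  ((forall k : int, s <> dot b.2 be + k%:~R) -> Y (bvec b) s w = 0).
Proof.
case: b => m mu /=; elim/mon_ind: m s w => [|m [i k] IH] s w hw.
  rewrite -/(vertex mu) vertexE op_mul_nat; last exact: (creator_support H).
  split.
    apply: (supported_linear H (P := fun b => b.2 = be)) => [|b hb|]; first exact: el.
      rewrite (eop_bvec HL); apply: (supportedZ H); apply: (supported_bvec H).
      by rewrite /= hb.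
    apply: (supported_nsum H) => n; apply: (momentum_creator HL).
    by rewrite (annih_zpowE HL _ _ hw); exact: (momentum_annihilator HL).
  move=> hs; rewrite nsum_eq0 ?(linear0' (el _)) // => q.
  rewrite (annih_zpowE HL _ _ hw) (annihilator_support H) ?(linear0' (creator_linear H _ _)) //.
  move=> p e; apply: (hs (q%:Z - p%:Z)).
  have -> : s = dot mu be + (s - q%:R - dot mu be) + q%:R by ring.
  by rewrite e; ring.
rewrite Ybasis_mul; split.
  apply: (supportedD H); apply: (supported_nsum H) => r; apply: (supportedZ H).
    by apply: (momentum_heis HL); exact: (IH _ _ hw).1.
  by apply: (IH _ _ _).1; exact: (momentum_heis HL).
move=> hs; rewrite /normal_product !nsum_eq0 ?addr0 // => r.
  rewrite (IH _ _ _).2 ?scaler0 //; first exact: (momentum_heis HL).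
  move=> p e; apply: (hs (p - r%:Z - 1 - k%:Z)).
  have -> : s = (s + r%:R + 1 + k%:R) - r%:R - 1 - k%:R by ring.
  by rewrite e; ring.
rewrite (IH _ _ hw).2 ?(linear0' (hl _ _)) ?scaler0 //.
move=> p e; apply: (hs (p + r%:Z - k%:Z)).
have -> : s = (s - r%:R + k%:R) + r%:R - k%:R by ring.
by rewrite e; ring.
Qed.

End LatticeFields.

(** * The identity of delta functions, and uniqueness of coherent families *)

Section ScalarIdentities.
Variable F : numFieldType.
Implicit Types (x : F).

Lemma sbinomS x q : q.+1%:R * sbinom x q.+1 = (q%:R - x) * sbinom x q.
Proof. by rewrite /sbinom exprS mulN1r mulrCA mulNr cbinomS; ring. Qed.

Lemma sbinom_sum x q : q%:R * sbinom x q = - x * \sum_(j < q) sbinom x j.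
Proof.
elim: q => [|q IH]; first by rewrite big_ord0 mulr0 mul0r.
by rewrite big_ord_recr /= mulrDr -IH sbinomS; ring.
Qed.

(** With f q s as the coefficient of t^q z^s, the recursion is the differential equation
    t dG/dt = - x (\sum_(n > 0) (t / z)^n) G, which E z^A (1 - t / z)^x solves. *)
Lemma sbinom_recursion (f : nat -> F -> F) x A E :
  (forall s, f 0%N s = if s == A then E else 0) ->
  (forall q s, q.+1%:R * f q.+1 s = - x * \sum_(n < q.+1) f (q - n)%N (s + n.+1%:R)) ->
  forall q s, f q s = if s == A - q%:R then sbinom x q * E else 0.
Proof.
move=> f0 fS q; have [d] := ubnP q; elim: d q => // d IH [|q] hq s.
  by rewrite f0 subr0 sbinom0 mul1r.
apply: (mulfI (natf_neq0' F q)); rewrite fS.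
have e (n : 'I_q.+1) : f (q - n)%N (s + n.+1%:R) =
    (if s == A - q.+1%:R then E else 0) * sbinom x (q - n)%N.
  have hn : (n <= q)%N by rewrite -ltnS.
  rewrite IH; last by move: hq; clear; lia.
  rewrite (_ : (s + n.+1%:R == A - (q - n)%:R) = (s == A - q.+1%:R)).
    by case: ifP; rewrite ?mul0r // mulrC.
  rewrite -[RHS](inj_eq (addIr n.+1%:R)); congr (_ == _).
  by rewrite natrB // -!natr1; ring.
rewrite (eq_bigr _ (fun n _ => e n)) -mulr_sumr.
have -> : \sum_(n < q.+1) sbinom x (q - n)%N = \sum_(n < q.+1) sbinom x n.
  rewrite (reindex_inj rev_ord_inj); apply: eq_bigr => n _ /=.
  by have hn : (n <= q)%N; [rewrite -ltnS | rewrite subSS subKn].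
case: ifP => _; last by rewrite !(mul0r, mulr0).
by rewrite mulrCA -sbinom_sum; ring.
Qed.

Lemma sbinom_nat n q : sbinom (n%:R : F) q = (-1) ^+ q * 'C(n, q)%:R.
Proof. by rewrite /sbinom cbinom_nat. Qed.

Definition pos_sbinom (x : F) (q : int) : F := if q is Posz q then sbinom x q else 0.

(** The coefficient form of
    z_0^-1 delta((z_1 - z_2) / z_0) - z_0^-1 delta((z_2 - z_1) / (- z_0)) =
    z_2^-1 delta((z_1 - z_0) / z_2). For n >= 0 it says that the two expansions of
    (z_1 - z_2)^n agree; for n < 0 at most one of the two terms on the left is nonzero. *)
Lemma delta_identity (n p q : int) : p + q = n ->
  pos_sbinom n%:~R q - (-1) ^ n * pos_sbinom n%:~R p =
  if - n - 1 is Posz k then cbinom (- p%:~R - 1) k else 0.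
Proof.
move=> e.
have binC (k r : nat) : 'C(k + r, r) = 'C(k + r, k).
  by rewrite -(bin_sub (leq_addl k r)) addnK.
have neg (k r : nat) : sbinom ((Negz k)%:~R : F) r = 'C(k + r, r)%:R.
  rewrite sbinomE -cbinom_nat; congr cbinom; rewrite NegzE natrD; ring.
case: n e => n e.
  have -> : - Posz n - 1 = Negz n by lia.
  case: p e => p; case: q => q e /=.
  - rewrite -[n%:~R]/(n%:R) !sbinom_nat -[(-1) ^ n]/((-1) ^+ n).
    have -> : n = (p + q)%N by lia.
    rewrite binC exprD mulrA [_ * (-1) ^+ p]mulrAC -expr2 sqrr_sign mul1r subrr //.
  - by rewrite -[n%:~R]/(n%:R) sbinom_nat bin_small ?mulr0 ?subr0 //; lia.
  - by rewrite -[n%:~R]/(n%:R) sbinom_nat bin_small ?mulr0 ?subr0 //; lia.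
  - lia.
have -> : - Negz n - 1 = Posz n by lia.
case: p e => p; case: q => q e /=; first lia.
- rewrite neg sub0r.
  have -> : cbinom (- p%:~R - 1) n = (-1) ^+ n * 'C(n + p, p)%:R :> F.
    rewrite -[LHS](signrMK n) cbinomN (_ : _ - _ - 1 = (n + p)%:R); last by rewrite natrD; ring.
    by rewrite cbinom_nat binC.
  rewrite -mulNr; congr (_ * _).
  by rewrite NegzE -exprnN invr_sign exprS; ring.
- rewrite neg mulr0 subr0.
  have -> : - (Negz p)%:~R - 1 = p%:R :> F by rewrite NegzE; ring.
  rewrite cbinom_nat; have -> : p = (n + q)%N by lia.
  by rewrite binC.
- rewrite mulr0 subr0.
  have -> : - (Negz p)%:~R - 1 = p%:R :> F by rewrite NegzE; ring.
  rewrite cbinom_small //; lia.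
Qed.

End ScalarIdentities.

Section Uniqueness.
Variables (F : numFieldType) (l : nat) (W : lmodType F).
Local Notation key := (fkey F l).
Variables (bvec : key -> W) (coef : key -> W -> F) (supp : W -> seq key).
Variables (heis : 'I_l -> int -> W -> W).
Hypothesis H : fock_space bvec coef supp heis.
Let hl i n := heis_linear H i n.

Lemma coef_heisN g i k w : coef (onecm _, g) (heis i (Negz k) w) = 0.
Proof.
have lc := linear_coef H (onecm _, g).
apply: (linear_ext H (X := F^o) (f := fun w => coef (onecm _, g) (heis i (Negz k) w))
  (g := fun=> 0)).
- by move=> c u v; rewrite hl (coef_linear H).
- exact: linear_cst0.
move=> b; rewrite (heisN H) (coef_bvec H); case: eqP => // -[e _].
have : mulcm b.1 (ucm (i, k)) (i, k) = onecm _ (i, k) by rewrite e.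
by rewrite mulcmUE onecmE eqxx addn1.
Qed.

Lemma coef_heisP m g i k w : coef (m, g) (heis i k.+1 w) =
  (k.+1 * (m (i, k)).+1)%:R * coef (mulcm m (ucm (i, k)), g) w.
Proof.
apply: (linear_ext H (X := F^o) (f := fun w => coef (m, g) (heis i k.+1 w))
  (g := fun w => (k.+1 * (m (i, k)).+1)%:R * coef (mulcm m (ucm (i, k)), g) w)).
- by move=> c u v; rewrite hl (coef_linear H).
- by move=> c u v; rewrite (coef_linear H) mulrDr mulrCA.
case=> m' g'; rewrite (heisP H) (vcoefZ H) !(coef_bvec H) /=.
have [z|nz] := eqVneq (m' (i, k)) 0%N.
  rewrite z muln0 mul0r; case: eqP => [[e _]|_]; last by rewrite mulr0.
  by move: z; rewrite e mulcmUE eqxx addn1.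
rewrite !xpair_eqE; have -> : (divcm m' (ucm (i, k)) == m) = (m' == mulcm m (ucm (i, k))).
  by apply/eqP/eqP => [<-|->]; rewrite ?divcmUK ?mulcmUK.
case: (m' =P _) => [->|_]; last by rewrite !mulr0.
by rewrite mulcmUE eqxx addn1.
Qed.

(** A positive mode annihilates e^be, and so it maps D_t(e^be) to a combination of other
    members of the family at e^be. This expresses the coefficient of a monomial in
    D_t(e^be) by coefficients of smaller monomials, and finally by constant terms, which
    vanish. The negative modes carry the vanishing from e^be to its whole Fock space.
    The zero modes are left out, so that the lemma also applies to maps that change the
    momentum. *)
Lemma coherent_family_eq0 (S : Type) (D : S -> W -> W) be :
  (forall t, linear (D t)) ->
  (forall i n t, n != 0 -> exists r : seq (F * S), forall w,
     heis i n (D t w) = D t (heis i n w) + \sum_(x <- r) x.1 *: D x.2 w) ->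
  (forall t g, coef (onecm _, g) (D t (bvec (onecm _, be))) = 0) ->
  forall t w, supported coef (fun b => b.2 = be) w -> D t w = 0.
Proof.
move=> lD hD h0.
have h1 t : D t (bvec (onecm _, be)) = 0.
  apply: (coef_eq0 H) => -[m g]; elim/mon_ind: m t => [|m [i k] IH] t; first exact: h0.
  have [r hr] := hD i k.+1 t isT.
  have := coef_heisP m g i k (D t (bvec (onecm _, be))).
  rewrite hr (heisP H) /= onecmE muln0 scale0r (linear0' (lD t)) add0r.
  have -> : coef (m, g) (\sum_(x <- r) x.1 *: D x.2 (bvec (onecm _, be))) = 0.
    elim: r {hr} => [|x r IHr]; first by rewrite big_nil (vcoef0 H).
    by rewrite big_cons (coef_linear H) IH mulr0 add0r.
  by move/esym/eqP; rewrite mulf_eq0 pnatr_eq0 muln_eq0 /= => /eqP.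
have h2 t m : D t (bvec (m, be)) = 0.
  elim/mon_ind: m t => [|m [i k] IH] t; first exact: h1.
  have [r hr] := hD i (Negz k) t isT.
  have := hr (bvec (m, be)); rewrite IH (linear0' (hl _ _)) (heisN H) /= => /esym/eqP.
  rewrite big1 ?addr0 => [/eqP//|x _].
  by rewrite IH scaler0.
move=> t w hw; apply: (linear_ext_on H (f := D t) (g := fun=> 0) _ _ _ hw) => //.
  exact: linear_cst0.
by case=> m g /= ->.
Qed.

End Uniqueness.

(** * Constant terms of products of exponentials *)

Section VertexConstants.
Variables (F : numFieldType) (l : nat) (W : lmodType F).
Local Notation key := (fkey F l).
Local Notation vec := 'rV[F]_l.
Variables (bvec : key -> W) (coef : key -> W -> F) (supp : W -> seq key).
Variables (heis : 'I_l -> int -> W -> W).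
Variables (zpow : vec -> opseries W) (eop : vec -> W -> W) (eps : vec -> vec -> F).
Variables (Y : W -> opseries W).
Hypothesis HL : lattice_fields bvec coef supp heis zpow eop eps Y.
Implicit Types (b : key) (w : W) (al mu nu be g : vec).
Let H := lf_fock HL.
Let hl i n := heis_linear H i n.
Let el mu := eop_linear HL mu.
Let NO := lattice_normal_ordered HL.
Let lr u s := no_linear_r NO u s.
Let lY s w := no_linear_l NO s w.
Local Notation momentum := (momentum coef).
Local Notation vertex := (vertex bvec).
Local Notation phi g := (coef (onecm _, g)).

Lemma dotDl mu nu be : dot (mu + nu) be = dot mu be + dot nu be.
Proof. by rewrite /dot -big_split; apply: eq_bigr => i _; rewrite mxE mulrDl. Qed.

Lemma dotDr mu nu be : dot mu (nu + be) = dot mu nu + dot mu be.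
Proof. by rewrite /dot -big_split; apply: eq_bigr => i _; rewrite mxE mulrDr. Qed.

Lemma dotC mu nu : dot mu nu = dot nu mu.
Proof. by apply: eq_bigr => i _; exact: mulrC. Qed.

Lemma momentum_vertex be : momentum be (vertex be).
Proof. exact: (supported_bvec H). Qed.

Lemma annihilator_vertex al be s :
  annihilator heis 1 al s (vertex be) = if s == 0 then vertex be else 0.
Proof.
have [->|s0] := eqVneq s 0; first exact: (annihilator0 H).
have [[p sp]|h] := pselect (exists p : nat, s = - p%:R); last first.
  by apply: (annihilator_support H) => p e; apply: h; exists p.
rewrite sp; apply: (supported_empty H (P := fun b => (weight b.1 + p <= 0)%N)).
  apply: (annihilator_weight H); apply: (supported_bvec H).
  by rewrite /= weight1.
move=> b; case: p sp => [|p] sp; last by rewrite addnS.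
by move: s0; rewrite sp oppr0 eqxx.
Qed.

(** The annihilation part of the vertex operator fixes e^be. *)
Lemma vertex_vertex mu be s :
  Y (vertex mu) s (vertex be) = eop mu (creator heis mu (s - dot mu be) (vertex be)).
Proof.
rewrite (vertexE HL) op_mul_nat; last exact: (creator_support H).
have lc t := creator_linear H mu t.
congr (eop _ _); have e q : annih_zpow heis zpow mu (s - q%:R) (vertex be) =
    if s - q%:R - dot mu be == 0 then vertex be else 0.
  by rewrite (annih_zpowE HL _ _ (@momentum_vertex be)) annihilator_vertex.
have [[p hp]|h] := pselect (exists p : nat, s - dot mu be = p%:R).
  rewrite (@nsum1 _ p) => [|q hq]; rewrite e addrAC hp.
    by rewrite subrr eqxx.
  by rewrite subr_eq0 eqr_nat eq_sym (negbTE hq) (linear0' (lc _)).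
rewrite (creator_support H) => [|p hp]; last by apply: h; exists p.
rewrite nsum_eq0 // => q; rewrite e ifF ?(linear0' (lc _)) //.
by apply/eqP => hq; apply: h; exists q; apply/eqP; rewrite -subr_eq0 addrAC hq.
Qed.

Lemma vertex_vertex0 mu be :
  Y (vertex mu) (dot mu be) (vertex be) = eps mu be *: vertex (mu + be).
Proof. by rewrite vertex_vertex subrr (creator0 H) (eop_bvec HL). Qed.

Lemma vertex_vertex_out mu be t : (forall q : nat, t <> q%:R) ->
  Y (vertex mu) (dot mu be + t) (vertex be) = 0.
Proof.
move=> h; rewrite vertex_vertex addrAC subrr add0r (creator_support H) //.
exact: linear0' (el _).
Qed.

Lemma vertex_vertex_neg mu be (q : nat) :
  Y (vertex mu) (dot mu be + (Negz q)%:~R) (vertex be) = 0.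
Proof.
apply: vertex_vertex_out => p /eqP.
by rewrite -[p%:R]/(p%:~R) eqr_int.
Qed.

Lemma eop_modev mu al k w :
  eop mu (modev heis al (Negz k) w) = modev heis al (Negz k) (eop mu w).
Proof.
rewrite /modev (linear_sum' _ _ _ (el _)); apply: eq_bigr => i _.
by rewrite (linearZ' (el _)) (eop_heis HL).
Qed.

Lemma vertex_vertex_der mu be s : (s - dot mu be) *: Y (vertex mu) s (vertex be) =
  nsum (fun n => modev heis mu (Negz n) (Y (vertex mu) (s - n.+1%:R) (vertex be))).
Proof.
rewrite vertex_vertex -(linearZ' (el _)) (creator_der H) (linear_nsum (el _)).
  apply: eq_nsum => n; rewrite eop_modev; congr modev.
  by rewrite vertex_vertex addrAC.
apply: (fin1_linear_fam (h := fun n => modev heis mu (Negz n))).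
  by move=> n; exact: (modev_linear H).
have [[p ->]|h] := pselect (exists p : nat, s - dot mu be = p%:R).
  exists p.+1 => n hn; apply: (creator_support H) => q /eqP.
  rewrite subr_eq -natrD eqr_nat; move: hn; clear; lia.
exists 0%N => n _; apply: (creator_support H) => q e; apply: h; exists (q + n.+1)%N.
by apply/eqP; rewrite natrD -subr_eq e.
Qed.

Lemma vertex_vertex_rec mu be (q : nat) :
  q.+1%:R *: Y (vertex mu) (dot mu be + q.+1%:R) (vertex be) =
  \sum_(n < q.+1) modev heis mu (Negz n) (Y (vertex mu) (dot mu be + (q - n)%:R) (vertex be)).
Proof.
have {1}-> : q.+1%:R = dot mu be + q.+1%:R - dot mu be by rewrite addrAC subrr add0r.
rewrite vertex_vertex_der (nsumE (N := q.+1)) => [|n hn].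
  apply: eq_bigr => n _; congr (modev _ _ _ (Y _ _ _)).
  have hn : (n <= q)%N by rewrite -ltnS.
  by rewrite natrB // -!natr1; ring.
rewrite -addrA vertex_vertex_out ?(linear0' (modev_linear H _ _)) // => p /eqP.
rewrite subr_eq -natrD eqr_nat; move: hn; clear; lia.
Qed.

Lemma vcoef_nsum0 b (f : nat -> W) : (forall n, coef b (f n) = 0) -> coef b (nsum f) = 0.
Proof.
move=> h; apply: (big_ind (fun x => coef b x = 0)) => //; first exact: (vcoef0 H).
by move=> x y hx hy; rewrite (vcoefD H) hx hy addr0.
Qed.

(** Here and below, constant terms are the coefficients of the vectors 1 (x) e^g. *)
Lemma constant_modev g al k w : phi g (modev heis al (Negz k) w) = 0.
Proof.
apply: (big_ind (fun x => phi g x = 0)); first exact: (vcoef0 H).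
  by move=> x y hx hy; rewrite (vcoefD H) hx hy addr0.
by move=> i _; rewrite (vcoefZ H) (coef_heisN H) mulr0.
Qed.

Lemma constant_vertex_vertex g mu be s : phi g (Y (vertex mu) s (vertex be)) =
  if s == dot mu be then eps mu be * (mu + be == g)%:R else 0.
Proof.
have [->|ns] := eqVneq s (dot mu be).
  rewrite vertex_vertex0 (vcoefZ H) (coef_bvec H) xpair_eqE.
  by rewrite (eqxx (onecm _ : {cmonom _})).
have : phi g ((s - dot mu be) *: Y (vertex mu) s (vertex be)) = 0.
  by rewrite vertex_vertex_der vcoef_nsum0 // => n; exact: constant_modev.
by move=> /eqP; rewrite (vcoefZ H) mulf_eq0 subr_eq0 (negbTE ns) => /eqP.
Qed.

Lemma constant_vertex_modev g mu al s k w :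
  phi g (Y (vertex mu) s (modev heis al (Negz k) w)) =
  - dot mu al * phi g (Y (vertex mu) (s + k.+1%:R) w).
Proof.
rewrite /modev (linear_sum' _ _ _ (lr _ _)) (vcoef_sum H) /dot -sumrN mulr_suml.
apply: eq_bigr => i _; rewrite (linearZ' (lr _ _)) (vcoefZ H).
have := congr1 (phi g) (vertex_comm HL mu i (Negz k) s w).
rewrite (coef_heisN H) (vcoefD H) (vcoefZ H) NegzE => /esym/eqP.
rewrite addr_eq0 => /eqP ->; rewrite (_ : s - _ = s + k.+1%:R); last by ring.
by ring.
Qed.

Lemma constant_modev_vertex g al be u s k :
  phi g (Y (modev heis al (Negz k) u) s (vertex be)) =
  (-1) ^+ k * dot al be * phi g (Y u (s + k.+1%:R) (vertex be)).
Proof.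
rewrite /modev (linear_sum' _ _ _ (lY _ _)) (vcoef_sum H) /dot mulr_sumr mulr_suml.
apply: eq_bigr => i _; rewrite (linearZ' (lY _ _)) (vcoefZ H) (no_normal NO) (vcoefD H).
rewrite vcoef_nsum0 ?add0r => [|r]; last by rewrite (vcoefZ H) (coef_heisN H) mulr0.
rewrite (@nsum1 _ 0%N) => [|[|r] // _]; last first.
  by rewrite (vertex_annihilated HL) (linear0' (lr _ _)) scaler0.
rewrite cbinom_m1.
rewrite (heis0 H) (linearZ' (lr _ _)) !(vcoefZ H) /=.
by rewrite (_ : s + 0%:R + 1 + k%:R = s + k.+1%:R); [ring | rewrite -natr1; ring].
Qed.

(** The recursion for Y_-(nu, z_2) e^be, combined with the commutators of its modes with
    Y(e^mu, z_1), is the differential equation in z_2 of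
    z_1^(mu.(nu + be)) z_2^(nu.be) (1 - z_2 / z_1)^(mu.nu). *)
Lemma constant_product g mu nu be (q : nat) s :
  phi g (Y (vertex mu) s (Y (vertex nu) (dot nu be + q%:R) (vertex be))) =
  if s == dot mu (nu + be) - q%:R then
    sbinom (dot mu nu) q * (eps nu be * (eps mu (nu + be) * (mu + (nu + be) == g)%:R))
  else 0.
Proof.
pose f q s := phi g (Y (vertex mu) s (Y (vertex nu) (dot nu be + q%:R) (vertex be))).
apply: (@sbinom_recursion F f) => {q s} [s|q s]; rewrite /f.
  rewrite addr0 vertex_vertex0 (linearZ' (lr _ _)) (vcoefZ H) constant_vertex_vertex.
  by case: ifP; rewrite ?mulr0.
rewrite -(vcoefZ H) -(linearZ' (lr _ _)) vertex_vertex_rec (linear_sum' _ _ _ (lr _ _)).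
by rewrite (vcoef_sum H) mulr_sumr; apply: eq_bigr => n _; rewrite constant_vertex_modev.
Qed.

(** The same argument in the variable z_0, for
    z_0^(mu.nu) z_2^((mu + nu).be) (1 + z_0 / z_2)^(mu.be). The commutators are replaced by
    the iterate formula, of which only the zero mode acts on e^be. *)
Lemma constant_iterate g mu nu be (q : nat) s :
  phi g (Y (Y (vertex mu) (dot mu nu + q%:R) (vertex nu)) s (vertex be)) =
  if s == dot (mu + nu) be - q%:R then
    cbinom (dot mu be) q * (eps mu nu * (eps (mu + nu) be * (mu + nu + be == g)%:R))
  else 0.
Proof.
pose f q s := (-1) ^+ q *
  phi g (Y (Y (vertex mu) (dot mu nu + q%:R) (vertex nu)) s (vertex be)).
have e' : forall q s, f q s = if s == dot (mu + nu) be - q%:R then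
    sbinom (dot mu be) q * (eps mu nu * (eps (mu + nu) be * (mu + nu + be == g)%:R))
  else 0.
  apply: (@sbinom_recursion F f) => {q s} [s|q s].
    rewrite /f addr0 vertex_vertex0 (linearZ' (lY _ _)) (vcoefZ H) constant_vertex_vertex mul1r.
    by case: ifP; rewrite ?mulr0.
  rewrite /f mulrCA -(vcoefZ H) -(linearZ' (lY _ _)) vertex_vertex_rec.
  rewrite (linear_sum' _ _ _ (lY _ _)) (vcoef_sum H) !mulr_sumr; apply: eq_bigr => n _.
  rewrite constant_modev_vertex !mulrA; congr (_ * _).
  have hn : (n <= q)%N by rewrite -ltnS.
  rewrite -[in (-1) ^+ q.+1](subnK hn) -addSn exprD exprS.
  transitivity (- dot mu be * (-1) ^+ (q - n) * ((-1) ^+ n) ^+ 2); first by ring.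
  by rewrite sqrr_sign mulr1.
rewrite -[LHS](signrMK q) -/(f q s) e'; case: ifP => _; last by rewrite mulr0.
by rewrite /sbinom -!mulrA signrMK.
Qed.

End VertexConstants.

(** * The Jacobi identity on Fock spaces *)

Section KernelCombination.
Variables (F : numFieldType) (W : lmodType F) (I : eqType).
Variables (a : I -> int -> W -> W).
Hypothesis Al : forall i n, linear (a i n).

Definition kernelD (X : kernel W) (c : F) (X' : kernel W) : kernel W :=
  fun u v w n s1 s2 => X u v w n s1 s2 + c *: X' u v w n s1 s2.

Lemma nsum_lin2 (f g h : nat -> W) (c : F) : fin1 f -> fin1 g ->
  (forall r, h r = f r + c *: g r) -> fin1 h /\ nsum h = nsum f + c *: nsum g.
Proof.
move=> ff fg e; split.
  by apply: (fin1_eq (fun r => esym (e r))); apply: fin1D => //; exact: fin1Z.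
by rewrite nsumZ // -nsumD //; [exact: eq_nsum|exact: fin1Z].
Qed.

Lemma left_stepD X c X' : left_step a X -> left_step a X' -> left_step a (kernelD X c X').
Proof.
move=> hX hX' i k u v w n s1 s2.
have [f1 f2 f3 e] := hX i k u v w n s1 s2.
have [f1' f2' f3' e'] := hX' i k u v w n s1 s2.
have scale2 b x y : b *: (x + c *: y) = b *: x + c *: (b *: y) :> W.
  by rewrite scalerDr !scalerA mulrC.
have [h1 e1] := nsum_lin2 (h := fun r => cbinom r%:R k *: a i (Negz r)
   (kernelD X c X' u v w n (s1 - r%:R + k%:R) s2)) f1 f1'
   (fun r => etrans (congr1 _ (etrans (linearD' (Al _ _) _ _)
     (congr1 _ (linearZ' (Al _ _) _ _)))) (scale2 _ _ _)).
have [h2 e2] := nsum_lin2 f2 f2' (fun r => scale2 _ _ _).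
have [h3 e3] := nsum_lin2 f3 f3' (fun r => scale2 _ _ _).
split=> //; rewrite e1 e2 e3 /kernelD e e' !scalerDr.
by rewrite (addrACA (nsum _ + nsum _)) [in LHS](addrACA (nsum _)).
Qed.

Lemma right_stepD mu u X c X' : right_step a mu u X -> right_step a mu u X' ->
  right_step a mu u (kernelD X c X').
Proof.
move=> hX hX' i k v w n s1 s2.
have [f1 f2 e] := hX i k v w n s1 s2.
have [f1' f2' e'] := hX' i k v w n s1 s2.
have scale2 b x y : b *: (x + c *: y) = b *: x + c *: (b *: y) :> W.
  by rewrite scalerDr !scalerA mulrC.
have [h1 e1] := nsum_lin2 (h := fun r => cbinom r%:R k *: a i (Negz r)
   (kernelD X c X' u v w n s1 (s2 - r%:R + k%:R))) f1 f1'
   (fun r => etrans (congr1 _ (etrans (linearD' (Al _ _) _ _)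
     (congr1 _ (linearZ' (Al _ _) _ _)))) (scale2 _ _ _)).
have [h2 e2] := nsum_lin2 f2 f2' (fun r => scale2 _ _ _).
split=> //; rewrite e1 e2 /kernelD e e' scale2 opprD !scalerDr scalerN.
by rewrite (addrACA (nsum _ + nsum _)) [in LHS](addrACA (nsum _)).
Qed.

Lemma coherent_stepD mu nu u v X c X' : coherent_step a mu nu u v X ->
  coherent_step a mu nu u v X' -> coherent_step a mu nu u v (kernelD X c X').
Proof.
move=> hX hX' i p w n s1 s2; rewrite /kernelD (linearD' (Al _ _)) (linearZ' (Al _ _)) hX hX'.
rewrite !scalerDr !scalerA ![_ * c]mulrC -!scalerA.
by rewrite addrACA; congr (_ + _); rewrite addrACA.
Qed.

End KernelCombination.

Section JacobiIdentity.
Variables (F : numFieldType) (l : nat) (W : lmodType F).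
Local Notation key := (fkey F l).
Local Notation vec := 'rV[F]_l.
Variables (bvec : key -> W) (coef : key -> W -> F) (supp : W -> seq key).
Variables (heis : 'I_l -> int -> W -> W).
Variables (zpow : vec -> opseries W) (eop : vec -> W -> W) (eps : vec -> vec -> F).
Variables (Y : W -> opseries W).
Hypothesis HL : lattice_fields bvec coef supp heis zpow eop eps Y.
Hypothesis eps_cocycle : forall a b c, eps a b * eps (a + b) c = eps b c * eps a (b + c).
Implicit Types (b : key) (w : W) (al mu nu be g : vec).
Let H := lf_fock HL.
Let hl i n := heis_linear H i n.
Let NO := lattice_normal_ordered HL.
Let HC := lattice_commutator_formula HL.
Let lr u s := no_linear_r NO u s.
Let lY s w := no_linear_l NO s w.
Local Notation momentum := (momentum coef).
Local Notation vertex := (vertex bvec).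
Local Notation phi g := (coef (onecm _, g)).

Lemma vcoef_nsum b (f : nat -> W) : fin1 f -> coef b (nsum f) = nsum (fun n => coef b (f n)).
Proof. by move=> ff; exact: (linear_nsum (linear_coef H b) ff). Qed.

(** Multiplication by (z_1 - z_2)^n only adds n to the exponent mu.nu = N of
    1 - z_2 / z_1. *)
Lemma constant_binomial_product g mu nu be (N n p q : int) : dot mu nu = N%:~R ->
  phi g (nsum (fun m => sbinom n%:~R m *:
    Y (vertex mu) (dot mu be + p%:~R - n%:~R + m%:R)
      (Y (vertex nu) (dot nu be + q%:~R - m%:R) (vertex be)))) =
  if p + q == n + N then pos_sbinom (n + N)%:~R q *
    (eps nu be * (eps mu (nu + be) * (mu + (nu + be) == g)%:R)) else 0.
Proof.
move=> hN; rewrite (vcoef_nsum _ (fin1_jacobi12 NO _ _ _ _ _ _)).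
case: q => q; last first.
  rewrite /= mul0r if_same nsum_eq0 // => m.
  rewrite (_ : dot nu be + _ - m%:R = dot nu be + (Negz (q + m))%:~R).
    by rewrite (vertex_vertex_neg HL) (linear0' (lr _ _)) scaler0 (vcoef0 H).
  rewrite -addrA -[m%:R]/(m%:~R) -intrB; congr (_ + _%:~R); lia.
rewrite (nsumE (N := q.+1)) => [|m hm]; last first.
  rewrite (_ : dot nu be + _ - m%:R = dot nu be + (Negz (m - q.+1))%:~R).
    by rewrite (vertex_vertex_neg HL) (linear0' (lr _ _)) scaler0 (vcoef0 H).
  rewrite -addrA; congr (_ + _).
  rewrite -[m%:R]/(m%:~R) -intrB; congr (_%:~R); lia.
have e (m : 'I_q.+1) : phi g (sbinom n%:~R m *:
    Y (vertex mu) (dot mu be + p%:~R - n%:~R + m%:R)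
      (Y (vertex nu) (dot nu be + q%:~R - m%:R) (vertex be))) =
    sbinom n%:~R m * sbinom N%:~R (q - m)%N * (if p + q == n + N then
    eps nu be * (eps mu (nu + be) * (mu + (nu + be) == g)%:R) else 0).
  have hm : (m <= q)%N by rewrite -ltnS.
  rewrite (vcoefZ H) (_ : dot nu be + _ - m%:R = dot nu be + (q - m)%N%:R); last first.
    by rewrite natrB // addrA.
  rewrite (constant_product HL) hN dotDr hN -mulrA.
  congr (_ * _); rewrite (_ : (_ == _) = (p + q%:Z == n + N)); last first.
    rewrite -[RHS](eqr_int F) -(inj_eq (addIr (n%:~R - m%:R - dot mu be))).
    rewrite -[RHS](inj_eq (addIr (- q%:R))).
    congr (_ == _); rewrite ?natrB // ?intrD; ring.
  by case: ifP; rewrite ?mulr0.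
rewrite (eq_bigr _ (fun m _ => e m)) -mulr_suml vandermonde_signed -intrD.
by case: ifP; rewrite ?mulr0.
Qed.

Lemma constant_jacobi20 g mu nu be (N n p q : int) : dot mu nu = N%:~R ->
  phi g (jacobi20 Y (vertex mu) (vertex nu) (vertex be) n
    (dot mu be + p%:~R) (dot nu be + q%:~R)) =
  if p + q == n + N then
    (if - (n + N) - 1 is Posz k then cbinom (- p%:~R - 1) k else 0) *
    (eps mu nu * (eps (mu + nu) be * (mu + nu + be == g)%:R)) else 0.
Proof.
move=> hN; rewrite (vcoef_nsum _ (fin1_jacobi20 NO _ _ _ _ _ _)).
case eK: (- (n + N) - 1) => [K|K]; last first.
  rewrite mul0r if_same nsum_eq0 // => m.
  rewrite (_ : - n%:~R - 1 - m%:R = dot mu nu + (Negz (K + m))%:~R).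
    by rewrite (vertex_vertex_neg HL) (linear0' (lY _ _)) scaler0 (vcoef0 H).
  rewrite hN -[m%:R]/(m%:~R) -[1]/(1%:~R) -!mulrNz -!intrD; congr (_%:~R); lia.
rewrite (nsumE (N := K.+1)) => [|m hm]; last first.
  rewrite (_ : - n%:~R - 1 - m%:R = dot mu nu + (Negz (m - K.+1))%:~R).
    by rewrite (vertex_vertex_neg HL) (linear0' (lY _ _)) scaler0 (vcoef0 H).
  rewrite hN -[m%:R]/(m%:~R) -[1]/(1%:~R) -!mulrNz -!intrD; congr (_%:~R); lia.
have e (m : 'I_K.+1) : phi g (cbinom (- (dot mu be + p%:~R) - 1) m *:
    Y (Y (vertex mu) (- n%:~R - 1 - m%:R) (vertex nu))
      (dot mu be + p%:~R + (dot nu be + q%:~R) + 1 + m%:R) (vertex be)) =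
    cbinom (- (dot mu be + p%:~R) - 1) m * cbinom (dot mu be) (K - m)%N *
    (if p + q == n + N then
    eps mu nu * (eps (mu + nu) be * (mu + nu + be == g)%:R) else 0).
  have hm : (m <= K)%N by rewrite -ltnS.
  rewrite (vcoefZ H) (_ : - n%:~R - 1 - m%:R = dot mu nu + (K - m)%N%:R); last first.
    rewrite hN -[(K - m)%N%:R]/((K - m)%N%:~R) -[m%:R]/(m%:~R) -[1]/(1%:~R) -!mulrNz -!intrD; congr (_%:~R); lia.
  rewrite (constant_iterate HL) dotDl -mulrA.
  congr (_ * _); rewrite (_ : (_ == _) = (p + q == n + N)); last first.
    have -> : (p + q == n + N) = (p + q + 1 == - K%:Z) by lia.
    rewrite -[RHS](eqr_int F) -[RHS](inj_eq (addIr (dot mu be + dot nu be + m%:R))).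
    congr (_ == _); rewrite ?natrB // ?intrD ?mulrNz; ring.
  by case: ifP; rewrite ?mulr0.
rewrite (eq_bigr _ (fun m _ => e m)) -mulr_suml vandermonde.
rewrite (_ : _ - 1 + dot mu be = - p%:~R - 1); last by ring.
by case: ifP; rewrite ?mulr0.
Qed.

Definition jacobi_defect (ka : F) : kernel W :=
  kernelD (kernelD (jacobi12 Y) (- ka) (jacobi21 Y)) (-1) (jacobi20 Y).

Lemma jacobi_defect_linear_w ka u v n s1 s2 :
  linear (fun w => jacobi_defect ka u v w n s1 s2).
Proof.
apply: (linear_add' (f := fun w => kernelD _ _ _ u v w n s1 s2)).
  apply: (linear_add' (f := fun w => jacobi12 Y u v w n s1 s2)).
    apply: linear_nsum_fam => [m|w]; last exact: (fin1_jacobi12 NO).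
    by apply: linear_scale'; exact: linear_comp'.
  apply: linear_scale'; apply: linear_nsum_fam => [m|w]; last exact: (fin1_jacobi21 NO).
  by apply: linear_scale'; exact: linear_comp'.
apply: linear_scale'; apply: linear_nsum_fam => [m|w]; last exact: (fin1_jacobi20 NO).
exact: linear_scale'.
Qed.

Lemma jacobi_defect_linear_v ka u w n s1 s2 :
  linear (fun v => jacobi_defect ka u v w n s1 s2).
Proof.
apply: (linear_add' (f := fun v => kernelD _ _ _ u v w n s1 s2)).
  apply: (linear_add' (f := fun v => jacobi12 Y u v w n s1 s2)).
    apply: linear_nsum_fam => [m|v]; last exact: (fin1_jacobi12 NO).
    apply: linear_scale'; exact: (linear_comp' (lr _ _) (lY _ _)).
  apply: linear_scale'; apply: linear_nsum_fam => [m|v]; last exact: (fin1_jacobi21 NO).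
  by apply: linear_scale'.
apply: linear_scale'; apply: linear_nsum_fam => [m|v]; last exact: (fin1_jacobi20 NO).
apply: linear_scale'; exact: (linear_comp' (lY _ _) (lr _ _)).
Qed.

Lemma jacobi_defect_linear_u ka v w n s1 s2 :
  linear (fun u => jacobi_defect ka u v w n s1 s2).
Proof.
apply: (linear_add' (f := fun u => kernelD _ _ _ u v w n s1 s2)).
  apply: (linear_add' (f := fun u => jacobi12 Y u v w n s1 s2)).
    apply: linear_nsum_fam => [m|u]; last exact: (fin1_jacobi12 NO).
    by apply: linear_scale'.
  apply: linear_scale'; apply: linear_nsum_fam => [m|u]; last exact: (fin1_jacobi21 NO).
  apply: linear_scale'; exact: (linear_comp' (lr _ _) (lY _ _)).
apply: linear_scale'; apply: linear_nsum_fam => [m|u]; last exact: (fin1_jacobi20 NO).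
apply: linear_scale'; exact: (linear_comp' (lY _ _) (lY _ _)).
Qed.

Section Sector.
Variables (mu nu be : vec) (N : int) (ka : F).
Hypothesis hN : dot mu nu = N%:~R.
Hypothesis hka : ka * eps nu mu = (-1) ^ N * eps mu nu.

(** The constants that come with the basis vectors agree in all three terms: by the
    cocycle identity for the first and the third, by the choice of ka for the second.
    What remains is the identity of delta functions, with n + N in place of n. *)
Lemma constant_jacobi_defect g n (p q : int) :
  phi g (jacobi_defect ka (vertex mu) (vertex nu) (vertex be) n
    (dot mu be + p%:~R) (dot nu be + q%:~R)) = 0.
Proof.
rewrite /jacobi_defect /kernelD !(vcoefD H) !(vcoefZ H).
rewrite (constant_binomial_product _ _ _ _ _ hN) (constant_jacobi20 _ _ _ _ _ hN).
rewrite (jacobi21E NO) /flip (vcoefZ H) (constant_binomial_product _ _ _ _ _ (etrans (dotC nu mu) hN)).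
rewrite [q + p]addrC; case: eqP => e; last by rewrite !(mulr0, addr0).
have <- := delta_identity F e.
have e1 : eps nu be * (eps mu (nu + be) * (mu + (nu + be) == g)%:R) =
    eps mu nu * (eps (mu + nu) be * (mu + nu + be == g)%:R).
  by rewrite !mulrA eps_cocycle addrA.
have e2 : ka * ((-1) ^ n * (pos_sbinom (n + N)%:~R p *
      (eps mu be * (eps nu (mu + be) * (nu + (mu + be) == g)%:R)))) =
    (-1) ^ (n + N) * pos_sbinom (n + N)%:~R p *
      (eps mu nu * (eps (mu + nu) be * (mu + nu + be == g)%:R)).
  have -> : nu + (mu + be) = mu + nu + be by rewrite addrCA addrA.
  have h : ka * (eps mu be * eps nu (mu + be)) = (-1) ^ N * (eps mu nu * eps (mu + nu) be).
    by rewrite -eps_cocycle [nu + mu]addrC !mulrA hka.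
  rewrite exprzDr ?unitrN1 //.
  transitivity ((-1) ^ n * pos_sbinom (n + N)%:~R p * (mu + nu + be == g)%:R *
    (ka * (eps mu be * eps nu (mu + be)))); first by ring.
  by rewrite h; ring.
by rewrite mulNr e2 e1; ring.
Qed.

(** Both exponents vary over a coset of Z, in which the family of defects is closed under
    commutators with the modes. *)
Lemma jacobi_vertex n (p q : int) w : momentum be w ->
  jacobi_defect ka (vertex mu) (vertex nu) w n (dot mu be + p%:~R) (dot nu be + q%:~R) = 0.
Proof.
move: w; pose D (t : int * int) w := jacobi_defect ka (vertex mu) (vertex nu) w n
  (dot mu be + t.1%:~R) (dot nu be + t.2%:~R).
apply: (coherent_family_eq0 H (D := D) _ _ _ (p, q)).
- by move=> t; exact: jacobi_defect_linear_w.
- move=> i m [x y] _; exists [:: (mu 0 i, (x - m, y)); (nu 0 i, (x, y - m))] => w.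
  rewrite big_cons big_seq1 /D /=.
  have [cm cn] := (vertex_coherent HL mu, vertex_coherent HL nu).
  have st : coherent_step heis (fun i => mu 0 i) (fun i => nu 0 i) (vertex mu) (vertex nu)
      (jacobi_defect ka).
    apply: (coherent_stepD hl); last exact: (coherent_step20 NO HC).
    by apply: (coherent_stepD hl); [exact: (coherent_step12 NO HC)|exact: (coherent_step21 NO HC)].
  by rewrite st !intrB !addrA.
- by move=> [x y] g; exact: constant_jacobi_defect.
Qed.

Let sR : right_step heis (fun i => mu 0 i) (vertex mu) (jacobi_defect ka).
Proof.
have cm := vertex_coherent HL mu.
apply: (right_stepD hl); last exact: (right_step20 NO HC).
by apply: (right_stepD hl); [exact: (right_step12 NO HC)|exact: (right_step21 NO HC)].
Qed.

Let sL : left_step heis (jacobi_defect ka).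
Proof.
apply: (left_stepD hl); last exact: (left_step20 NO).
by apply: (left_stepD hl); [exact: (left_step12 NO)|exact: (left_step21 NO)].
Qed.

Lemma jacobi_right v : momentum nu v -> forall w, momentum be w -> forall n (p q : int),
  jacobi_defect ka (vertex mu) v w n (dot mu be + p%:~R) (dot nu be + q%:~R) = 0.
Proof.
move=> hv w hw n p q; apply: (linear_ext_on H
  (f := fun v => jacobi_defect ka (vertex mu) v w n (dot mu be + p%:~R) (dot nu be + q%:~R))
  (g := fun=> 0) _ _ _ hv).
- exact: jacobi_defect_linear_v.
- exact: linear_cst0.
case=> m nu' /= ->; elim/mon_ind: m w hw n p q => [|m [i k] IH] w hw n p q.
  exact: jacobi_vertex.
have -> : bvec (mulcm m (ucm (i, k)), nu) = heis i (Negz k) (bvec (m, nu)).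
  by rewrite (heisN H).
have [_ _ ->] := sR i k (bvec (m, nu)) w n (dot mu be + p%:~R) (dot nu be + q%:~R).
rewrite IH // scaler0 subr0 !nsum_eq0 ?addr0 // => r.
  rewrite (_ : _ + k%:R = dot nu be + (q + r%:Z + 1 + k%:Z)%:~R); last by rewrite !intrD; ring.
  by rewrite IH ?scaler0 //; exact: (momentum_heis HL).
rewrite (_ : _ + k%:R = dot nu be + (q - r%:Z + k%:Z)%:~R); last by rewrite !intrD; ring.
by rewrite IH ?(linear0' (hl _ _)) ?scaler0.
Qed.

Lemma jacobi_left u : momentum mu u -> forall v w, momentum nu v -> momentum be w ->
  forall n (p q : int),
  jacobi_defect ka u v w n (dot mu be + p%:~R) (dot nu be + q%:~R) = 0.
Proof.
move=> hu v w hv hw n p q; apply: (linear_ext_on H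
  (f := fun u => jacobi_defect ka u v w n (dot mu be + p%:~R) (dot nu be + q%:~R))
  (g := fun=> 0) _ _ _ hu).
- exact: jacobi_defect_linear_u.
- exact: linear_cst0.
case=> m mu' /= ->; elim/mon_ind: m v hv w hw n p q => [|m [i k] IH] v hv w hw n p q.
  exact: jacobi_right.
have -> : bvec (mulcm m (ucm (i, k)), mu) = heis i (Negz k) (bvec (m, mu)).
  by rewrite (heisN H).
have [_ _ _ ->] := sL i k (bvec (m, mu)) v w n (dot mu be + p%:~R) (dot nu be + q%:~R).
rewrite !nsum_eq0 ?addr0 // => r.
- by rewrite IH ?scaler0 //; exact: (momentum_heis HL).
- rewrite (_ : _ + k%:R = dot mu be + (p + r%:Z + 1 + k%:Z)%:~R); last by rewrite !intrD; ring.
  by rewrite IH ?scaler0 //; exact: (momentum_heis HL).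
rewrite (_ : _ + k%:R = dot mu be + (p - r%:Z + k%:Z)%:~R); last by rewrite !intrD; ring.
by rewrite IH ?(linear0' (hl _ _)) ?scaler0.
Qed.

End Sector.

Lemma momentum_Y mu be u w s : momentum mu u -> momentum be w ->
  momentum (mu + be) (Y u s w).
Proof.
move=> hu hw; apply: (supported_linear H (f := fun u => Y u s w) _ _ hu) => [//|b hb].
rewrite -hb; exact: (Y_momentum HL b s hw).1.
Qed.

Lemma Y_exponent mu be u w s : momentum mu u -> momentum be w ->
  (forall k : int, s <> dot mu be + k%:~R) -> Y u s w = 0.
Proof.
move=> hu hw hs; apply: (linear_ext_on H (f := fun u => Y u s w) (g := fun=> 0) _ _ _ hu) => //.
  exact: linear_cst0.
by move=> b hb; rewrite (Y_momentum HL b s hw).2 // hb.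
Qed.

(** The exponents of Y(u, z) on M_be lie in mu.be + Z, and (z_1 - z_2)^n changes
    exponents by integers only. *)
Lemma jacobi12_out mu nu be (N n : int) u v w s1 s2 : dot mu nu = N%:~R ->
  momentum mu u -> momentum nu v -> momentum be w ->
  ((forall p : int, s1 <> dot mu be + p%:~R) \/ forall q : int, s2 <> dot nu be + q%:~R) ->
  jacobi12 Y u v w n s1 s2 = 0.
Proof.
move=> hN hu hv hw [h|h]; apply: nsum_eq0 => m.
  rewrite (Y_exponent hu (@momentum_Y _ _ _ _ _ hv hw)) ?scaler0 // => k e.
  apply: (h (k + N + n - m%:Z)).
  have -> : s1 = s1 - n%:~R + m%:R + n%:~R - m%:R by ring.
  by rewrite e dotDr hN; ring.
rewrite (Y_exponent hv hw) ?(linear0' (lr _ _)) ?scaler0 // => k e.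
apply: (h (k + m%:Z)); have -> : s2 = s2 - m%:R + m%:R by ring.
by rewrite e; ring.
Qed.

Lemma jacobi21_out mu nu be (N n : int) u v w s1 s2 : dot mu nu = N%:~R ->
  momentum mu u -> momentum nu v -> momentum be w ->
  ((forall p : int, s1 <> dot mu be + p%:~R) \/ forall q : int, s2 <> dot nu be + q%:~R) ->
  jacobi21 Y u v w n s1 s2 = 0.
Proof.
move=> hN hu hv hw h.
rewrite (jacobi21E NO) /flip (@jacobi12_out nu mu be N) ?scaler0 //; first by rewrite dotC.
by case: h; [right|left].
Qed.

(** For exponents of z_2 outside nu.be + Z the iterate has no term either, since its total
    exponent lies in (mu + nu).be + Z. *)
Lemma jacobi_sector mu nu be (N n p : int) ka u v w s2 : dot mu nu = N%:~R ->
  ka * eps nu mu = (-1) ^ N * eps mu nu ->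
  momentum mu u -> momentum nu v -> momentum be w ->
  jacobi_defect ka u v w n (dot mu be + p%:~R) s2 = 0.
Proof.
move=> hN hka hu hv hw.
have [[q ->]|h] := pselect (exists q : int, s2 = dot nu be + q%:~R).
  exact: (jacobi_left hN hka).
have h' : forall q : int, s2 <> dot nu be + q%:~R by move=> q e; apply: h; exists q.
rewrite /jacobi_defect /kernelD.
rewrite (jacobi12_out n hN hu hv hw) ?(jacobi21_out n hN hu hv hw); try by right.
rewrite scaler0 !add0r /jacobi20 nsum_eq0 ?scaler0 // => m.
rewrite (Y_exponent (@momentum_Y _ _ _ _ _ hu hv) hw) ?scaler0 // => k e.
apply: (h' (k - p - 1 - m%:Z)).
have -> : s2 = dot mu be + p%:~R + s2 + 1 + m%:R - dot mu be - p%:~R - 1 - m%:R by ring.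
by rewrite e dotDl; ring.
Qed.

End JacobiIdentity.

(** * The Jacobi identity with delta functions *)

Section DeltaProducts.
Variables (F : numFieldType) (W : lmodType F).

(** In each of the three products of the Jacobi identity the exponent of one variable
    fixes one of the two summation indices of the delta function; the index pairs that
    remain form the sequence g. *)
Lemma mul3_delta (e : int * nat -> F * F * F) (c : int * nat -> F) (X : F * F * F -> W) s
    (g : nat -> int * nat) : injective e -> injective g ->
  (forall i, X (s - e i) != 0 -> exists m, i = g m) ->
  mul3 (formal_sum [set: int * nat] e c) X s =
  nsum (fun m => c (g m) *: X (s - e (g m))).
Proof.
move=> ie ig hX; pose K := formal_sum [set: int * nat] e c.
have K1 i : K (e i) = c i.
  rewrite /K /formal_sum (_ : [set: _] `&` _ = [set i]) ?fsbig_set1 //.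
  by apply/seteqP; split => [j [_ /= /ie]|j /= ->].
rewrite /mul3 -/K -(fsbig_widen (range (e \o g))) //; last first.
  move=> t /= [_ ht]; have [[i hi]|h] := pselect (exists i, e i = t).
    rewrite -hi; have [->|/hX[m em]] := eqVneq (X (s - e i)) 0; first exact: scaler0.
    by case: ht; exists m => //=; rewrite -em.
  rewrite /K /formal_sum (_ : _ `&` _ = set0) ?fsbig_set0 ?scale0r //.
  by apply/seteqP; split => // i [_ /= hi]; apply: h; exists i.
rewrite (reindex_fsbig (e \o g) [set: nat]); first by apply: eq_nsum => m; rewrite /= K1.
split=> [m _|i j _ _ /= /ie/ig //|_ [m _ <-]]; by exists m.
Qed.

Lemma mul3_eq0 (K : F * F * F -> F) (X : F * F * F -> W) s :
  (forall t, K t != 0 -> X (s - t) = 0) -> mul3 K X s = 0.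
Proof.
move=> h; rewrite /mul3 fsbig1 // => t _.
by have [->|/h ->] := eqVneq (K t) 0; rewrite ?scale0r ?scaler0.
Qed.

Lemma formal_sum_neq0 (e : int * nat -> F * F * F) (c : int * nat -> F) t :
  formal_sum [set: int * nat] e c t != 0 -> exists i, t = e i.
Proof.
move=> h; apply: contrapT => hn; move/eqP: h; apply.
rewrite /formal_sum (_ : _ `&` _ = set0) ?fsbig_set0 //.
by apply/seteqP; split => // i [_ /= hi]; apply: hn; exists i.
Qed.

Variables (Y : W -> F -> W -> W).

Lemma mul3_delta12 u v w (n : int) s1 s2 :
  mul3 (@delta12 F) (fun t => if t.1.1 == 0 then Y u t.1.2 (Y v t.2 w) else 0)
    ((- n - 1)%:~R, s1, s2) = jacobi12 Y u v w n s1 s2.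
Proof.
rewrite /delta12 (mul3_delta _ (g := fun m => (n, m))).
- apply: eq_nsum => m; rewrite /= subrr eqxx /sbinom.
  by congr (_ *: Y _ _ _); ring.
- move=> [n1 m1] [n2 m2] [/eqP h _ /eqP h']; move: h h'; rewrite eqr_int eqr_nat => /eqP h /eqP ->.
  by congr (_, _); move: h; clear; lia.
- by move=> m1 m2 [].
case=> n1 m1 /=; case: ifP; rewrite ?eqxx // subr_eq0 eqr_int => /eqP h _.
by exists m1; congr (_, _); move: h; clear; lia.
Qed.

Lemma mul3_delta21 u v w (n : int) s1 s2 :
  mul3 (@delta21 F) (fun t => if t.1.1 == 0 then Y v t.2 (Y u t.1.2 w) else 0)
    ((- n - 1)%:~R, s1, s2) = jacobi21 Y u v w n s1 s2.
Proof.
rewrite /delta21 (mul3_delta _ (g := fun m => (n, m))).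
- apply: eq_nsum => m; rewrite /= subrr eqxx [cbinom _ _ * _]mulrC.
  by congr (_ *: Y _ _ _); rewrite /sbinom; ring.
- move=> [n1 m1] [n2 m2] [/eqP h /eqP h' _]; move: h h'; rewrite eqr_int eqr_nat => /eqP h /eqP ->.
  by congr (_, _); move: h; clear; lia.
- by move=> m1 m2 [].
case=> n1 m1 /=; case: ifP; rewrite ?eqxx // subr_eq0 eqr_int => /eqP h _.
by exists m1; congr (_, _); move: h; clear; lia.
Qed.

Lemma mul3_delta10 u v w rho s0 (p : int) s2 :
  mul3 (delta10 rho) (fun t => if t.1.2 == 0 then Y (Y u t.1.1 v) t.2 w else 0)
    (s0, - rho + p%:~R, s2) =
  nsum (fun m => cbinom (- (- rho + p%:~R) - 1) m *:
    Y (Y u (s0 - m%:R) v) (- rho + p%:~R + s2 + 1 + m%:R) w).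
Proof.
rewrite /delta10 (mul3_delta _ (g := fun m => (p + m%:Z, m))).
- apply: eq_nsum => m; rewrite /= intrD ifT; last by apply/eqP; ring.
  rewrite mulrC cbinomN; congr (cbinom _ _ *: Y (Y _ _ _) _ _); ring.
- move=> [n1 m1] [n2 m2] /= [/eqP]; rewrite eqr_nat => /eqP -> /addIr/addIr/eqP.
  by rewrite eqr_int => /eqP ->.
- by move=> m1 m2 [].
case=> n1 m1 /=; case: ifP; rewrite ?eqxx // => /eqP h _.
exists m1; congr (_, _); apply/eqP; rewrite -(eqr_int F) intrD; apply/eqP.
transitivity (- rho + p%:~R - (n1%:~R - rho - m1%:R) + n1%:~R); first by rewrite h add0r.
by ring.
Qed.

Lemma mul3_delta12_out u v w s0 s1 s2 : (forall n : int, s0 <> (- n - 1)%:~R) ->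
  mul3 (@delta12 F) (fun t => if t.1.1 == 0 then Y u t.1.2 (Y v t.2 w) else 0)
    (s0, s1, s2) = 0.
Proof.
move=> h; apply: mul3_eq0 => t /formal_sum_neq0[[n m] ->] /=.
by case: ifP => //; rewrite subr_eq0 => /eqP/h.
Qed.

Lemma mul3_delta21_out u v w s0 s1 s2 : (forall n : int, s0 <> (- n - 1)%:~R) ->
  mul3 (@delta21 F) (fun t => if t.1.1 == 0 then Y v t.2 (Y u t.1.2 w) else 0)
    (s0, s1, s2) = 0.
Proof.
move=> h; apply: mul3_eq0 => t /formal_sum_neq0[[n m] ->] /=.
by case: ifP => //; rewrite subr_eq0 => /eqP/h.
Qed.

Lemma mul3_delta10_out u v w rho s0 s1 s2 : (forall p : int, s1 <> - rho + p%:~R) ->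
  mul3 (delta10 rho) (fun t => if t.1.2 == 0 then Y (Y u t.1.1 v) t.2 w else 0)
    (s0, s1, s2) = 0.
Proof.
move=> h; apply: mul3_eq0 => t /formal_sum_neq0[[n m] ->] /=.
case: ifP => // /eqP e; case: (h (n - m%:Z)).
transitivity (s1 - (n%:~R - rho - m%:R) + (n%:~R - rho - m%:R)); first by rewrite subrK.
by rewrite e; ring.
Qed.

End DeltaProducts.

Section DeltaJacobi.
Variables (F : numFieldType) (l : nat) (W : lmodType F).
Local Notation key := (fkey F l).
Local Notation vec := 'rV[F]_l.
Variables (bvec : key -> W) (coef : key -> W -> F) (supp : W -> seq key).
Variables (heis : 'I_l -> int -> W -> W).
Variables (zpow : vec -> opseries W) (eop : vec -> W -> W) (eps : vec -> vec -> F).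
Variables (Y : W -> opseries W).
Hypothesis HL : lattice_fields bvec coef supp heis zpow eop eps Y.
Hypothesis eps_cocycle : forall a b c, eps a b * eps (a + b) c = eps b c * eps a (b + c).
Let H := lf_fock HL.
Let NO := lattice_normal_ordered HL.
Let lr u s := no_linear_r NO u s.
Let lY s w := no_linear_l NO s w.

Definition momenta (P : vec -> Prop) : W -> Prop := supported coef (fun b => P b.2).

Variables (P Q S : vec -> Prop) (rho ka : F).
Hypothesis hPQ : forall mu nu, P mu -> Q nu ->
  exists2 N : int, dot mu nu = N%:~R & ka * eps nu mu = (-1) ^ N * eps mu nu.
Hypothesis hPS : forall mu be, P mu -> S be -> exists k : int, dot mu be = - rho + k%:~R.

Lemma trilinear_ext (D : W -> W -> W -> W) :
  (forall v w, linear (fun u => D u v w)) -> (forall u w, linear (fun v => D u v w)) ->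
  (forall u v, linear (D u v)) ->
  (forall mu nu be u v w, P mu -> Q nu -> S be -> momentum coef mu u ->
    momentum coef nu v -> momentum coef be w -> D u v w = 0) ->
  forall u v w, momenta P u -> momenta Q v -> momenta S w -> D u v w = 0.
Proof.
move=> l1 l2 l3 h u v w hu hv hw.
have mb b : momentum coef b.2 (bvec b) by exact: (momentum_bvec HL).
apply: (linear_ext_on H (f := fun u => D u v w) (g := fun=> 0) _ _ _ hu) => //.
  exact: linear_cst0.
move=> b1 p1; apply: (linear_ext_on H (f := fun v => D _ v w) (g := fun=> 0) _ _ _ hv) => //.
  exact: linear_cst0.
move=> b2 p2; apply: (linear_ext_on H (f := D _ _) (g := fun=> 0) _ _ _ hw) => //.
  exact: linear_cst0.
by move=> b3 p3; apply: (h b1.2 b2.2 b3.2).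
Qed.

(** By hypothesis the exponents of z_1 on the left-hand side lie in - rho + Z, as they do
    on the right-hand side. At other exponents of z_1, and at nonintegral exponents of
    z_0, all three products vanish. *)
Lemma jacobi_delta u v w : momenta P u -> momenta Q v -> momenta S w -> forall s,
  mul3 (@delta12 F) (fun t => if t.1.1 == 0 then Y u t.1.2 (Y v t.2 w) else 0) s
  - ka *: mul3 (@delta21 F) (fun t => if t.1.1 == 0 then Y v t.2 (Y u t.1.2 w) else 0) s
  = mul3 (delta10 rho) (fun t => if t.1.2 == 0 then Y (Y u t.1.1 v) t.2 w else 0) s.
Proof.
move=> hu hv hw [[s0 s1] s2].
have [[p ->]|h1] := pselect (exists p : int, s1 = - rho + p%:~R).
  rewrite [RHS]mul3_delta10; have [[n ->]|h0] := pselect (exists n : int, s0 = (- n - 1)%:~R).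
    rewrite mul3_delta12 mul3_delta21.
    have e : jacobi_defect Y ka u v w n (- rho + p%:~R) s2 = 0.
      apply: (@trilinear_ext (fun u v w => jacobi_defect Y ka u v w n _ s2)
        _ _ _ _ u v w) => //.
      - by move=> v' w'; exact: (jacobi_defect_linear_u HL).
      - by move=> u' w'; exact: (jacobi_defect_linear_v HL).
      - by move=> u' v'; exact: (jacobi_defect_linear_w HL).
      move=> mu nu be u' v' w' pm pn pb hu' hv' hw'.
      have [N hN hka] := hPQ pm pn; have [k hk] := hPS pm pb.
      have -> : - rho + p%:~R = dot mu be + (p - k)%:~R by rewrite hk intrB; ring.
      exact: (jacobi_sector HL eps_cocycle n (p - k) s2 hN hka).
    move/eqP: e; rewrite /jacobi_defect /kernelD scaleN1r scaleNr subr_eq0 => /eqP ->.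
    by apply: eq_nsum => m; congr (_ *: Y (Y _ _ _) _ _); ring.
  have h0' (n : int) : s0 <> (- n - 1)%:~R by move=> e; apply: h0; exists n.
  rewrite mul3_delta12_out // mul3_delta21_out // scaler0 subr0 nsum_eq0 // => m.
  rewrite (@trilinear_ext (fun u v w => Y (Y u (s0 - m%:R) v) _ w)) ?scaler0 //.
  + by move=> v' w'; exact: (linear_comp' (lY _ _) (lY _ _)).
  + by move=> u' w'; exact: (linear_comp' (lY _ _) (lr _ _)).
  move=> mu nu be u' v' w' pm pn pb hu' hv' hw'.
  have [N hN _] := hPQ pm pn.
  rewrite (Y_exponent HL hu' hv') ?(linear0' (lY _ _)) // => k e.
  apply: (h0' (- (N + k + m%:Z) - 1)).
  have -> : s0 = s0 - m%:R + m%:R by ring.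
  rewrite e hN; have -> : - (- (N + k + m%:Z) - 1) - 1 = N + k + m%:Z by ring.
  by rewrite !intrD.
have h1' (p : int) : s1 <> - rho + p%:~R by move=> e; apply: h1; exists p.
have out t mu be (n k : int) : P mu -> S be -> s1 - t = n%:~R -> t <> dot mu be + k%:~R.
  move=> pm pb e e1; have [k' hk] := hPS pm pb; apply: (h1' (k' + k + n)).
  by rewrite -[s1](subrK t) e e1 hk !intrD; ring.
rewrite [RHS]mul3_delta10_out // !mul3_eq0 ?scaler0 ?subr0 //.
  move=> t /formal_sum_neq0[[n m] ->] /=; case: ifP => // _.
  apply: (@trilinear_ext (fun u v w => Y v _ (Y u _ w)) _ _ _ _ u v w) => //.
  - by move=> v' w'; exact: (linear_comp' (lr _ _) (lY _ _)).
  - by move=> u' v'; exact: (linear_comp' (lr _ _) (lr _ _)).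
  move=> mu nu be u' v' w' pm pn pb hu' hv' hw'.
  rewrite (Y_exponent HL hu' hw') ?(linear0' (lr _ _)) // => k.
  by apply: (out _ _ _ m%:Z) => //; rewrite subKr.
move=> t /formal_sum_neq0[[n m] ->] /=; case: ifP => // _.
apply: (@trilinear_ext (fun u v w => Y u _ (Y v _ w)) _ _ _ _ u v w) => //.
- by move=> u' w'; exact: (linear_comp' (lr _ _) (lY _ _)).
- by move=> u' v'; exact: (linear_comp' (lr _ _) (lr _ _)).
move=> mu nu be u' v' w' pm pn pb hu' hv' hw'.
have [N hN _] := hPQ pm pn.
rewrite (Y_exponent HL hu' (momentum_Y HL hv' hw')) // => k.
rewrite dotDr hN addrAC [_ + dot mu be]addrC -intrD.
by apply: (out _ _ _ (n - m%:Z)) => //; rewrite subKr intrB.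
Qed.

End DeltaJacobi.

(** * Gradings and the Virasoro vector *)

Section Support.
Variables (F : numFieldType) (l : nat) (W : lmodType F).
Local Notation key := (fkey F l).
Variables (bvec : key -> W) (coef : key -> W -> F) (supp : W -> seq key).
Variables (heis : 'I_l -> int -> W -> W).
Hypothesis H : fock_space bvec coef supp heis.
Implicit Types (P : key -> Prop).

Lemma supp_coef b w : coef b w != 0 -> b \in supp w.
Proof.
apply: contraNT => hb; rewrite (fock_span H w) (vcoef_sum H) big1_seq // => k /andP[_ hk].
rewrite (vcoefZ H) (coef_bvec H); case: eqP => [e|_]; last exact: mulr0.
by move: hb; rewrite -e hk.
Qed.

Lemma supported_subspace P : is_subspace (supported coef P).
Proof. by split; [exact: (supported0 H)|move=> a u v; exact: (supportedP H)]. Qed.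

Lemma supported_fin_dim P : finite_set P -> fin_dim (supported coef P).
Proof.
move=> /finite_fsetP[X hX]; exists (size X), (fun i => bvec (tnth (in_tuple X) i)) => w hw.
exists (fun i => coef (tnth (in_tuple X) i) w).
rewrite -(big_tnth _ _ X xpredT (fun b => coef b w *: bvec b)).
apply: (coef_inj H) => b; rewrite (vcoef_sum H).
have [hb|nb] := boolP (b \in (X : seq key)).
  rewrite (bigD1_seq b) ?fset_uniq //= (vcoefZ H) (coef_bvec H) eqxx mulr1 big1 ?addr0 //.
  by move=> b' /negbTE nb; rewrite (vcoefZ H) (coef_bvec H) nb mulr0.
have -> : coef b w = 0.
  by apply: contrapT => /eqP/hw; rewrite hX /= => hb; move: nb; rewrite hb.
rewrite big1_seq // => b' /andP[_ hb']; rewrite (vcoefZ H) (coef_bvec H).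
by case: eqP => [e|_]; [move: nb; rewrite -e hb'|rewrite mulr0].
Qed.

(** The component of index r collects the basis vectors with h b = r. *)
Lemma supported_direct_sum (J : choiceType) P (h : key -> J) :
  direct_sum (supported coef P) (fun r => supported coef (fun b => P b /\ h b = r)).
Proof.
split=> [r|w|f [fin hf] f0].
- exact: supported_subspace.
- split=> [hw|[f [_ hf] ->]]; last first.
    apply: (supported_fsum H) => j; apply: (supportedS _ (hf j)); by move=> b [].
  pose f r := \sum_(k <- supp w | h k == r) coef k w *: bvec k.
  have cf r b : coef b (f r) = if h b == r then coef b w else 0.
    rewrite (vcoef_sum H); under eq_bigr => k _ do rewrite (vcoefZ H) (coef_bvec H).
    case: eqP => [<-|nh]; last first.
      rewrite big1 // => k /eqP hk; case: eqP => [e|_]; last exact: mulr0.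
      by case: nh; rewrite -e.
    rewrite [X in _ = coef b X](fock_span H w) (vcoef_sum H) big_mkcond; apply: eq_bigr => k _.
    rewrite (vcoefZ H) (coef_bvec H); case: eqP => // hk.
    by case: (k =P b) hk => [->//|_ _]; rewrite mulr0.
  have f0 r : r \notin map h (supp w) -> f r = 0.
    move=> nr; rewrite /f big1_seq // => k /andP[/eqP hk ks].
    by move: nr; rewrite -hk map_f.
  exists f; first split.
  + apply: (@sub_finite_set _ _ [set` map h (supp w)]); last exact: finite_seq.
    by move=> r /= nf; apply: contraNT nf => /f0 ->; rewrite eqxx.
  + move=> r b; rewrite cf; case: ifP => [/eqP e nb|_]; last by rewrite eqxx.
    by split=> //; exact: hw.
  rewrite -(fsbig_widen [set` undup (map h (supp w))]) //; last first.
    by move=> r [_ /= /negP]; rewrite mem_undup => /f0.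
  rewrite -fsbig_seq ?undup_uniq //; apply: (coef_inj H) => b; rewrite (vcoef_sum H).
  under eq_bigr => r _ do rewrite cf.
  have [->|nb] := eqVneq (coef b w) 0; first by rewrite big1 // => r _; rewrite if_same.
  rewrite (bigD1_seq (h b)) ?undup_uniq //=; last by rewrite mem_undup map_f // supp_coef.
  by rewrite eqxx big1 ?addr0 // => r /negbTE nr; rewrite eq_sym nr.
move=> r; apply: (coef_eq0 H) => b.
have [e|ne] := eqVneq (h b) r; last first.
  by apply: contrapT => /eqP /(hf r) [_ e]; move: ne; rewrite e eqxx.
have other j : j != r -> coef b (f j) = 0.
  by move=> nj; apply: contrapT => /eqP /(hf j) [_ e']; move: nj; rewrite -e' e eqxx.
have [X hX] : exists X : {fset J}, [set i | f i != 0] = [set` X] by exact/finite_fsetP.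
have := congr1 (coef b) f0.
rewrite -(fsbig_widen [set` (r |` X)%fset]) //; last first.
  move=> j [_ /= /negP]; rewrite in_fset1U negb_or => /andP[_ nX].
  apply: contrapT => /eqP nj; have : [set i | f i != 0] j by [].
  by rewrite hX /= (negbTE nX).
rewrite -fsbig_seq ?fset_uniq // (vcoef_sum H) (bigD1_seq r) ?fset_uniq //=; last first.
  by rewrite in_fset1U eqxx.
by rewrite big1 ?addr0 ?(vcoef0 H) // => j nj; exact: other.
Qed.

End Support.

Section Virasoro.
Variables (F : numFieldType) (l : nat) (W : lmodType F).
Local Notation key := (fkey F l).
Local Notation vec := 'rV[F]_l.
Variables (bvec : key -> W) (coef : key -> W -> F) (supp : W -> seq key).
Variables (heis : 'I_l -> int -> W -> W).
Variables (zpow : vec -> opseries W) (eop : vec -> W -> W) (eps : vec -> vec -> F).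
Variables (Y : W -> opseries W).
Hypothesis HL : lattice_fields bvec coef supp heis zpow eop eps Y.
Hypothesis eps_left0 : forall a, eps 0 a = 1.
Let H := lf_fock HL.
Let hl i n := heis_linear H i n.
Let NO := lattice_normal_ordered HL.
Let lr u s := no_linear_r NO u s.
Let lY s w := no_linear_l NO s w.
Local Notation vertex := (vertex bvec).

(** Both sides commute with all modes and have the same constant terms. *)
Lemma Y_vacuum s w : Y (vertex 0) s w = op_one s w.
Proof.
have l1 t : linear (@op_one F W t).
  by move=> c u v; rewrite /op_one; case: ifP => _; rewrite ?scaler0 ?addr0.
pose D t w := Y (vertex 0) t w - op_one t w.
have lD t : linear (D t).
  apply: (linear_add' (f := Y (vertex 0) t)) => // c u v.
  by rewrite l1 opprD scalerN.
apply/eqP; rewrite -subr_eq0; apply/eqP; rewrite -/(D s w).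
apply: (linear_ext H (f := D s) (g := fun=> 0)) => //; first exact: linear_cst0.
move=> b; apply: (coherent_family_eq0 H lD (be := b.2)).
- move=> i n t _; exists [::] => v; rewrite big_nil addr0 /D (linearB' (hl _ _)).
  rewrite (vertex_comm HL) mxE scale0r addr0; congr (_ - _).
  by rewrite /op_one; case: ifP => _ //; exact: linear0' (hl _ _).
- move=> t g; rewrite /D -scaleN1r (vcoefD H) (vcoefZ H) (constant_vertex_vertex HL).
  rewrite eps_left0 mul1r add0r (_ : dot 0 b.2 = 0); last first.
    by apply: big1 => i _; rewrite mxE mul0r.
  rewrite /op_one; case: ifP => _; last by rewrite (vcoef0 H) mulr0 addr0.
  by rewrite (coef_bvec H) xpair_eqE eqxx mulN1r subrr.
exact: (momentum_bvec HL).
Qed.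

Local Notation current i := (heis i (Negz 0) (vertex 0)).

Lemma Y_current_out i s w : (forall n : int, s <> (- n - 1)%:~R) -> Y (current i) s w = 0.
Proof.
move=> hs; rewrite (no_normal NO) !nsum_eq0 ?addr0 // => r;
  rewrite Y_vacuum /op_one ifF ?(linear0' (hl _ _)) ?scaler0 //.
- apply/eqP => e; apply: (hs r%:Z); rewrite -[s](addrK (r%:R + 1 + 0%:R)) !addrA e.
  by rewrite intrB mulrNz; ring.
- apply/eqP => e; apply: (hs (- r%:Z - 1)).
  rewrite -[s](addrK (- r%:R + 0%:R)) !addrA e.
  by rewrite !(intrB, mulrNz); ring.
Qed.

Lemma Y_current i (n : int) w : Y (current i) (- n - 1)%:~R w = heis i n w.
Proof.
have e (r : nat) : (- n - 1)%:~R - r%:R + 0%:R = (- n - 1 - r%:Z)%:~R :> F.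
  by rewrite addr0 [RHS]intrB.
have e' (r : nat) : (- n - 1)%:~R + r%:R + 1 + 0%:R = (- n + r%:Z)%:~R :> F.
  by rewrite addr0 !intrD; ring.
rewrite (no_normal NO); case: n e e' => n e e'.
  rewrite [X in X + _]nsum_eq0 ?add0r => [|r].
    rewrite (@nsum1 _ n) => [|r hr]; rewrite cbinom0 scale1r Y_vacuum /op_one e' intr_eq0.
      by rewrite addNr eqxx.
    by rewrite ifF //; move: hr; clear; lia.
  rewrite cbinom0 scale1r Y_vacuum /op_one e intr_eq0 ifF ?(linear0' (hl _ _)) //; clear; lia.
rewrite [X in _ + X]nsum_eq0 ?addr0 => [|r].
  rewrite (@nsum1 _ n) => [|r hr]; rewrite cbinom0 scale1r Y_vacuum /op_one e intr_eq0.
    by rewrite ifT //; clear; lia.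
  by rewrite ifF ?(linear0' (hl _ _)) //; move: hr; clear; lia.
rewrite cbinom0 scale1r Y_vacuum /op_one e' intr_eq0; case: eqP => //; clear; lia.
Qed.

Definition conformal_vector : W :=
  2^-1 *: \sum_(i < l) heis i (Negz 0) (current i).

Lemma Y_conformal_out s w : (forall n : int, s <> (- n - 2)%:~R) ->
  Y conformal_vector s w = 0.
Proof.
move=> hs; rewrite (linearZ' (lY _ _)) (linear_sum' _ _ _ (lY _ _)) big1 ?scaler0 // => i _.
rewrite (no_normal NO) !nsum_eq0 ?addr0 // => r; rewrite Y_current_out ?(linear0' (hl _ _)) ?scaler0 // => n e.
- apply: (hs (n + r%:Z)); rewrite -[s](addrK (r%:R + 1 + 0%:R)) !addrA e.
  by rewrite !(intrB, intrD, mulrNz); ring.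
- apply: (hs (n - r%:Z - 1)).
  rewrite -[s](addrK (- r%:R + 0%:R)) !addrA e.
  by rewrite !(intrB, intrD, mulrNz); ring.
Qed.

Lemma weight_double_sum (m : {cmonom ('I_l * nat)%type}) N : (weight m <= N)%N ->
  (\sum_(i < l) \sum_(r < N) r.+1 * m (i, val r) = weight m)%N.
Proof.
elim/mon_ind: m => [|m [j k] IH] hN.
  by rewrite weight1 big1 // => i _; rewrite big1 // => r _; rewrite onecmE muln0.
move: hN; rewrite weightM /= => hN; rewrite -IH; last by move: hN; clear; lia.
have hk : (k < N)%N by move: hN; clear; lia.
rewrite !pair_big (bigD1 (j, Ordinal hk)) //= [in RHS](bigD1 (j, Ordinal hk)) //=.
rewrite mulcmUE eqxx mulnDr muln1 addnAC; congr (_ + _ + _)%N.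
apply: eq_bigr => -[i r] /= ne; rewrite mulcmUE (_ : (_ == _) = false) ?addn0 //.
by apply: contraNF ne => /eqP[<- e]; apply/eqP; congr (_, _); apply: val_inj.
Qed.

(** As a(-r-1) a(r+1) multiplies a monomial by r + 1 times the exponent of its variable,
    and a(0) multiplies it by the momentum, this is the value of
    L(0) = (1/2) \sum_i (a^i(0)^2 + 2 \sum_r a^i(-r-1) a^i(r+1)). *)
Theorem conformal_weight b : Y conformal_vector (- 1 - 1) (bvec b) =
  ((weight b.1)%:R + 2^-1 * dot b.2 b.2) *: bvec b.
Proof.
pose N := weight b.1.
have A i r : heis i (Negz r) (heis i r.+1 (bvec b)) = (r.+1 * b.1 (i, r))%:R *: bvec b.
  rewrite (heisP H) (linearZ' (hl _ _)) (heisN H) /=.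
  have [->|nz] := eqVneq (b.1 (i, r)) 0%N; first by rewrite muln0 !scale0r.
  by rewrite divcmUK //; case: (b).
have A0 i r : (N <= r)%N -> (r.+1 * b.1 (i, r))%:R *: bvec b = 0.
  move=> hr; have [->|/weight_ge] := eqVneq (b.1 (i, r)) 0%N; first by rewrite muln0 scale0r.
  by rewrite /= ltnNge hr.
have e1 i (r : nat) : Y (current i) (- 1 - 1 - r%:R + 0%:R) (bvec b) = heis i r.+1 (bvec b).
  by rewrite -[RHS]Y_current; congr (Y _ _ _); rewrite !(intrB, mulrNz); ring.
have e2 i (r : nat) w : Y (current i) (- 1 - 1 + r%:R + 1 + 0%:R) w = heis i (- r%:Z) w.
  by rewrite -[RHS]Y_current; congr (Y _ _ _); rewrite !(intrB, mulrNz); ring.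
have sum1 i : Y (heis i (Negz 0) (current i)) (- 1 - 1) (bvec b) =
    (2 * (\sum_(r < N) r.+1 * b.1 (i, val r))%:R + b.2 0 i * b.2 0 i) *: bvec b.
  rewrite (no_normal NO).
  rewrite (nsumE (N := N)) => [|r hr]; last by rewrite e1 A A0 ?scaler0.
  rewrite (nsumE (N := N.+1)) => [|[|r] hr //]; last by rewrite e2 -NegzE A A0 ?scaler0.
  rewrite big_ord_recl e2 oppr0 (heis0 H) (linearZ' (hl _ _)) (heis0 H) cbinom0 scale1r.
  under eq_bigr => r _ do rewrite cbinom0 scale1r e1 A.
  under [X in _ + (_ + X)]eq_bigr => r _ do rewrite cbinom0 scale1r e2 -NegzE A.
  rewrite -!scaler_suml scalerA -!scalerDl natr_sum; congr (_ *: _); ring.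
rewrite (linearZ' (lY _ _)) (linear_sum' _ _ _ (lY _ _)).
rewrite (eq_bigr _ (fun i _ => sum1 i)) -scaler_suml scalerA; congr (_ *: _).
rewrite big_split -mulr_sumr -natr_sum weight_double_sum // mulrDr mulKf //.
by rewrite pnatr_eq0.
Qed.

End Virasoro.

(** * The complex exponential and finiteness of lattice balls *)

Section ComplexExponential.
Variable R : realType.
Local Notation C := R[i].
Implicit Types (z w : C).

Lemma ReD z w : complex.Re (z + w) = complex.Re z + complex.Re w.
Proof. by case: z w => [a b] [c d]. Qed.

Lemma ImD z w : complex.Im (z + w) = complex.Im z + complex.Im w.
Proof. by case: z w => [a b] [c d]. Qed.

Lemma ReN z : complex.Re (- z) = - complex.Re z.
Proof. by case: z. Qed.

Lemma ImN z : complex.Im (- z) = - complex.Im z.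
Proof. by case: z. Qed.

Lemma ReM z w : complex.Re (z * w) =
  complex.Re z * complex.Re w - complex.Im z * complex.Im w.
Proof. by case: z w => [a b] [c d]. Qed.

Lemma Re_int (n : int) : complex.Re (n%:~R : C) = n%:~R.
Proof.
have Re_nat (m : nat) : complex.Re (m%:R : C) = m%:R.
  by elim: m => // m IH; rewrite -!natr1 ReD IH.
case: n => n; rewrite ?NegzE ?mulrNz; first exact: Re_nat.
by rewrite ReN -[RHS]/(- (n.+1%:R)) -Re_nat.
Qed.

Lemma Im_int (n : int) : complex.Im (n%:~R : C) = 0.
Proof.
have Im_nat (m : nat) : complex.Im (m%:R : C) = 0.
  by elim: m => // m IH; rewrite -!natr1 ImD IH addr0.
case: n => n; first exact: Im_nat.
by rewrite NegzE mulrNz ImN Im_nat oppr0.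
Qed.

Lemma Re_half (z r : C) (n : nat) : n%:R + 2^-1 * z = r ->
  n%:R + 2^-1 * complex.Re z = complex.Re r.
Proof.
move=> e; have {e} : z = 2%:~R * (r - n%:~R).
  by rewrite -e addrAC subrr add0r mulrA mulfV ?mul1r // pnatr_eq0.
move=> ->; rewrite ReM Re_int Im_int mul0r subr0 mulKf ?pnatr_eq0 //.
by rewrite ReD ReN Re_int addrC subrK.
Qed.

Lemma cexpD z w : cexp (z + w) = cexp z * cexp w.
Proof.
rewrite /cexp ReD ImD expRD cosD sinD.
apply/eqP; rewrite eq_complex /=; apply/andP; split; apply/eqP; ring.
Qed.

Lemma cexp0 : cexp (0 : C) = 1.
Proof. by rewrite /cexp /= expR0 cos0 sin0; apply/eqP; rewrite eq_complex /=; apply/andP; split; apply/eqP; ring. Qed.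

Lemma cexp_neq0 z : cexp z != 0.
Proof.
apply/eqP => h; have := cexpD z (- z); rewrite addrN cexp0 h mul0r => /eqP.
by rewrite oner_eq0.
Qed.

Lemma cexpN z : cexp (- z) = (cexp z)^-1.
Proof.
apply: (mulfI (cexp_neq0 z)); rewrite -cexpD addrN cexp0 mulfV //.
exact: cexp_neq0.
Qed.

(** Subtracting the integral part of x changes the sine by a sign at most, and the sine
    has no zero strictly between 0 and pi. *)
Lemma sin_pi_int (x : R) : sin (pi * x) = 0 -> exists k : int, x = k%:~R.
Proof.
move=> h; pose k := Num.floor x; exists k.
pose f := x - k%:~R.
have f0 : 0 <= f by rewrite subr_ge0 floor_le.
have f1 : f < 1 by rewrite ltrBlDl -intrD1 floorD1_gt.
have sn (m : nat) (y : R) : sin (y + pi * m%:R) = (-1) ^+ m * sin y.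
  elim: m => [|m IH]; first by rewrite mulr0 addr0 mul1r.
  by rewrite -natr1 mulrDr mulr1 addrA sinDpi IH exprS mulN1r mulNr.
have hs : sin (pi * f) = 0.
  have e : x = f + k%:~R by rewrite subrK.
  move: h; rewrite e mulrDr; case: (k) => m.
    by rewrite sn => /eqP; rewrite mulf_eq0 signr_eq0 => /eqP.
  move=> h; have := sn m.+1 (pi * f + pi * (Negz m)%:~R).
  by rewrite h mulr0 -addrA -mulrDr NegzE mulrNz addNr mulr0 addr0.
have [z|nz] := eqVneq f 0; first by rewrite -[x](subrK k%:~R) -/f z add0r.
have : 0 < sin (pi * f).
  apply: sin_gt0_pi; rewrite mulr_gt0 ?pi_gt0 ?lt0r ?nz //=.
  by rewrite -[ltRHS]mulr1 ltr_pM2l ?pi_gt0.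
by rewrite hs ltxx.
Qed.

(** The imaginary part of e^(2 pi i z) = 1 says that sin (2 pi x) = 0 for z = x + i y, hence
    that cos (2 pi x) is 1 or -1; the real part then gives cos (2 pi x) = 1, so that
    sin (pi x) = 0, and y = 0. *)
Lemma cexp_eq1 z : cexp (two_pi_i R * z) = 1 -> exists k : int, z = k%:~R.
Proof.
case: z => x y; rewrite /cexp /two_pi_i /= !mul0r !sub0r !add0r.
move=> /eqP; rewrite eq_complex /= !mul0r subr0 addr0 => /andP[/eqP h1 /eqP h2].
set E := expR _ in h1 h2.
have E0 : E != 0 by rewrite gt_eqF // expR_gt0.
have s0 : sin (2 * pi * x) = 0.
  by apply/eqP; move/eqP: h2; rewrite mulf_eq0 (negbTE E0).
have c1 : cos (2 * pi * x) = 1.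
  have := cos2Dsin2 (2 * pi * x); rewrite s0 expr0n addr0 => /eqP; rewrite sqrf_eq1.
  case/orP => /eqP // c; move: h1; rewrite c mulrN1 => h1.
  by have := expR_gt0 (- (2 * pi * y)); rewrite -/E -[E]opprK h1 oppr_gt0 ltr10.
have y0 : y = 0.
  move: h1; rewrite c1 mulr1 /E -[RHS]expR0 => /expR_inj/eqP.
  have p0 : 2 * pi != 0 :> R by rewrite mulf_neq0 ?pnatr_eq0 // gt_eqF // pi_gt0.
  by rewrite oppr_eq0 mulf_eq0 (negbTE p0) => /eqP.
have [k hk] : exists k : int, x = k%:~R.
  apply: sin_pi_int; apply/eqP; rewrite -sqrf_eq0 sin2cos2.
  have := cos_mulr2n (pi * x); rewrite (_ : pi * x *+ 2 = 2 * pi * x) ?c1 => [e|]; last by ring.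
  have : cos (pi * x) ^+ 2 *+ 2 = 1 *+ 2 by rewrite -[LHS](subrK 1) -e; ring.
  by move=> /(pmulrnI (isT : 0 < 2)%N) ->; rewrite subrr.
by exists k; apply/eqP; rewrite eq_complex /= y0 hk Re_int eqxx /= Im_int eqxx.
Qed.

Lemma cexp_eq z w : cexp (two_pi_i R * z) = cexp (two_pi_i R * w) ->
  exists k : int, z = w + k%:~R.
Proof.
move=> h; have [k hk] : exists k : int, z - w = k%:~R.
  by apply: cexp_eq1; rewrite mulrBr cexpD cexpN h mulfV ?cexp_neq0.
by exists k; rewrite -hk addrC subrK.
Qed.

End ComplexExponential.

Section Finiteness.
Variables (R : realType) (l : nat).
Local Notation C := R[i].
Implicit Types (mu nu a : 'rV[R]_l) (al : 'rV[C]_l).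

Lemma finite_weight d : finite_set [set m : {cmonom ('I_l * nat)%type} | (weight m <= d)%N].
Proof.
elim: d => [|d IH].
  apply: (sub_finite_set _ (finite_set1 (onecm _))) => m /=; elim/mon_ind: m => // m x _.
  by rewrite weightM addnS.
pose f (p : {cmonom ('I_l * nat)%type} * ('I_l * 'I_d.+1)) := mulcm p.1 (ucm (p.2.1, val p.2.2)).
pose A := [set m : {cmonom ('I_l * nat)%type} | (weight m <= d)%N].
apply: (@sub_finite_set _ _ ([set onecm _] `|` f @` (A `*` setT))); last first.
  rewrite finite_setU; split; first exact: finite_set1.
  by apply/finite_image/finite_setX => //; exact: finite_finset.
move=> m; elim/mon_ind: m => [|m [i k] _]; first by left.
rewrite /= weightM /= => hm; right.
have hk : (k < d.+1)%N by move: hm; clear; lia.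
by exists (m, (i, Ordinal hk)) => //; split => //=; move: hm; clear; rewrite /A /=; lia.
Qed.

Lemma finite_int_box (M : nat) :
  finite_set [set x : 'rV[int]_l | forall j, (absz (x 0%R j) <= M)%N].
Proof.
pose f (y : 'rV['I_(M + M).+1]_l) : 'rV[int]_l := \row_j ((val (y 0 j))%:Z - M%:Z).
apply: (@sub_finite_set _ _ (range f)); last by apply/finite_image/finite_finset.
move=> x /= hx; exists (\row_j inord (absz (x 0 j + M%:Z))) => //.
apply/rowP => j; rewrite !mxE; have := hx j; move: (x 0 j) => z hz.
by rewrite /= inordK; move: hz; clear; lia.
Qed.

Lemma dot_ge0 mu : 0 <= dot mu mu.
Proof. by apply: sumr_ge0 => i _; rewrite -expr2 sqr_ge0. Qed.

Lemma dot_ge_coord mu i : mu 0 i ^+ 2 <= dot mu mu.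
Proof.
rewrite /dot (bigD1 i) //= -expr2 lerDl.
by apply: sumr_ge0 => j _; rewrite -expr2 sqr_ge0.
Qed.

(** A bound on the norm of mu bounds its coordinates with respect to the basis of the
    lattice, through the inverse of the basis matrix. *)
Lemma finite_lattice_ball (L : set 'rV[R]_l) a K : integral_lattice L ->
  finite_set [set mu | L mu /\ dot (mu + a) (mu + a) <= K].
Proof.
case=> [[B uB ->] _].
pose S := \sum_i \sum_j `|invmx B i j|.
(* a coordinate x of mu + a with x^2 <= K satisfies |x| <= |K| + 1 *)
pose T := `|K| + 1 + \sum_i `|a 0 i|.
pose M : nat := (Num.truncn (T * S)).+1.
pose f (x : 'rV[int]_l) : 'rV[R]_l := map_mx intr x *m B.
apply: (@sub_finite_set _ _ (f @` [set x : 'rV[int]_l | forall j, (absz (x 0%R j) <= M)%N])); last first.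
  by apply/finite_image/finite_int_box.
move=> mu /= [[x _ <-]]; set mu' := _ *m B => hK; exists x => // j.
have hmu i : `|mu' 0 i| <= T.
  have h1 : `|(mu' + a) 0 i| <= `|K| + 1.
    have h2 : `|(mu' + a) 0 i| ^+ 2 <= `|K|.
      rewrite real_normK ?num_real //; apply: le_trans (dot_ge_coord _ _) _.
      exact: le_trans hK (ler_norm _).
    rewrite leNgt; apply/negP => h3.
    have : `|K| + 1 < `|(mu' + a) 0 i| ^+ 2.
      apply: (lt_le_trans h3); rewrite expr2 ler_peMl //.
      by apply: le_trans (ltW h3); rewrite lerDr.
    by move=> /lt_le_trans/(_ h2); rewrite gtrDl ltNge ler01.
  have -> : mu' 0 i = (mu' + a) 0 i - a 0 i by rewrite [X in X - _]mxE addrK.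
  apply: le_trans (ler_normB _ _) _; apply: lerD => //.
  rewrite (bigD1 i) //= lerDl; exact: sumr_ge0.
have ex : (x 0 j)%:~R = \sum_i mu' 0 i * invmx B i j :> R.
  have : (mu' *m invmx B) 0 j = (x 0 j)%:~R by rewrite mulmxK // mxE.
  by rewrite mxE.
have hx : `|(x 0 j)%:~R| <= T * S :> R.
  rewrite ex; apply: le_trans (ler_norm_sum _ _ _) _; rewrite mulr_sumr.
  apply: ler_sum => i _; rewrite normrM; apply: ler_pM => //.
  by rewrite (bigD1 j) //= lerDl; exact: sumr_ge0.
have T0 : 0 <= T * S by apply: le_trans hx.
rewrite -(ler_nat R) natr_absz intr_norm; apply: le_trans hx _.
by apply/ltW; rewrite /M truncnS_gt.
Qed.

Lemma dot_embed mu nu : dot (embed mu) (embed nu) = (dot mu nu)%:C%C.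
Proof.
rewrite /dot rmorph_sum; apply: eq_bigr => i _.
by rewrite !mxE -rmorphM.
Qed.

(** For complex al the square (mu + al)^2 is not positive, but its real part differs
    from the square of the real vector mu + Re al by a constant only. This is why L(0) has
    finite-dimensional eigenspaces and eigenvalues bounded below in each class. *)
Lemma Re_dot al mu : complex.Re (dot (embed mu + al) (embed mu + al)) =
  dot (mu + map_mx (@complex.Re R) al) (mu + map_mx (@complex.Re R) al) -
  dot (map_mx (@complex.Im R) al) (map_mx (@complex.Im R) al).
Proof.
rewrite /dot (big_morph _ (@ReD R) (erefl : complex.Re (0 : C) = 0)) -sumrB.
apply: eq_bigr => i _; rewrite !mxE ReM ReD ImD /=; ring.
Qed.

End Finiteness.

(** * Shifting the momentum *)

Section SpectralFlow.
Variables (F : numFieldType) (l : nat) (W : lmodType F).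
Local Notation key := (fkey F l).
Local Notation vec := 'rV[F]_l.
Variables (bvec : key -> W) (coef : key -> W -> F) (supp : W -> seq key).
Variables (heis : 'I_l -> int -> W -> W).
Variables (zpow : vec -> opseries W) (eop : vec -> W -> W) (eps : vec -> vec -> F).
Variables (Y : W -> opseries W).
Hypothesis HL : lattice_fields bvec coef supp heis zpow eop eps Y.
Hypothesis eps_cocycle : forall a b c, eps a b * eps (a + b) c = eps b c * eps a (b + c).
Hypothesis eps_neq0 : forall a b, eps a b != 0.
Let H := lf_fock HL.
Let hl i n := heis_linear H i n.
Let NO := lattice_normal_ordered HL.
Let lr u s := no_linear_r NO u s.
Let lY s w := no_linear_l NO s w.
Local Notation vertex := (vertex bvec).
Variable al : vec.

Local Notation A := (annihilator heis (-1) al).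
Let lA t : linear (A t) := annihilator_linear H (-1) al t.

(** The series Delta(al, z) = z^(al(0)) Y_+(al, -z). *)
Definition shift_series : opseries W := op_mul (zpow al) A.

(** The vertex operators Y(Delta(al, z) v, z). *)
Definition flowed (v : W) : opseries W :=
  fun s w => \sum_(t \in [set: F]) Y (shift_series t v) (s - t) w.

(** The vertex operators Y(Y_+(al, -z) v, z). They differ from the previous ones by a shift
    of exponents, because z^(al(0)) is a scalar on each M_mu. *)
Definition reduced (v : W) : opseries W :=
  fun s w => nsum (fun p => Y (A (- p%:R) v) (s + p%:R) w).

Lemma shift_series_momentum mu t v : momentum coef mu v ->
  shift_series t v = A (t - dot al mu) v.
Proof.
move=> hv; rewrite /shift_series (op_mul_seq (T := [:: dot al mu])) // => [|t' ht'].
  rewrite big_seq1 (zpow_momentum HL (be := mu)) ?eqxx //.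
  exact: (momentum_annihilator HL).
rewrite (zpow_momentum HL (be := mu)) ?ifF //; last exact: (momentum_annihilator HL).
by apply: contraNF ht'; rewrite inE.
Qed.

Lemma fin1_reduced v s w : fin1 (fun p => Y (A (- p%:R) v) (s + p%:R) w).
Proof.
have [d hd] := annihilator_finite H (-1) al v.
by exists d.+1 => p hp; rewrite hd // (linear0' (lY _ _)).
Qed.

Lemma flowed_momentum mu v s w : momentum coef mu v ->
  flowed v s w = reduced v (s - dot al mu) w.
Proof.
move=> hv; rewrite /flowed.
rewrite -(fsbig_widen ((fun p : nat => dot al mu - p%:R) @` [set: nat])) //; last first.
  move=> t /= [_ ht]; rewrite (shift_series_momentum _ hv) (annihilator_support H).
    exact: linear0' (lY _ _).
  by move=> p e; apply: ht; exists p => //; rewrite -e addrC subrK.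
rewrite fsbig_image //; last by move=> i j _ _ /addrI/oppr_inj/eqP; rewrite eqr_nat => /eqP.
apply: eq_nsum => p; rewrite (shift_series_momentum _ hv).
have -> : dot al mu - p%:R - dot al mu = - p%:R by ring.
by have -> : s - (dot al mu - p%:R) = s - dot al mu + p%:R by ring.
Qed.

Lemma flowed_linear s w : linear (fun v => flowed v s w).
Proof.
have fA : finite_op A.
  move=> v; have [d hd] := annihilator_finite H (-1) al v.
  apply: (@sub_finite_set _ _ ((fun p : nat => - p%:R) @` `I_d.+1)); last first.
    by apply: finite_image; exact: finite_II.
  move=> t /= ht; have [[p hp]|h] := pselect (exists p : nat, t = - p%:R); last first.
    by move/eqP: ht; case; apply: (annihilator_support H) => p e; apply: h; exists p.
  exists p => //; rewrite /= ltnS leqNgt; apply/negP => /hd h0.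
  by move: ht; rewrite hp h0 eqxx.
have lS t : linear (shift_series t).
  by apply: linear_op_mul_finite => // ?; exact: (zpow_linear HL).
have fS : finite_op shift_series.
  apply: (linear_finite_op HL) => // b.
  have mb : momentum coef b.2 (bvec b) by exact: (momentum_bvec HL).
  apply: (@sub_finite_set _ _ ((fun t => t + dot al b.2) @` [set t | A t (bvec b) != 0])).
    by move=> t /=; rewrite (shift_series_momentum _ mb) => ht; exists (t - dot al b.2); rewrite ?subrK.
  exact/finite_image/fA.
have e v : flowed v s w = op_mul (fun t v => Y v t w) shift_series s v.
  rewrite /flowed /op_mul (reindex_fsbigT (fun t => s - t)); last first.
    by exists (fun t => s - t) => t; rewrite subKr.
  by apply: eq_fsbigr => t _; rewrite subKr.
move=> c u v; rewrite !e.
by apply: (linear_op_mul_finite (A := fun t v => Y v t w)) => // t; exact: lY.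
Qed.

Lemma normal_product_reduced i k v s w : normal_product heis i k (reduced v) s w =
  nsum (fun p => normal_product heis i k (Y (A (- p%:R) v)) (s + p%:R) w).
Proof.
have [d hd] := annihilator_finite H (-1) al v.
pose G1 p r := cbinom r%:R k *: heis i (Negz r) (Y (A (- p%:R) v) (s + p%:R - r%:R + k%:R) w).
pose G2 p r := cbinom (- r%:R - 1) k *: Y (A (- p%:R) v) (s + p%:R + r%:R + 1 + k%:R) (heis i r w).
have fG1 : fin2 G1.
  apply: fin2_rows.
    by exists d.+1 => p hp r; rewrite /G1 hd // (Y0 NO) (linear0' (hl _ _)) scaler0.
  by move=> p; exact: (fin1_normal_neg NO).
have fG2 : fin2 G2.
  apply: fin2_rows.
    by exists d.+1 => p hp r; rewrite /G2 hd // (Y0 NO) scaler0.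
  by move=> p; exact: (fin1_normal_pos NO).
rewrite /normal_product nsumD; [|exact: (fin2_nsum fG1)|exact: (fin2_nsum fG2)].
rewrite (nsum_exch fG1) (nsum_exch fG2); congr (_ + _); apply: eq_nsum => r.
  rewrite (linear_nsum (hl _ _) (fin1_reduced _ _ _)).
  rewrite nsumZ; last exact: (fin1_linear (hl i (Negz r)) (fin1_reduced _ _ _)).
  by apply: eq_nsum => p; rewrite /G1; congr (_ *: heis _ _ (Y _ _ _)); ring.
rewrite nsumZ; last exact: fin1_reduced.
by apply: eq_nsum => p; rewrite /G2; congr (_ *: Y _ _ _); ring.
Qed.

(** The commutator of a(-k-1) with Y_+(al, -z) is al (-z)^(-k-1) Y_+(al, -z). Apart from
    the resulting multiple, the vertex operators obey the iterate formula. *)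
Lemma reduced_creation i k v s w : reduced (heis i (Negz k) v) s w =
  normal_product heis i k (reduced v) s w +
  (al 0 i * (-1) ^+ k) *: reduced v (s + 1 + k%:R) w.
Proof.
have e p : A (- p%:R) (heis i (Negz k) v) =
    heis i (Negz k) (A (- p%:R) v) + (al 0 i * (-1) ^+ k) *: A (- p%:R + k.+1%:R) v.
  rewrite (annihilator_comm H) -addrA -scalerDl -exprVn invrN1 exprS.
  by rewrite mulN1r mulrN addNr scale0r addr0.
have fin2' : fin1 (fun p => Y (A (- p%:R + k.+1%:R) v) (s + p%:R) w).
  have [d hd] := annihilator_finite H (-1) al v; exists (d.+1 + k.+1)%N => p hp.
  rewrite (_ : - p%:R + k.+1%:R = - (p - k.+1)%:R).
    by rewrite hd ?(linear0' (lY _ _)) //; move: hp; clear; lia.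
  by rewrite natrB; [ring|move: hp; clear; lia].
have sh : nsum (fun p => Y (A (- p%:R + k.+1%:R) v) (s + p%:R) w) =
    reduced v (s + 1 + k%:R) w.
  rewrite (@nsum_shift _ k.+1) => [|p hp].
    apply: eq_nsum => p; have -> : - (k.+1 + p)%:R + k.+1%:R = - p%:R :> F by rewrite natrD; ring.
    by have -> : s + (k.+1 + p)%:R = s + 1 + k%:R + p%:R by rewrite natrD -natr1; ring.
  rewrite (annihilator_support H) ?(linear0' (lY _ _)) // => q /eqP.
  rewrite -subr_eq0 opprK addrAC -addrA -natrD addrC subr_eq0 eqr_nat.
  by move=> /eqP; move: hp; clear; lia.
rewrite normal_product_reduced -sh nsumZ // -nsumD.
- apply: eq_nsum => p; rewrite e (linearD' (lY _ _)) (linearZ' (lY _ _)).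
  by rewrite (no_normal NO).
- have [d hd] := annihilator_finite H (-1) al v; exists d.+1 => p hp.
  transitivity (Y (heis i (Negz k) (A (- p%:R) v)) (s + p%:R) w).
    by rewrite (no_normal NO).
  by rewrite hd // (linear0' (hl _ _)) (linear0' (lY _ _)).
exact: fin1Z.
Qed.

Variable f : W -> W.
Hypothesis f_linear : linear f.
Hypothesis f_bvec : forall b, f (bvec b) = (eps (b.2 - al) al)^-1 *: bvec (b.1, b.2 - al).

Lemma flow_heis i n w : n != 0 -> f (heis i n w) = heis i n (f w).
Proof.
move=> nz; apply: (linear_ext H (f := fun w => f (heis i n w)) (g := fun w => heis i n (f w)));
  try exact: linear_comp'.
move=> b; rewrite f_bvec (linearZ' (hl _ _)); case: n nz => [[|n]|n] // _.
  by rewrite !(heisP H) (linearZ' f_linear) f_bvec /= !scalerA mulrC.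
by rewrite !(heisN H) f_bvec.
Qed.

Lemma flow_heis0 i w : f (heis i (Posz 0) w) = heis i (Posz 0) (f w) + al 0 i *: f w.
Proof.
apply: (linear_ext H (f := fun w => f (heis i (Posz 0) w))
  (g := fun w => heis i (Posz 0) (f w) + al 0 i *: f w)).
- exact: linear_comp'.
- apply: (linear_add' (f := fun w => heis i (Posz 0) (f w))); first exact: linear_comp'.
  exact: linear_scale'.
move=> b; rewrite f_bvec (linearZ' (hl _ _)) !(heis0 H) (linearZ' f_linear) f_bvec !scalerA.
by rewrite -scalerDl /= !mxE; congr (_ *: _); ring.
Qed.

Lemma coef_flow m g w : coef (m, g) (f w) = (eps g al)^-1 * coef (m, g + al) w.
Proof.
apply: (linear_ext H (X := F^o) (f := fun w => coef (m, g) (f w))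
  (g := fun w => (eps g al)^-1 * coef (m, g + al) w)).
- by move=> c u v; rewrite f_linear (coef_linear H).
- by move=> c u v; rewrite (coef_linear H) mulrDr mulrCA.
case=> m' g'; rewrite f_bvec (vcoefZ H) !(coef_bvec H) !xpair_eqE subr_eq /=.
by case: (g' =P _) => [->|_]; rewrite ?addrK // !andbF !mulr0.
Qed.

Lemma reduced_vertex mu s w : reduced (vertex mu) s w = Y (vertex mu) s w.
Proof.
rewrite /reduced (@nsum1 _ 0%N) => [|p hp].
  by rewrite oppr0 addr0 (annihilator0 H).
have -> : A (- p%:R) (vertex mu) = 0.
  apply: (supported_empty H (P := fun b => (weight b.1 + p <= 0)%N)).
    apply: (annihilator_weight H); apply: (supported_bvec H).
    by rewrite /= weight1.
  by move=> b; move: hp; clear; lia.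
exact: linear0' (lY _ _).
Qed.

(** The differences of the two sides form a family that is closed under commutators with
    the modes of nonzero index, with which f commutes. The constant terms agree by the
    cocycle identity for (mu, be - al, al); the factor eps(be - al, al)^-1 in f serves this
    purpose. *)
Lemma flow_vertex mu s w :
  f (Y (vertex mu) s w) = Y (vertex mu) (s - dot al mu) (f w).
Proof.
pose D s w := f (Y (vertex mu) s w) - Y (vertex mu) (s - dot al mu) (f w).
have lD t : linear (D t).
  move=> c u v; rewrite /D lr !f_linear lr opprD addrACA; congr (_ + _).
  by rewrite scalerBr.
apply/eqP; rewrite -subr_eq0; apply/eqP; rewrite -/(D s w).
apply: (linear_ext H (f := D s) (g := fun=> 0)) => //; first exact: linear_cst0.
move=> b; apply: (coherent_family_eq0 H lD (be := b.2)).
- move=> i n t nz; exists [:: (mu 0 i, t - n%:~R)] => v; rewrite big_seq1 /D /=.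
  rewrite (linearB' (hl _ _)) -flow_heis // (vertex_comm HL) (linearD' f_linear).
  rewrite (linearZ' f_linear) (vertex_comm HL) -flow_heis // scalerBr [in RHS]addrACA opprD.
  by rewrite (addrAC t).
- move=> t g; rewrite /D -scaleN1r (vcoefD H) (vcoefZ H) coef_flow (constant_vertex_vertex HL).
  rewrite f_bvec (linearZ' (lr _ _)) (vcoefZ H) (constant_vertex_vertex HL) /=.
  set be := b.2; rewrite (_ : (_ == dot mu (be - al)) = (t == dot mu be)); last first.
    rewrite -[LHS](inj_eq (addIr (dot al mu))) subrK (dotC al mu) -dotDr subrK //.
  rewrite addrA subr_eq; case: eqP => _; last by rewrite !mulr0 addr0.
  case: eqP => [e|_]; last by rewrite !mulr0 addr0.
  have := eps_cocycle mu (be - al) al; rewrite subrK addrA e addrK => h.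
  rewrite !mulr1 mulN1r; apply/eqP; rewrite subr_eq0; apply/eqP.
  apply: (mulfI (eps_neq0 g al)); rewrite mulVKf //.
  apply: (mulfI (eps_neq0 (be - al) al)); rewrite -h.
  by field; rewrite eps_neq0.
exact: (momentum_bvec HL).
Qed.

(** Both sides satisfy the same recursion in the monomial of v: f commutes with all modes
    except a(0), which it shifts by al, and in the iterate formula this shift appears with
    the coefficient binom(-1, k) = (-1)^k, exactly as the additional multiple in
    reduced_creation does. *)
Theorem flow_intertwines v s w : f (Y v s w) = flowed v s (f w).
Proof.
apply: (linear_ext H (f := fun v => f (Y v s w)) (g := fun v => flowed v s (f w))).
- exact: (linear_comp' f_linear (lY _ _)).
- exact: flowed_linear.
case=> m mu; rewrite (@flowed_momentum mu); last exact: (supported_bvec H).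
elim/mon_ind: m s w => [|m [i k] IH] s w.
  by rewrite reduced_vertex; exact: flow_vertex.
have -> : bvec (mulcm m (ucm (i, k)), mu) = heis i (Negz k) (bvec (m, mu)).
  by rewrite (heisN H).
rewrite (no_normal NO) reduced_creation (linearD' f_linear).
rewrite (linear_nsum f_linear (fin1_normal_neg NO _ _ _ _ _)).
rewrite (linear_nsum f_linear (fin1_normal_pos NO _ _ _ _ _)) -[RHS]addrA; congr (_ + _).
  apply: eq_nsum => r; rewrite (linearZ' f_linear) flow_heis // IH.
  by congr (_ *: heis _ _ (reduced _ _ _)); ring.
set u := bvec (m, mu); set t := s - dot al mu.
have r0 t' : reduced u t' 0 = 0 by rewrite /reduced nsum_eq0 // => p; exact: linear0' (lr _ _).
have rD t' x y : reduced u t' (x + y) = reduced u t' x + reduced u t' y.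
  rewrite /reduced -nsumD; try exact: fin1_reduced.
  by apply: eq_nsum => p; rewrite (linearD' (lr _ _)).
have rZ t' c x : reduced u t' (c *: x) = c *: reduced u t' x.
  by rewrite /reduced nsumZ; [apply: eq_nsum => p; rewrite (linearZ' (lr _ _))|exact: fin1_reduced].
pose g r := cbinom (- r%:R - 1) k *: reduced u (t + r%:R + 1 + k%:R) (heis i r (f w)).
pose x r := if r == 0%N then (al 0 i * (-1) ^+ k) *: reduced u (t + 1 + k%:R) (f w) else 0.
have fg : fin1 g.
  have [N hN] := heis_trunc H i (f w); exists N => r hr.
  by rewrite /g hN // r0 scaler0.
have fx : fin1 x by exists 1%N => -[].
have -> : (al 0 i * (-1) ^+ k) *: reduced u (t + 1 + k%:R) (f w) = nsum x.
  by rewrite (@nsum1 _ 0%N) // => -[].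
rewrite -nsumD //; apply: eq_nsum => r; rewrite (linearZ' f_linear) IH -/u /g.
have -> : s + r%:R + 1 + k%:R - dot al mu = t + r%:R + 1 + k%:R by rewrite /t; ring.
case: r => [|r]; last by rewrite flow_heis // addr0.
rewrite flow_heis0 rD rZ scalerDr scalerA /x /= addr0.
by rewrite cbinom_m1 [in RHS]mulrC.
Qed.

End SpectralFlow.

(** * Transport of twisted modules *)

(** An injective linear map preserves supports, and so the convention that sums of
    infinite support are 0. *)
Lemma linear_fsum (F : fieldType) (W1 W2 : lmodType F) (f : W1 -> W2) (I : choiceType)
    (D : set I) (G : I -> W1) : linear f -> injective f ->
  f (\sum_(i \in D) G i) = \sum_(i \in D) f (G i).
Proof.
move=> lf jf; rewrite (linear_sum' _ _ _ lf); congr (bigop.body _ _ _).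
rewrite /finite_support !unlock; congr (fset_set (D `&` _)).
apply/seteqP; split => i /= h e; apply: h; last by rewrite e (linear0' lf).
by apply: jf; rewrite e (linear0' lf).
Qed.

Section DirectSumTransport.
Variables (F : fieldType) (W1 W2 : lmodType F) (f : W1 -> W2) (f' : W2 -> W1).
Hypotheses (lf : linear f) (lf' : linear f') (fK : cancel f f') (f'K : cancel f' f).

Lemma preimage_subspace (S : set W1) : is_subspace S -> is_subspace (f' @^-1` S).
Proof.
by move=> [S0 SD]; split=> [|a u v hu hv] /=; rewrite ?(linear0' lf') // lf'; apply: SD.
Qed.

Lemma preimage_fin_dim (S : set W1) : fin_dim S -> fin_dim (f' @^-1` S).
Proof.
move=> [n [b hb]]; exists n, (f \o b) => w /hb[c e]; exists c.
rewrite -[w]f'K e (linear_sum' _ _ _ lf); apply: eq_bigr => i _.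
by rewrite (linearZ' lf).
Qed.

Lemma preimage_direct_sum (I : choiceType) (S : set W1) (Si : I -> set W1) :
  direct_sum S Si -> direct_sum (f' @^-1` S) (fun i => f' @^-1` (Si i)).
Proof.
have [jf jf'] := (can_inj fK, can_inj f'K).
have fam h : is_family (fun i => f' @^-1` Si i) h <-> is_family Si (f' \o h).
  have e : [set i | h i != 0] = [set i | (f' \o h) i != 0].
    apply/seteqP; split => i /=; apply: contraNN => /eqP e.
      by apply/eqP/jf'; rewrite e (linear0' lf').
    by rewrite e (linear0' lf').
  by rewrite /is_family e.
move=> [sub dec ind]; split.
- by move=> i; exact: preimage_subspace.
- move=> w; split=> [/dec[h hh e]|[h /fam hh ->]].
    exists (f \o h); first by apply/fam; rewrite (_ : f' \o _ = h) //; apply/funext => i /=.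
    by rewrite -[LHS]f'K e (linear_fsum _ _ lf jf).
  by apply/dec; exists (f' \o h) => //; rewrite (linear_fsum _ _ lf' jf').
- move=> h /fam hh h0 i; apply: (can_inj f'K); rewrite (linear0' lf').
  by apply: (ind _ hh); rewrite -(linear_fsum _ _ lf' jf') h0 (linear0' lf').
Qed.

End DirectSumTransport.

Lemma direct_sum_sub (F : fieldType) (W : lmodType F) (I : choiceType) (S : set W)
    (Si : I -> set W) i : direct_sum S Si -> Si i `<=` S.
Proof.
move=> [sub dec _] w hw; apply/dec; exists (fun j => if j == i then w else 0); last first.
  rewrite -(fsbig_widen [set i]) //; first by rewrite fsbig_set1 /= eqxx.
  by move=> j [_ /= /eqP/negbTE ->].
split; last by move=> j; case: eqP => [->|_]; [exact: hw|exact: (sub j).1].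
apply: (@sub_finite_set _ _ [set i]); last exact: finite_set1.
by move=> j /=; case: (j =P i) => // _; rewrite eqxx.
Qed.

Section Transport.
Variables (R : realType) (U W1 W2 : lmodType R[i]).
Local Notation C := R[i].
Variables (V : vosa_data U) (g : U -> U).
Hypothesis V_subspace : is_subspace (vosa_space V).
Hypothesis V_one : vosa_space V (vosa_one V).
Hypothesis V_omega : vosa_space V (vosa_omega V).
Hypothesis V_parity : forall p v, vosa_parity V p v -> vosa_space V v.
Hypothesis V_closed : forall u s v, vosa_space V u -> vosa_space V v ->
  vosa_space V (vosa_Y V u s v).
Variables (S1 : set W1) (Y1 : U -> C -> W1 -> W1) (S2 : set W2) (Y2 : U -> C -> W2 -> W2).
Variables (f : W1 -> W2) (f' : W2 -> W1).
Hypotheses (lf : linear f) (lf' : linear f') (fK : cancel f f') (f'K : cancel f' f).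
Hypothesis hS : S2 = f' @^-1` S1.
Hypothesis hf : forall v s w, vosa_space V v -> S1 w -> f (Y1 v s w) = Y2 v s (f w).

Let Y2E v s w : vosa_space V v -> S2 w -> Y2 v s w = f (Y1 v s (f' w)).
Proof. by rewrite hS => hv hw; rewrite hf // f'K. Qed.

Lemma linear_mul3 (K : C * C * C -> C) (X : C * C * C -> W1) s :
  f (mul3 K X s) = mul3 K (f \o X) s.
Proof.
rewrite /mul3 (linear_fsum _ _ lf (can_inj fK)); apply: eq_fsbigr => t _.
by rewrite (linearZ' lf).
Qed.

Lemma eq_mul3 (K : C * C * C -> C) (X X' : C * C * C -> W2) s :
  X =1 X' -> mul3 K X s = mul3 K X' s.
Proof. by move=> /funext ->. Qed.

(** Every axiom for Y2 is the image under f of the axiom for Y1. The intertwining relation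
    is only given for vectors of V, whence the closure of V under its vertex operators is
    used in the Jacobi identity. *)
Theorem twisted_module_transport : twisted_module V g S1 Y1 -> twisted_module V g S2 Y2.
Proof.
have S2S1 w : S2 w -> S1 (f' w) by rewrite hS.
case=> sp cl ll lr [Sr [ds fd lb ev]] ex tr on om ja; split.
- by rewrite hS; exact: preimage_subspace.
- by move=> v s w hv hw; rewrite Y2E // hS /= fK; apply: cl => //; exact: S2S1.
- move=> s w hw a u v hu hv.
  have hauv : vosa_space V (a *: u + v) by exact: V_subspace.2.
  by rewrite !Y2E // ll ?lf //; exact: S2S1.
- move=> v s hv a u w hu hw; rewrite !Y2E //; last first.
    by rewrite hS; apply: (preimage_subspace lf' sp).2; rewrite -hS.
  by rewrite lf' lr ?lf //; exact: S2S1.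
- exists (fun r => f' @^-1` Sr r); split.
  + by rewrite hS; exact: (preimage_direct_sum lf lf' fK f'K).
  + by move=> r; exact: (preimage_fin_dim lf f'K).
  + move=> r; have [N hN] := lb r; exists N => n hn w /(hN _ hn) /= e.
    by rewrite -[w]f'K e (linear0' lf).
  + move=> r w hw; have hw1 : S1 (f' w) := direct_sum_sub ds hw.
    have := ev _ _ hw; rewrite /mode Y2E ?hS // => ->.
    by rewrite (linearZ' lf) f'K.
- move=> rho v hv n w hw hn; rewrite /mode Y2E //; last exact: hv.1.
  by have := ex _ _ hv n _ (S2S1 _ hw) hn; rewrite /mode => ->; rewrite (linear0' lf).
- move=> rho v hv w hw; have [K hK] := tr _ _ hv _ (S2S1 _ hw); exists K => k /hK.
  by rewrite /mode Y2E // => [->|]; [rewrite (linear0' lf)|exact: hv.1].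
- move=> s w hw; rewrite Y2E // on ?/op_one; last exact: S2S1.
  by case: ifP => _; rewrite ?f'K ?(linear0' lf).
- by move=> s w hw hs; rewrite Y2E // om ?(linear0' lf) //; exact: S2S1.
- move=> rho p q u v w hu hpu hpv hw s.
  have hw1 := S2S1 _ hw; have hv := V_parity hpv.
  have := congr1 f (ja rho p q u v _ hu hpu hpv hw1 s).
  rewrite (linearB' lf) (linearZ' lf) !linear_mul3.
  rewrite (@eq_mul3 (@delta12 C) _ (fun t => if t.1.1 == 0 then Y2 u t.1.2 (Y2 v t.2 w) else 0)).
  rewrite (@eq_mul3 (@delta21 C) _ (fun t => if t.1.1 == 0 then Y2 v t.2 (Y2 u t.1.2 w) else 0)).
  rewrite (@eq_mul3 (delta10 rho) _ (fun t => if t.1.2 == 0 then Y2 (vosa_Y V u t.1.1 v) t.2 w else 0)).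
  + by [].
  + move=> t /=; case: ifP => _; last exact: linear0' lf.
    by rewrite hf ?f'K //; apply: V_closed => //; exact: hu.1.
  + move=> t /=; case: ifP => _; last exact: linear0' lf.
    have hu1 := hu.1; rewrite hf //; last exact: cl.
    by rewrite hf // f'K.
  move=> t /=; case: ifP => _; last exact: linear0' lf.
  have hu1 := hu.1; rewrite hf //; last exact: cl.
  by rewrite hf // f'K.
Qed.

End Transport.

(** * The twisted modules of a lattice *)

Section MomentaY.
Variables (F : numFieldType) (l : nat) (W : lmodType F).
Local Notation key := (fkey F l).
Local Notation vec := 'rV[F]_l.
Variables (bvec : key -> W) (coef : key -> W -> F) (supp : W -> seq key).
Variables (heis : 'I_l -> int -> W -> W).
Variables (zpow : vec -> opseries W) (eop : vec -> W -> W) (eps : vec -> vec -> F).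
Variables (Y : W -> opseries W).
Hypothesis HL : lattice_fields bvec coef supp heis zpow eop eps Y.
Let H := lf_fock HL.
Let NO := lattice_normal_ordered HL.
Local Notation momenta := (momenta coef).

Lemma momenta_Y (P Q S : vec -> Prop) u w s : (forall mu be, P mu -> Q be -> S (mu + be)) ->
  momenta P u -> momenta Q w -> momenta S (Y u s w).
Proof.
move=> hS hu hw.
apply: (supported_linear H (f := fun u => Y u s w) (no_linear_l NO s w) _ hu) => b hb.
apply: (supported_linear H (no_linear_r NO _ s) _ hw) => b' hb'.
apply: (supportedS (P := fun k => k.2 = b.2 + b'.2)) => [k ->|]; first exact: hS.
by apply: (momentum_Y HL); exact: (supported_bvec H).
Qed.

Lemma momenta_exponent (P S : vec -> Prop) (E : F -> Prop) u w s :
  (forall mu be (k : int), P mu -> S be -> E (dot mu be + k%:~R)) ->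
  momenta P u -> momenta S w -> ~ E s -> Y u s w = 0.
Proof.
move=> hE hu hw hs.
apply: (linear_ext_on H (f := fun u => Y u s w) (g := fun=> 0) (no_linear_l NO s w) _ _ hu).
  exact: linear_cst0.
move=> b hb; apply: (linear_ext_on H (g := fun=> 0) (no_linear_r NO _ s) _ _ hw).
  exact: linear_cst0.
move=> b' hb'; apply: (Y_exponent HL (mu := b.2) (be := b'.2)).
- exact: (supported_bvec H).
- exact: (supported_bvec H).
by move=> k e; apply: hs; rewrite e; exact: hE.
Qed.

Lemma linear_set_bij (P Q : key -> Prop) (f f' : W -> W) : linear f -> linear f' ->
  cancel f f' -> cancel f' f ->
  (forall b, P b -> supported coef Q (f (bvec b))) ->
  (forall b, Q b -> supported coef P (f' (bvec b))) ->
  set_bij (supported coef P) (supported coef Q) f.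
Proof.
move=> lf lf' fK f'K hf hf'; split.
- by move=> w; exact: (supported_linear H).
- by move=> u v _ _; exact: (can_inj fK).
- by move=> w hw; exists (f' w); [exact: (supported_linear H lf' hf')|exact: f'K].
Qed.

Lemma cancel_basis (f f' : W -> W) : linear f -> linear f' ->
  (forall b, f' (f (bvec b)) = bvec b) -> cancel f f'.
Proof.
move=> lf lf' h w; apply: (linear_ext H (f := fun w => f' (f w)) (g := id)) => //.
exact: linear_comp'.
Qed.

(** Associativity of the operators e^x, e^y on a vector 1 (x) e^z. *)
Lemma eop_cocycle : (forall x y w, eop x (eop y w) = eps x y *: eop (x + y) w) ->
  forall x y z, eps x y * eps (x + y) z = eps y z * eps x (y + z).
Proof.
move=> h x y z; have := h x y (bvec (onecm _, z)).
rewrite (eop_bvec HL) (linearZ' (eop_linear HL _)) !(eop_bvec HL) /= addrA.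
move=> /(congr1 (coef (onecm _, x + y + z))).
by rewrite !(vcoefZ H) (coef_bvec H) eqxx !mulr1 => ->.
Qed.

End MomentaY.

Section LatticeModule.
Variables (R : realType) (l : nat).
Local Notation C := R[i].
Variable W : lmodType C.
Local Notation key := (fkey C l).
Local Notation vec := 'rV[C]_l.
Variables (bvec : key -> W) (coef : key -> W -> C) (supp : W -> seq key).
Variables (heis : 'I_l -> int -> W -> W).
Variables (zpow : vec -> opseries W) (eop : vec -> W -> W) (eps : vec -> vec -> C).
Variables (Y : W -> opseries W).
Hypothesis HL : lattice_fields bvec coef supp heis zpow eop eps Y.
Hypothesis eps_cocycle : forall a b c, eps a b * eps (a + b) c = eps b c * eps a (b + c).
Hypothesis eps_neq0 : forall a b, eps a b != 0.
Hypothesis eps_left0 : forall a, eps 0 a = 1.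
Variables (L : set 'rV[R]_l) (al : vec).
Hypothesis hL : integral_lattice L.
Hypothesis eps_comm : forall mu nu, L mu -> L nu -> forall m n k : int,
    dot mu mu = m%:~R -> dot nu nu = n%:~R -> dot mu nu = k%:~R ->
    eps (embed mu) (embed nu) / eps (embed nu) (embed mu) = (-1) ^ (k + m * n).
Let H := lf_fock HL.
Let NO := lattice_normal_ordered HL.
Let lr u s := no_linear_r NO u s.
Let lY s w := no_linear_l NO s w.
Local Notation momenta := (momenta coef).

Definition lattice_vec : set vec := @embed R l @` L.

Definition parity_vec (p : bool) : set vec :=
  [set embed mu | mu in L `&`
     [set mu | exists2 n : int, dot mu mu = n%:~R & odd `|n|%N = p]].

Definition coset_vec : set vec := [set embed mu + al | mu in L].

Lemma embedD (mu nu : 'rV[R]_l) : embed (mu + nu) = embed mu + embed nu.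
Proof. by apply/matrixP => i j; rewrite !mxE rmorphD. Qed.

Lemma lattice_add mu nu : L mu -> L nu -> L (mu + nu).
Proof.
case: hL => [[B _ ->] _] [x _ <-] [y _ <-]; exists (x + y) => //.
rewrite -mulmxDl; congr (_ *m B); apply/matrixP => i j.
by rewrite !mxE intrD.
Qed.

Lemma lattice_zero : L 0.
Proof.
case: hL => [[B _ ->] _]; exists 0 => //.
by rewrite (_ : map_mx _ 0 = 0) ?mul0mx //; apply/matrixP => i j; rewrite !mxE.
Qed.

Lemma dot_embed_int (mu nu : 'rV[R]_l) (n : int) : dot mu nu = n%:~R ->
  dot (embed mu) (embed nu) = n%:~R :> C.
Proof. by move=> e; rewrite dot_embed e rmorph_int. Qed.

Lemma dot_lattice mu nu : lattice_vec mu -> lattice_vec nu ->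
  exists N : int, dot mu nu = N%:~R.
Proof.
move=> [m Lm <-] [n Ln <-]; have [N hN] := hL.2 m n Lm Ln.
by exists N; exact: dot_embed_int.
Qed.

Lemma signz_odd (z : int) : (-1) ^ z = (-1) ^+ odd `|z|%N :> C.
Proof.
case: z => n; rewrite signr_odd //.
by rewrite NegzE -exprnN invr_sign.
Qed.

(** The commutator function equals (-1)^(mu.nu) up to the sign (-1)^(mu^2 nu^2), which is
    the sign of the superalgebra: p and q are the parities of mu^2 and nu^2. *)
Lemma lattice_sign p q mu nu : parity_vec p mu -> parity_vec q nu ->
  exists2 N : int, dot mu nu = N%:~R &
    (-1) ^+ (p && q) * eps nu mu = (-1) ^ N * eps mu nu.
Proof.
move=> [m [Lm [pm em om]] <-] [n [Ln [pn en on]] <-].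
have [k ek] := hL.2 m n Lm Ln; exists k; first exact: dot_embed_int.
have := eps_comm Lm Ln em en ek; move/(canRL (divfK (eps_neq0 _ _))) => ->.
rewrite exprzDr ?unitrN1 // !signz_odd abszM oddM om on !mulrA -expr2 sqrr_sign.
by rewrite mul1r.
Qed.

Lemma parity_lattice p mu : parity_vec p mu -> lattice_vec mu.
Proof. by move=> [m [Lm _] <-]; exists m. Qed.

Variable V : vosa_data W.
Hypothesis V_space : vosa_space V = momenta lattice_vec.
Hypothesis V_parity : forall p, vosa_parity V p = momenta (parity_vec p).
Hypothesis V_Y : vosa_Y V = Y.
Hypothesis V_one : vosa_one V = vertex bvec 0.
Hypothesis V_omega : vosa_omega V = conformal_vector bvec heis.
Variable g : W -> W.
Hypothesis g_linear : linear g.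
Hypothesis g_bvec : forall b, g (bvec b) = cexp (- two_pi_i R * dot al b.2) *: bvec b.

Lemma coef_g b w : coef b (g w) = cexp (- two_pi_i R * dot al b.2) * coef b w.
Proof.
apply: (linear_ext H (X := C^o) (f := fun w => coef b (g w))
  (g := fun w => cexp (- two_pi_i R * dot al b.2) * coef b w)).
- by move=> c u v; rewrite g_linear (coef_linear H).
- by move=> c u v; rewrite (coef_linear H) mulrDr mulrCA.
move=> b'; rewrite g_bvec (vcoefZ H) !(coef_bvec H).
by case: (b' =P b) => [->//|_]; rewrite !mulr0.
Qed.

Definition eigen_vec (rho : C) : set vec :=
  [set mu | lattice_vec mu /\ exists k : int, dot mu al = - rho + k%:~R].

(** The eigenvalue e^(- 2 pi i al.mu) of e^mu equals e^(2 pi i rho) if and only if mu.al lies in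
    - rho + Z; this is what links the eigenvalues of g to the exponents of z_1. *)
Lemma eigen_momenta rho v : eigen V g rho v -> momenta (eigen_vec rho) v.
Proof.
rewrite /eigen V_space => -[hv e] b hb; split; first exact: hv.
have : cexp (- two_pi_i R * dot al b.2) = cexp (two_pi_i R * rho).
  by apply: (mulIf hb); rewrite -coef_g e (vcoefZ H).
rewrite mulNr -mulrN => /cexp_eq[k hk]; exists (- k).
by rewrite dotC -[LHS]opprK hk opprD mulrNz.
Qed.

Lemma eigen_coset rho mu be : eigen_vec rho mu -> coset_vec be ->
  exists k : int, dot mu be = - rho + k%:~R.
Proof.
move=> [Lm [k hk]] [n Ln <-]; rewrite dotDr hk.
have [|N ->] := @dot_lattice mu (embed n) Lm; first by exists n.
by exists (N + k); rewrite intrD; ring.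
Qed.

(** The eigenvalue of L(0) on the basis vector b. *)
Definition energy (b : key) : C := (weight b.1)%:R + 2^-1 * dot b.2 b.2.

Let a := map_mx (@complex.Re R) al.
Let c := map_mx (@complex.Im R) al.

Lemma energy_Re (b : key) r mu : b.2 = embed mu + al -> energy b = r ->
  (weight b.1)%:R + 2^-1 * dot (mu + a) (mu + a) = complex.Re r + 2^-1 * dot c c.
Proof.
move=> eb er; have e := Re_half er; rewrite -e eb Re_dot mulrBr; ring.
Qed.

(** A bound on the real part of the eigenvalue bounds the weight of the monomial and, as
    weights are nonnegative, the norm of the momentum. *)
Lemma energy_finite r : finite_set [set b : key | coset_vec b.2 /\ energy b = r].
Proof.
pose K := complex.Re r + 2^-1 * dot c c.
pose f (p : {cmonom ('I_l * nat)%type} * 'rV[R]_l) : key := (p.1, embed p.2 + al).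
pose A1 := [set m : {cmonom ('I_l * nat)%type} | (weight m <= Num.truncn K)%N].
pose A2 := [set mu | L mu /\ dot (mu + a) (mu + a) <= 2 * K].
apply: (@sub_finite_set _ _ (f @` (A1 `*` A2))); last first.
  by apply/finite_image/finite_setX; [exact: finite_weight|exact: finite_lattice_ball].
case=> m be /= [[mu Lmu eb] er].
have e := @energy_Re (m, be) r mu (esym eb) er; rewrite -/K /= in e.
have half0 : 0 <= (2^-1 : R) by rewrite invr_ge0 ler0n.
exists (m, mu); last by rewrite /f /= eb.
split; rewrite /A1 /A2 /=.
  have K0 : 0 <= K by rewrite -e addr_ge0 // mulr_ge0 // dot_ge0.
  by rewrite truncn_ge_nat // -e lerDl mulr_ge0 // dot_ge0.
by split=> //; rewrite -e mulrDr mulVKf ?pnatr_eq0 // lerDr mulr_ge0.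
Qed.

Lemma energy_bounded r : exists N : int, forall n : int, n <= N ->
  forall b, coset_vec b.2 -> energy b <> r + n%:~R.
Proof.
pose K := complex.Re r + 2^-1 * dot c c.
exists (- (Num.floor K + 1)) => n hn b [mu Lmu eb] er.
have := energy_Re (esym eb) er; rewrite ReD Re_int => e.
have : 0 <= complex.Re r + n%:~R + 2^-1 * dot c c.
  by rewrite -e addr_ge0 // mulr_ge0 ?invr_ge0 ?ler0n // dot_ge0.
rewrite addrAC -/K leNgt => /negP; apply.
have hn' : n%:~R <= (- (Num.floor K + 1))%:~R :> R by rewrite ler_int.
apply: le_lt_trans (lerD (lexx K) hn') _.
by rewrite mulrNz subr_lt0 floorD1_gt.
Qed.

Theorem coset_twisted_module : twisted_module V g (momenta coset_vec) Y.
Proof.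
split.
- exact: (supported_subspace H).
- move=> v s w; rewrite V_space => hv hw; apply: (momenta_Y HL _ hv hw).
  move=> mu be [m Lm <-] [n Ln <-]; exists (m + n); first exact: lattice_add.
  by rewrite embedD addrA.
- by move=> s w _ k u v _ _; exact: lY.
- by move=> v s _ k u w _ _; exact: lr.
- exists (fun r => supported coef (fun b => coset_vec b.2 /\ energy b = r)); split.
  + exact: (supported_direct_sum H).
  + by move=> r; apply: (supported_fin_dim H); exact: energy_finite.
  + move=> r; have [N hN] := energy_bounded r; exists N => n hn w hw.
    by apply: (supported_empty H hw) => b [hb]; exact: hN.
  + move=> r w hw; rewrite /mode V_omega.
    apply: (linear_ext_on H (f := Y _ _) (g := fun w => r *: w) _ _ _ hw); first exact: lr.
      exact: (linear_scale' r (@linear_id' _ _)).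
    by move=> b [_ <-]; exact: (conformal_weight HL).
- move=> rho v hv n w hw hn.
  apply: (momenta_exponent HL (P := eigen_vec rho) (S := coset_vec)
    (E := fun s => exists k : int, s = - rho + k%:~R)) => //.
  + move=> mu be k hmu hbe; have [k' ->] := eigen_coset hmu hbe.
    by exists (k' + k); rewrite intrD addrA.
  + exact: eigen_momenta.
  move=> [k e]; apply: (hn (- k - 1)); rewrite intrB mulrNz.
  by rewrite -[LHS]opprK -[- n](subrK 1) e; ring.
- move=> rho v hv w hw; have [N hN] := no_trunc NO v (- rho - 1) w.
  exists N%:Z => -[k|k] // hk; rewrite /mode -[RHS](hN k hk); congr (Y v _ w).
  by rewrite -[k%:~R]/(k%:R); ring.
- by move=> s w _; rewrite V_one; exact: (Y_vacuum HL).
- by move=> s w _ hs; rewrite V_omega; exact: (Y_conformal_out HL).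
move=> rho p q u v w hu; rewrite !V_parity V_Y => hpu hpv hw.
apply: (jacobi_delta HL eps_cocycle (P := fun mu => eigen_vec rho mu /\ parity_vec p mu)
  (Q := parity_vec q) (S := coset_vec)) => //.
- by move=> mu nu [_ hp] hq; exact: lattice_sign.
- by move=> mu be [hmu _] hbe; exact: eigen_coset.
- by move=> b hb; split; [exact: (eigen_momenta hu)|exact: hpu].
Qed.

Variable g' : W -> W.
Hypothesis g'_linear : linear g'.
Hypothesis g'_bvec : forall b, g' (bvec b) = cexp (- (- two_pi_i R * dot al b.2)) *: bvec b.

Theorem lattice_automorphism : diagonalizable_automorphism V g.
Proof.
have gmom mu w : momentum coef mu w -> g w = cexp (- two_pi_i R * dot al mu) *: w.
  move=> hw; apply: (linear_ext_on H (f := g) (g := fun w => _ *: w) _ _ _ hw) => //.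
    exact: (linear_scale' _ (@linear_id' _ _)).
  by move=> b <-.
have mb b : momentum coef b.2 (bvec b) by exact: (supported_bvec H).
have mom0 w : momentum coef 0 w -> g w = w.
  move=> /gmom ->; rewrite (_ : dot al 0 = 0) ?mulr0 ?cexp0 ?scale1r //.
  by apply: big1 => i _; rewrite mxE mulr0.
have m0 : momentum coef 0 (vertex bvec 0) by exact: (supported_bvec H).
split.
- rewrite V_space; apply: (linear_set_bij HL g_linear g'_linear).
  + apply: (cancel_basis HL) => // b; rewrite g_bvec (linearZ' g'_linear) g'_bvec scalerA.
    by rewrite -cexpD addrN cexp0 scale1r.
  + apply: (cancel_basis HL) => // b; rewrite g'_bvec (linearZ' g_linear) g_bvec scalerA.
    by rewrite -cexpD addNr cexp0 scale1r.
  + by move=> b hb; rewrite g_bvec; apply: (supportedZ H); exact: (supported_bvec H).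
  + by move=> b hb; rewrite g'_bvec; apply: (supportedZ H); exact: (supported_bvec H).
- by move=> k u v _ _; exact: g_linear.
- by rewrite V_one; exact: mom0.
- rewrite V_omega; apply: mom0; apply: (supportedZ H); apply: (supported_sum H) => i _.
  by do 2?apply: (momentum_heis HL).
- move=> v w s _ _; rewrite V_Y.
  apply: (linear_ext H (f := fun v => g (Y v s w)) (g := fun v => Y (g v) s (g w))).
  + exact: (linear_comp' g_linear (lY _ _)).
  + exact: (linear_comp' (lY _ _) g_linear).
  move=> b; apply: (linear_ext H (f := fun w => g (Y (bvec b) s w))
    (g := fun w => Y (g (bvec b)) s (g w))).
  + exact: (linear_comp' g_linear (lr _ _)).
  + exact: (linear_comp' (lr _ _) g_linear).
  move=> b'; rewrite (gmom (b.2 + b'.2)); last exact: (momentum_Y HL).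
  rewrite !g_bvec (linearZ' (lY _ _)) (linearZ' (lr _ _)) scalerA -cexpD.
  by rewrite dotDr mulrDr.
rewrite V_space (_ : (fun lambda : C => _) = fun lambda => supported coef
    (fun b => lattice_vec b.2 /\ cexp (- two_pi_i R * dot al b.2) = lambda)).
  exact: (supported_direct_sum H).
apply/funext => lambda; apply/seteqP; split => [v [hv e] b hb|v hv].
  by split; [exact: hv|apply: (mulIf hb); rewrite -coef_g e (vcoefZ H)].
split; first by apply: (supportedS _ hv) => b [].
apply: (coef_inj H) => b; rewrite coef_g (vcoefZ H).
by have [->|/hv[_ ->]] := eqVneq (coef b v) 0; rewrite ?mulr0.
Qed.

Variables f f' : W -> W.
Hypotheses (f_linear : linear f) (f'_linear : linear f').
Hypothesis f_bvec : forall b, f (bvec b) = (eps (b.2 - al) al)^-1 *: bvec (b.1, b.2 - al).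
Hypothesis f'_bvec : forall b, f' (bvec b) = eps b.2 al *: bvec (b.1, b.2 + al).

(** The map f sends M_(mu + al) to M_mu, and the properties of (V_L, Y_g) are those of
    (V_(L + al), Y), carried along f. *)
Theorem flow_isomorphism : twisted_isomorphic V g (momenta coset_vec) Y
  (vosa_space V) (flowed heis zpow Y al).
Proof.
have fK : cancel f f'.
  apply: (cancel_basis HL) => // -[m be]; rewrite f_bvec (linearZ' f'_linear) f'_bvec /=.
  by rewrite scalerA mulVf // scale1r subrK.
have f'K : cancel f' f.
  apply: (cancel_basis HL) => // -[m be]; rewrite f'_bvec (linearZ' f_linear) f_bvec /=.
  by rewrite addrK scalerA mulfV // scale1r.
have hb b : coset_vec b.2 -> momenta lattice_vec (f (bvec b)).
  move=> [m Lm e]; rewrite f_bvec; apply: (supportedZ H); apply: (supported_bvec H).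
  by exists m => //=; rewrite -e addrK.
have hb' b : lattice_vec b.2 -> momenta coset_vec (f' (bvec b)).
  move=> [m Lm e]; rewrite f'_bvec; apply: (supportedZ H); apply: (supported_bvec H).
  by exists m => //=; rewrite e.
have tw v s w : f (Y v s w) = flowed heis zpow Y al v s (f w).
  exact: (flow_intertwines HL).
split; first exact: coset_twisted_module.
  apply: (twisted_module_transport _ _ _ _ _ f_linear f'_linear fK f'K _ _
    coset_twisted_module).
  - by rewrite V_space; exact: (supported_subspace H).
  - rewrite V_space V_one; apply: (supported_bvec H); exists 0; first exact: lattice_zero.
    by apply/matrixP => i j; rewrite !mxE.
  - rewrite V_space V_omega; apply: (supportedS (P := fun b => b.2 = 0)).
      by move=> b ->; exists 0; [exact: lattice_zero|apply/matrixP => i j; rewrite !mxE].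
    apply: (supportedZ H); apply: (supported_sum H) => i _.
    by do 2?apply: (momentum_heis HL); exact: (supported_bvec H).
  - by move=> p v; rewrite V_parity V_space; apply: supportedS => b; exact: parity_lattice.
  - move=> u s v; rewrite V_space V_Y => hu hv; apply: (momenta_Y HL _ hu hv).
    move=> mu be [m Lm <-] [n Ln <-]; exists (m + n); first exact: lattice_add.
    by rewrite embedD.
  - rewrite V_space; apply/seteqP; split => w hw /=.
      exact: (supported_linear H f'_linear hb').
    by rewrite -[w]f'K; exact: (supported_linear H f_linear hb).
  - by move=> v s w _ _; exact: tw.
exists f; split.
- by move=> k u v _ _; exact: f_linear.
- by rewrite V_space; exact: (linear_set_bij HL f_linear f'_linear fK f'K).
- by move=> v s w _ _; exact: tw.
Qed.

End LatticeModule.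

(** * The space of formal linear combinations *)

Section Concrete.
Variables (R : realType) (l : nat).
Local Notation C := R[i].
Local Notation M := (calM R l).
Local Notation K := (key R l).
Implicit Types (b : K) (w : M).

Lemma linextw (X : lmodType C) (f : K -> X) (d : {fset K}) w :
  (msupp w `<=` d)%fset -> linext f w = \sum_(k <- d) mcoeff k w *: f k.
Proof.
move=> h; rewrite /linext (big_fset_incl _ h) // => k _ /mcoeff_outdom ->.
by rewrite scale0r.
Qed.

Lemma linext_linear (X : lmodType C) (f : K -> X) : linear (linext f).
Proof.
move=> c u v.
pose d := (msupp u `|` msupp v `|` msupp (c *: u + v))%fset.
rewrite (@linextw _ _ d) ?fsubsetUr // (@linextw _ _ d u); last first.
  by rewrite /d -fsetUA fsubsetUl.
rewrite (@linextw _ _ d v); last by rewrite /d fsetUAC fsubsetUr.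
rewrite scaler_sumr -big_split; apply: eq_bigr => k _.
by rewrite mcoeffD mcoeffZ scalerDl scalerA.
Qed.

Lemma linext_bvec (X : lmodType C) (f : K -> X) b : linext f (bvec b) = f b.
Proof.
rewrite (@linextw _ _ [fset b]%fset) ?msuppU_le // big_seq_fset1 mcoeffUU.
exact: scale1r.
Qed.

Lemma calM_span w : w = \sum_(k <- msupp w) mcoeff k w *: bvec k.
Proof.
rewrite [LHS]monalgE; apply: eq_bigr => k _; apply/malgP => k'.
rewrite [LHS]mcoeffU. rewrite [RHS]mcoeffZ. rewrite mcoeffU. by rewrite mulr_natr.
Qed.

Lemma calM_fock_space : @fock_space C l M (@bvec R l) (fun b w => mcoeff b w)
  (fun w => msupp w : seq K) (@heis R l).
Proof.
split.
- by move=> b c u v; rewrite mcoeffD mcoeffZ.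
- by move=> b b'; rewrite mcoeffU; case: eqP.
- exact: calM_span.
- by move=> i [[|k]|k]; exact: linext_linear.
- by move=> i b; exact: linext_bvec.
- by move=> i k b; exact: linext_bvec.
- by move=> i k b; exact: linext_bvec.
Qed.

Lemma YseqE vs : @Yseq R l vs = Yword (@heis R l) vs.
Proof. by elim: vs => [//|[i k] vs IH]; rewrite /= IH. Qed.

Lemma YminusE mu : @Yminus R l mu = creator (@heis R l) mu.
Proof. by []. Qed.

Lemma YplusE c mu : @Yplus R l c mu = annihilator (@heis R l) c mu.
Proof. by []. Qed.

Lemma calY_basisE eps b s w : calY_basis eps b s w =
  Ybasis (@heis R l) (@Defs.zpow R l) (eop eps) b s w.
Proof. by rewrite /calY_basis /Yheis YseqE YminusE YplusE. Qed.

Lemma eop_linear' eps mu : linear (@eop R l eps mu).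
Proof. by apply: linear_comp'; exact: linext_linear. Qed.

Lemma calM_lattice_fields eps : @lattice_fields C l M (@bvec R l) (fun b w => mcoeff b w)
  (fun w => msupp w : seq K) (@heis R l) (@Defs.zpow R l) (eop eps) eps (calY eps).
Proof.
split.
- exact: calM_fock_space.
- by move=> al s; exact: linext_linear.
- by move=> al s b; exact: linext_bvec.
- exact: eop_linear'.
- move=> mu b; rewrite /eop /coc linext_bvec /shift_op.
  by rewrite (linearZ' (linext_linear _)) linext_bvec.
- by move=> s w; exact: linext_linear.
- move=> b s w; rewrite [LHS]linext_bvec; exact: calY_basisE.
Qed.

Lemma sectorE (T : set 'rV[C]_l) : @sector R l T =
  @momenta C l M (fun b w => mcoeff b w) T.
Proof.
apply/seteqP; split => w hw b /=; first by rewrite mcoeff_neq0 => /hw.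
by rewrite -mcoeff_neq0 => /hw.
Qed.

Lemma omegaE : @omega R l = conformal_vector (@bvec R l) (@heis R l).
Proof. by []. Qed.

Lemma YgE eps al : @Yg R l eps al = flowed (@heis R l) (@Defs.zpow R l) (calY eps) al.
Proof. by []. Qed.

Lemma eps_cocycle L eps : cocycle_structure L eps ->
  forall a b c : 'rV[C]_l, eps a b * eps (a + b) c = eps b c * eps a (b + c).
Proof.
by move=> h; apply: (eop_cocycle (calM_lattice_fields eps)); exact: (eop_mul h).
Qed.

End Concrete.

Theorem corollary5p2 (R : realType) (l : nat) (L : set 'rV[R]_l)
    (eps : 'rV[R[i]]_l -> 'rV[R[i]]_l -> R[i]) (alpha : 'rV[R[i]]_l)
    (hL : integral_lattice L) (heps : cocycle_structure L eps) :
  let V := lattice_vosa L eps in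
  let g := exp_zero_mode (- two_pi_i R) alpha in
  diagonalizable_automorphism V g /\
  twisted_isomorphic V g
    (lattice_sector L alpha) (calY eps)
    (vosa_space V) (Yg eps alpha).
Proof.
move=> V g.
have HL := calM_lattice_fields eps.
have coc := eps_cocycle heps.
have V_space : vosa_space V = momenta (fun b w => mcoeff b w) (lattice_vec L) by exact: sectorE.
have V_parity p : vosa_parity V p = momenta (fun b w => mcoeff b w) (parity_vec L p).
  exact: sectorE.
have g_linear : linear g by exact: linext_linear.
have g_bvec b : g (bvec b) = cexp (- two_pi_i R * dot alpha b.2) *: bvec b by exact: linext_bvec.
pose g' := linext (fun b : key R l => cexp (- (- two_pi_i R * dot alpha b.2)) *: bvec b).
pose f := linext (fun b : key R l => (eps (b.2 - alpha) alpha)^-1 *: bvec (b.1, b.2 - alpha)).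
pose f' := linext (fun b : key R l => eps b.2 alpha *: bvec (b.1, b.2 + alpha)).
have V_Y : vosa_Y V = calY eps by [].
have V_one : vosa_one V = vertex (@bvec R l) 0 by [].
have V_omega : vosa_omega V = conformal_vector (@bvec R l) (@heis R l) by exact: omegaE.
have g'_linear : linear g' by exact: linext_linear.
have g'_bvec b : g' (bvec b) = cexp (- (- two_pi_i R * dot alpha b.2)) *: bvec b.
  exact: linext_bvec.
have f_linear : linear f by exact: linext_linear.
have f_bvec b : f (bvec b) = (eps (b.2 - alpha) alpha)^-1 *: bvec (b.1, b.2 - alpha).
  exact: linext_bvec.
have f'_linear : linear f' by exact: linext_linear.
have f'_bvec b : f' (bvec b) = eps b.2 alpha *: bvec (b.1, b.2 + alpha).
  exact: linext_bvec.
split.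
  have A := lattice_automorphism HL.
  have A1 := A L alpha V V_space V_Y V_one V_omega.
  have A2 := A1 g g_linear g_bvec g' g'_linear g'_bvec.
  exact: A2.
rewrite YgE /lattice_sector sectorE.
have A := flow_isomorphism HL coc (eps_neq0 heps) (eps_left0 heps).
have A1 := A L alpha hL (eps_comm heps) V V_space V_parity V_Y V_one V_omega.
have A2 := A1 g g_linear g_bvec f f' f_linear f'_linear f_bvec f'_bvec.
exact: A2.
Qed.
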